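(* Let $\tau\geq1$ and let $T=(t_0,t_1,\ldots,t_\tau)$ be a list of steps with $0\le t_0<t_1<\dots<t_\tau=N$, and set $\widetilde T=T_1=(t_1,\ldots,t_\tau)$. Let $D\subseteq\mathbb{R}_{0,t_0}\times\mathbb{R}^\tau$ be as in the context and assume $\Omega_D$ is a domain. Assume $t_1-t_0$ is an odd natural number $2n_1+1$. Then for every strongly $T$-regular function $f\in\mathcal{SR}_T(\Omega_D,A)$, the function $\Delta_{\widetilde T}^{n_1}f$ (called the first Fueter transform of $f$) is strongly $\widetilde T$-regular and is still a $T$-function; in symbols, $\Delta_{\widetilde T}^{n_1}f\in\mathcal{SR}_{\widetilde T}(\Omega_D,A)\cap\mathcal{S}_T^\omega(\Omega_D,A)$.
   Context: Setting. $A$ is a finite-dimensional associative real algebra with unit $1$ and a $*$-involution $x\mapsto x^c$ (an involutive real-linear antiautomorphism). Let $\mathbb S_A=\{x\in A: x+x^c=0,\ xx^c=1\}$, assumed nonempty. $V\subseteq A$ is a real subspace with a hypercomplex basis $\mathcal B=(v_0,\dots,v_N)$, $N\ge1$: $v_0=1$, $v_s\in\mathbb S_A$ for $s\geq1$, $v_sv_t=-v_tv_s$ for distinct $s,t\ge1$, and $V\subseteq\bigcup_{J\in\mathbb S_A}(\mathbb R+J\mathbb R)$. Complete $\mathcal B$ to a real basis of $A$ and give $A$ the Euclidean norm $\|\cdot\|$ making that basis orthonormal; write $x=\sum_{s=0}^Nx_sv_s$ for $x\in V$. For $0\le\ell<m\le N$, $\mathbb R_{\ell,m}=\mathrm{Span}_{\mathbb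 R}(v_\ell,\dots,v_m)$ and $\mathbb S_{\ell,m}$ is its unit sphere. A list of steps $T=(t_0,\dots,t_\tau)$ ($\tau\in\mathbb N$, $0\le t_0<\dots<t_\tau=N$) has torus $\mathbb T=\mathbb S_{t_0+1,t_1}\times\cdots\times\mathbb S_{t_{\tau-1}+1,t_\tau}$. Each $x\in V$ decomposes uniquely as $x=x^0+\dots+x^\tau$ with $x^h=\sum_{s=t_{h-1}+1}^{t_h}x_sv_s$ ($t_{-1}=-1$). For $J=(J_1,\dots,J_\tau)\in\mathbb T$ and $\beta\in\mathbb R^\tau$, $\beta J=\sum_h\beta_hJ_h$; $\mathscr P(\tau)$ is the power set of $\{1,\dots,\tau\}$; $J_\emptyset=1$, $J_K=J_{k_1}\cdots J_{k_p}$ for $K=\{k_1<\dots<k_p\}$; $\overline\beta^h$ is $\beta$ with $\beta_h$ replaced by $-\beta_h$. $T$-functions. $D\subseteq\mathbb R_{0,t_0}\times\mathbb R^\tau$ is open and invariant under $(\alpha,\beta)\mapsto(\alpha,\overline\beta^h)$ for each $h$, and $\Omega_D=\{\alpha+\beta J:(\alpha,\beta)\in D,J\in\mathbb T\}$ is open in $V$. A $T$-stem function is $F=\sum_{K\in\mathscr P(\tau)}E_KF_K:D\to A\otimes\mathbb R^{2^\tau}$ ($E_K$ the canonical basis of $\mathbb R^{2^\tau}$, $F_K:D\to A$) with $F_K(\alpha,\overline\beta^h)=F_K(\alpha,\beta)$ if $h\notin K$ and $=-F_K(\alpha,\beta)$ if $h\in K$. It induces $\mathcal I(F):\Omega_D\to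 A$, $\mathcal I(F)(\alpha+\beta J)=\sum_KJ_KF_K(\alpha,\beta)$; $\mathcal I$ is a well-defined injective right $A$-linear map onto the class $\mathcal S_T(\Omega_D,A)$ of $T$-functions. For $p\in\mathbb N\cup\{\infty,\omega\}$ ($\omega$ = real analytic), $\mathcal S^p_T(\Omega_D,A)$ is the set of $\mathcal I(F)$ with all $F_K\in C^p(D,A)$. Regularity. For $J\in\mathbb T$ let $\mathbb R_J=\mathrm{Span}(v_0,\dots,v_{t_0},J_1,\dots,J_\tau)$; for $\phi$ of class $C^1$ on an open subset of $\mathbb R_J$, $\partial_s\phi$ ($0\le s\le t_0$), $\partial_{t_0+u}\phi$ ($1\le u\le\tau$) are the directional derivatives along $v_s$, $J_u$, and $\overline\partial_J\phi=\sum_{s=0}^{t_0}v_s\partial_s\phi+\sum_{u=1}^\tau J_u\partial_{t_0+u}\phi$. A function $f$ on a domain $\Omega\subseteq V$ is $T$-regular if $\overline\partial_J(f|_{\Omega\cap\mathbb R_J})\equiv0$ for all $J\in\mathbb T$. If $\Omega_D$ is a domain, $\mathcal{SR}_T(\Omega_D,A)$ (strongly $T$-regular functions) is the set of $T$-functions on $\Omega_D$ that are $T$-regular; these are real analytic. Laplacian. Writing $\alpha=\sum_{s=0}^{t_0}x_sv_s$, let $\partial_{\alpha_s}$, $\partial_{\beta_h}$ denote partial derivatives of functions on $D$ with respect to $x_s$, $\beta_h$. For a $T$-stem function $F$ of class $C^2$, $\Delta_TF$ is the $T$-stem function with $(\Delta_TF)_K=\sum_{s=0}^{t_0}\partial_{\alpha_s}^2F_K+\sum_{h=1}^\tau\partial_{\beta_h}^2F_K$,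 and $\Delta_T\mathcal I(F):=\mathcal I(\Delta_TF)$. The same definitions apply to any list of steps $T'$ in place of $T$. Sub-lists. $\widetilde T=(t_1,\dots,t_\tau)$ is a list of steps (torus $\mathbb S_{t_1+1,t_2}\times\cdots$, mirror $\mathbb R_{0,t_1}$), and $\Omega_D=\Omega_{\widetilde D}$ for $\widetilde T$, with $\widetilde D=\{(\alpha+x^1,\beta_2,\dots,\beta_\tau):x^1\in\mathbb R_{t_0+1,t_1},(\alpha,\|x^1\|,\beta_2,\dots,\beta_\tau)\in D\}$. Every element of $\mathcal S^p_T(\Omega_D,A)$, $p\in\{\infty,\omega\}$, is also an element of $\mathcal S^p_{\widetilde T}(\Omega_D,A)$, and $\Delta_{\widetilde T}$ is applied to it in that sense. *)

(* Defs.v *)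
From HB Require Import structures.
From mathcomp Require Import all_boot all_order all_algebra.
From mathcomp Require Import all_classical all_reals all_analysis.
From Stdlib Require Import ClassicalEpsilon.

Unset Printing Implicit Defensive.

Import Order.TTheory GRing.Theory Num.Theory.
Import numFieldNormedType.Exports.
Local Open Scope classical_set_scope.
Local Open Scope ring_scope.

(* The algebra A is modelled on the coordinate space 'rV[R]_d, the coordinates
   being taken in the real basis of A completing the hypercomplex basis.  Its
   multiplication is [mul] and its involution is [conj]. *)

Section Defs.
Variable R : realType.
Variable d : nat.
Local Notation A := 'rV[R]_d.

(* nat-indexed access to the coordinates of a row vector (0 out of range) *)
Definition vc (n : nat) (p : 'rV[R]_n) (k : nat) : R :=
  odflt 0 (omap (fun i : 'I_n => p 0 i) (insub k)).

Definition real_algebra (mul : A -> A -> A) (one : A) : Prop :=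
  [/\ forall (a : R) x y z, mul (a *: x + y) z = a *: mul x z + mul y z,
      forall (a : R) x y z, mul z (a *: x + y) = a *: mul z x + mul z y,
      forall x y z, mul x (mul y z) = mul (mul x y) z &
      forall x, mul one x = x /\ mul x one = x].

Definition star_involution (mul : A -> A -> A) (conj : A -> A) : Prop :=
  [/\ forall (a : R) x y, conj (a *: x + y) = a *: conj x + conj y,
      forall x, conj (conj x) = x &
      forall x y, conj (mul x y) = mul (conj y) (conj x)].

Definition SA (mul : A -> A -> A) (conj : A -> A) (one : A) : set A :=
  [set x | x + conj x = 0 /\ mul x (conj x) = one].

Definition Vspace (N : nat) (v : nat -> A) : set A :=
  [set x | exists c : nat -> R, x = \sum_(s < N.+1) c s *: v s].

Definition hypercomplex_basis (mul : A -> A -> A) (conj : A -> A)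
    (N : nat) (v : nat -> A) : Prop :=
  [/\ (1 <= N)%N,
      (forall c : nat -> R, \sum_(s < N.+1) c s *: v s = 0 ->
          forall s, (s <= N)%N -> c s = 0),
      (forall s, (1 <= s <= N)%N -> SA mul conj (v 0%N) (v s)),
      (forall s t, (1 <= s <= N)%N -> (1 <= t <= N)%N -> s != t ->
          mul (v s) (v t) = - mul (v t) (v s)) &
      (forall x, Vspace N v x -> exists J (a b : R),
          SA mul conj (v 0%N) J /\ x = a *: v 0%N + b *: J)].

Definition steps (N : nat) (ts : seq nat) : Prop :=
  [/\ (0 < size ts)%N, sorted ltn ts & last 0%N ts = N].

Definition t0 (ts : seq nat) : nat := nth 0%N ts 0.
Definition tau (ts : seq nat) : nat := (size ts).-1.
(* dimension of R_{0,t0} x R^tau *)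
Definition dimD (ts : seq nat) : nat := (t0 ts).+1 + tau ts.

(* unit sphere S_{l,m} of R_{l,m} (Euclidean norm making v_l..v_m orthonormal) *)
Definition sphere (v : nat -> A) (l m : nat) : set A :=
  [set x | exists c : nat -> R,
     x = \sum_(l <= s < m.+1) c s *: v s /\ \sum_(l <= s < m.+1) c s ^+ 2 = 1].

(* the torus of ts; J h stands for J_{h+1}, h < tau *)
Definition torus (v : nat -> A) (ts : seq nat) (J : nat -> A) : Prop :=
  forall h, (h < tau ts)%N -> sphere v (nth 0%N ts h).+1 (nth 0%N ts h.+1) (J h).

(* the point alpha + beta J of V, for (alpha, beta) in R_{0,t0} x R^tau *)
Definition pt (v : nat -> A) (ts : seq nat) (J : nat -> A)
    (p : 'rV[R]_(dimD ts)) : A :=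
  \sum_(s < (t0 ts).+1) vc _ p s *: v s
  + \sum_(h < tau ts) vc _ p ((t0 ts).+1 + h) *: J h.

(* (alpha, beta) |-> (alpha, \overline beta^{h+1}) *)
Definition refl (ts : seq nat) (h : nat) (p : 'rV[R]_(dimD ts)) : 'rV[R]_(dimD ts) :=
  \row_i (if val i == ((t0 ts).+1 + h)%N then - p 0 i else p 0 i).

Definition Omega (v : nat -> A) (ts : seq nat) (D : set 'rV[R]_(dimD ts)) : set A :=
  [set x | exists p J, D p /\ torus v ts J /\ x = pt v ts J p].

(* J_K = J_{k1} ... J_{kp}, k1 < ... < kp *)
Definition JK (mul : A -> A -> A) (one : A) (n : nat) (J : nat -> A)
    (K : {set 'I_n}) : A :=
  \big[mul/one]_(k in K) J (val k).

Definition stem (ts : seq nat) (D : set 'rV[R]_(dimD ts))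
    (F : {set 'I_(tau ts)} -> 'rV[R]_(dimD ts) -> A) : Prop :=
  forall K (h : 'I_(tau ts)) p, D p ->
    F K (refl ts h p) = if h \in K then - F K p else F K p.

Definition Ival (mul : A -> A -> A) (v : nat -> A) (ts : seq nat)
    (F : {set 'I_(tau ts)} -> 'rV[R]_(dimD ts) -> A) (J : nat -> A)
    (p : 'rV[R]_(dimD ts)) : A :=
  \sum_(K : {set 'I_(tau ts)}) mul (JK mul (v 0%N) (tau ts) J K) (F K p).

Definition tfun_of (mul : A -> A -> A) (v : nat -> A) (ts : seq nat)
    (D : set 'rV[R]_(dimD ts)) (f : A -> A)
    (F : {set 'I_(tau ts)} -> 'rV[R]_(dimD ts) -> A) : Prop :=
  stem ts D F /\
  forall p J, D p -> torus v ts J -> f (pt v ts J p) = Ival mul v ts F J p.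

(* The function I(F) : Omega_D -> A (0 outside Omega_D), defined by choosing a
   representation x = alpha + beta J. *)
Definition Ical (mul : A -> A -> A) (v : nat -> A) (ts : seq nat)
    (D : set 'rV[R]_(dimD ts))
    (F : {set 'I_(tau ts)} -> 'rV[R]_(dimD ts) -> A) (x : A) : A :=
  let P := fun pJ : 'rV[R]_(dimD ts) * (nat -> A) =>
    D pJ.1 /\ torus v ts pJ.2 /\ x = pt v ts pJ.2 pJ.1 in
  match excluded_middle_informative (exists pJ, P pJ) with
  | left e => let pJ := proj1_sig (constructive_indefinite_description P e) in
              Ival mul v ts F pJ.2 pJ.1
  | right _ => 0
  end.

Definition pd (n : nat) (i : 'I_n) (g : 'rV[R]_n -> A) : 'rV[R]_n -> A :=
  fun p => derive g p (delta_mx 0 i).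

Definition iterpd (n : nat) (s : seq 'I_n) (g : 'rV[R]_n -> A) : 'rV[R]_n -> A :=
  foldr (fun i h => pd n i h) g s.

Definition Ck_on (k n : nat) (U : set 'rV[R]_n) (g : 'rV[R]_n -> A) : Prop :=
  forall (s : seq 'I_n) x, U x -> (size s <= k)%N ->
    {for x, continuous (iterpd n s g)} /\
    ((size s < k)%N -> forall i, derivable (iterpd n s g) x (delta_mx 0 i)).

Definition Cinf_on (n : nat) (U : set 'rV[R]_n) (g : 'rV[R]_n -> A) : Prop :=
  forall k, Ck_on k n U g.

Definition monomial (n k : nat) (s : {ffun 'I_k -> 'I_n}) (h : 'rV[R]_n) : R :=
  \prod_(i < k) h 0 (s i).

Definition analytic_on (n : nat) (U : set 'rV[R]_n) (g : 'rV[R]_n -> A) : Prop :=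
  forall x, U x -> exists r : R, 0 < r /\
    exists c : forall k : nat, {ffun 'I_k -> 'I_n} -> A,
      forall y : 'rV[R]_n, `|y - x| < r ->
        cvg ((fun M : nat => \sum_(k < M) \sum_(s : {ffun 'I_k -> 'I_n})
                 `|c k s| * `|monomial n k s (y - x)|) @ \oo) /\
        (fun M : nat => \sum_(k < M) \sum_(s : {ffun 'I_k -> 'I_n})
                 monomial n k s (y - x) *: c k s) @ \oo --> g y.

Definition S_inf (mul : A -> A -> A) (v : nat -> A) (ts : seq nat)
    (D : set 'rV[R]_(dimD ts)) (f : A -> A) : Prop :=
  exists F, tfun_of mul v ts D f F /\ forall K, Cinf_on (dimD ts) D (F K).

Definition S_omega (mul : A -> A -> A) (v : nat -> A) (ts : seq nat)
    (D : set 'rV[R]_(dimD ts)) (f : A -> A) : Prop :=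
  exists F, tfun_of mul v ts D f F /\ forall K, analytic_on (dimD ts) D (F K).

Definition dirvec (v : nat -> A) (ts : seq nat) (J : nat -> A) (i : nat) : A :=
  if (i < (t0 ts).+1)%N then v i else J (i - (t0 ts).+1)%N.

(* T-regularity on Om: for every J in the torus, the restriction of f to
   Om \cap R_J (read in the coordinates of R_J) is C^1 and
   dbar_J (f|) = sum_s v_s d_s f + sum_u J_u d_{t0+u} f vanishes *)
Definition T_regular (mul : A -> A -> A) (v : nat -> A) (ts : seq nat)
    (Om : set A) (f : A -> A) : Prop :=
  forall J, torus v ts J ->
    let U := [set p : 'rV[R]_(dimD ts) | Om (pt v ts J p)] in
    Ck_on 1 (dimD ts) U (f \o pt v ts J) /\
    forall p, U p ->
      \sum_(i < dimD ts) mul (dirvec v ts J i) (pd (dimD ts) i (f \o pt v ts J) p) = 0.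

Definition SR (mul : A -> A -> A) (v : nat -> A) (ts : seq nat)
    (D : set 'rV[R]_(dimD ts)) (f : A -> A) : Prop :=
  (exists F, tfun_of mul v ts D f F) /\ T_regular mul v ts (Omega v ts D) f.

Definition lap (n : nat) (g : 'rV[R]_n -> A) : 'rV[R]_n -> A :=
  fun p => \sum_(i < n) pd n i (pd n i g) p.

Definition lapS (ts : seq nat)
    (F : {set 'I_(tau ts)} -> 'rV[R]_(dimD ts) -> A) :
    {set 'I_(tau ts)} -> 'rV[R]_(dimD ts) -> A :=
  fun K => lap (dimD ts) (F K).

(* a point q = (alpha + x^1, beta_2, ..., beta_tau) of R_{0,t1} x R^{tau-1}
   gives the point (alpha, ||x^1||, beta_2, ..., beta_tau) of R_{0,t0} x R^tau *)
Definition down (ts : seq nat) (q : 'rV[R]_(dimD (behead ts))) : 'rV[R]_(dimD ts) :=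
  \row_(i < dimD ts)
    (if (i < (t0 ts).+1)%N then vc _ q i
     else if val i == (t0 ts).+1 then
       Num.sqrt (\sum_((t0 ts).+1 <= s < (nth 0%N ts 1).+1) vc _ q s ^+ 2)
     else vc _ q ((nth 0%N ts 1).+1 + (i - (t0 ts).+2))%N).

Definition Dtilde (ts : seq nat) (D : set 'rV[R]_(dimD ts)) :
    set 'rV[R]_(dimD (behead ts)) :=
  [set q | D (down ts q)].

Definition domain_in (V : set A) (Om : set A) : Prop :=
  Om `<=` V /\
  (forall x, Om x -> exists e : R, 0 < e /\
      forall y, V y -> `|y - x| < e -> Om y) /\
  connected Om.

End Defs.

(* Main.v *)
(** Fix J in the torus of (t_1, ..., t_tau) and let x1 be the component of a
    point in the block t_0 + 1, ..., t_1.  A T-function reads u = P + x1 Q, where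
    P and Q depend on x1 only through its norm and are even in it.  If it is
    T-regular, its stem components are harmonic, whence Q, the quotient of an odd
    harmonic function by |x1|, solves the Euler-Poisson-Darboux equation with
    parameter 3, and comparing the two Cauchy-Riemann operators gives
    dbar u = (1 - m) Q with m = 2 n_1 + 1 the dimension of the block.  Each
    Laplacian divides the radial derivative of Q by |x1| and multiplies it by one
    of the factors m - 3, m - 5, ..., so that n_1 of them kill Q; the Laplacian
    commutes with dbar, hence dbar (Delta^n_1 u) = 0.  The Laplacian preserves the
    form P + x1 Q, hence the property of being a T-function.

    Smoothness and analyticity are those of C^1 solutions of an elliptic system
    with constant coefficients: Steklov averages reduce to C^3 solutions, for which
    Bernstein's maximum principle argument bounds the gradient, and iterating that
    bound on shrinking balls gives M C^k k! for the derivatives of order k. *)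

Require Import Defs.
From HB Require Import structures.
From mathcomp Require Import all_boot all_order all_algebra.
From mathcomp Require Import all_classical all_reals all_analysis.
From mathcomp Require Import ring lra zify.

Import Order.TTheory GRing.Theory Num.Theory.
Import numFieldNormedType.Exports.
Local Open Scope classical_set_scope.
Local Open Scope ring_scope.

Set Implicit Arguments.
Unset Strict Implicit.
Unset Printing Implicit Defensive.

(** * Continuously differentiable functions of a row vector *)

(** Write B for (1/b) d/db. The parameter 3 comes from the second derivative of b Q along b, which
    is b (3 B Q + b^2 B^2 Q). Applying B raises the parameter by 2, while the Laplacian of a
    function of the norm of m variables has parameter m. Comparing the two for B^j Q leaves the
    factor m - 3 - 2j, which is zero for j = n_1 - 1. For n_1 = 0 no Laplacian is applied, and it is
    the factor 1 - m that vanishes.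

    The obstacle is the map to (alpha, |x1|, beta), which is not differentiable where x1 = 0.
    Smoothness is therefore carried by functions even in b: B preserves them, and their composition
    with the norm is smooth. Analyticity in the T-variables passes through linear sections of that
    map instead, as factorial bounds on derivatives, which survive sums, matrices and coordinate
    maps.

    T-regularity speaks of f on the slices and not of its stem components; these are recovered from
    a single J, by parity projections and left inverses of the J_K. *)

Section DirectionalDerivatives.
Variable R : realType.

Lemma line_is_derive (V W : normedModType R) (g : V -> W) x v dg :
  is_derive x v g dg <-> is_derive (0 : R) 1 (fun h : R => g (h *: v + x)) dg.
Proof.
have E : (fun h : R => h^-1 *: (((fun h : R => g (h *: v + x)) \o shift 0) (h *: 1)
      - (fun h : R => g (h *: v + x)) 0)) =
    (fun h => h^-1 *: ((g \o shift x) (h *: v) - g x)).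
  by apply/funext => h /=; rewrite addr0 scale0r add0r [_%:A]mulr1.
split=> -[H1 H2].
- by split; [rewrite /derivable E | rewrite /derive E].
- by split; [move: H1; rewrite /derivable E | move: H2; rewrite /derive E].
Qed.

Lemma is_derive_line_at (V W : normedModType R) (g : V -> W) x v (t : R) dg :
  is_derive (t *: v + x) v g dg ->
  is_derive t 1 (fun h : R => g (h *: v + x)) dg.
Proof.
have E : (fun h : R => h^-1 *: (((fun h : R => g (h *: v + x)) \o shift t) (h *: 1)
      - (fun h : R => g (h *: v + x)) t)) =
    (fun h => h^-1 *: ((g \o shift (t *: v + x)) (h *: v) - g (t *: v + x))).
  by apply/funext => h /=; rewrite [_%:A]mulr1 scalerDl addrA.
by move=> [H1 H2]; split; [rewrite /derivable E | rewrite /derive E].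
Qed.

Lemma is_derive1_compW (W : normedModType R) (f : R -> W) (p : R -> R) t df dp :
  is_derive (p t) 1 f df -> is_derive t 1 p dp ->
  is_derive t 1 (f \o p) (dp *: df).
Proof.
move=> [fd fE] [pd pE].
have Df := (derivable1_diffP _ _).1 fd; have Dp := (derivable1_diffP _ _).1 pd.
have Dc := differentiable_comp Dp Df.
split; first exact/derivable1_diffP.
rewrite deriveE // diff_comp //=.
have -> : 'd p t 1 = dp by rewrite -deriveE.
by rewrite -[in LHS](mulr1 dp) -[dp * 1]/(dp *: 1) linearZ /= -deriveE // fE.
Qed.

(** Chain rule for an inner map that, along [v], moves only along the fixed direction [w]. It uses
    directional derivatives only, and [p] may be nonlinear: besides coordinate changes it covers
    [dn], where [p] involves a square root. *)
Lemma is_derive_comp_line (V V' W : normedModType R) (g : V' -> W) (l : V -> V')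
    (p : R -> R) x v w dg dp :
  (\forall h \near (0 : R), l (h *: v + x) = p h *: w + l x) -> p 0 = 0 ->
  is_derive (0 : R) 1 p dp -> is_derive (l x) w g dg ->
  is_derive x v (g \o l) (dp *: dg).
Proof.
move=> hl p0 hp /line_is_derive hg; apply/line_is_derive.
apply: (@near_eq_is_derive _ _ _ ((fun h => g (h *: w + l x)) \o p)).
  by near=> h => /=; congr g; apply/esym; near: h.
by apply: is_derive1_compW => //; rewrite p0.
Unshelve. all: by end_near. Qed.

Lemma is_deriveZW (V W : normedModType R) (f : V -> R) (g : V -> W) x v df dg :
  is_derive x v f df -> is_derive x v g dg ->
  is_derive x v (fun y => f y *: g y) (f x *: dg + df *: g x).
Proof.
move=> [fd fE] [gd gE].
suff H : (fun h => h^-1 *: (((fun y => f y *: g y) \o shift x) (h *: v)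
            - f x *: g x)) @ 0^' --> f x *: dg + df *: g x.
  by split; [apply/cvg_ex; eexists; exact: H | exact: cvg_lim H].
have Hf : (fun h => h^-1 *: ((f \o shift x) (h *: v) - f x)) @ 0^' --> df.
  by rewrite -fE; exact: fd.
have Hg : (fun h => h^-1 *: ((g \o shift x) (h *: v) - g x)) @ 0^' --> dg.
  by rewrite -gE; exact: gd.
have Hid : (fun h : R => h) @ 0^' --> (0 : R) by exact: cvg_within.
(* The continuity of [f] along the line is read off its difference quotient. *)
have H1 : (fun h => f x + h * (h^-1 *: ((f \o shift x) (h *: v) - f x))) @ 0^'
   --> f x.
  rewrite -[X in _ --> X](addr0 (f x)) -[in X in _ --> X](mul0r df).
  apply: cvgD; first exact: cvg_cst.
  exact: cvgM.
apply: cvg_trans (cvgD (cvgZ H1 Hg) (cvgZ Hf (cvg_cst (g x)))).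
apply: near_eq_cvg; near=> h => /=.
have h0 : h != 0 by near: h; exact: nbhs_dnbhs_neq.
set a := f (h *: v + x); set b := g (h *: v + x).
rewrite fctE -/a -/b [h * (_ *: _)]mulrA mulfV // mul1r (addrC (f x)) subrK.
rewrite scalerA mulrC -scalerA -[(_ *: (a - f x)) *: _]scalerA -scalerDr.
congr (_ *: _).
by rewrite scalerBr scalerBl addrA subrK.
Unshelve. all: by end_near. Qed.

Lemma cvg_sumr (W : normedModType R) (T : Type) (F : set_system T)
    {FF : Filter F} (I : Type) (r : seq I) (P : pred I) (f : I -> T -> W) l :
  (forall i, P i -> f i x @[x --> F] --> l i) ->
  \sum_(i <- r | P i) f i x @[x --> F] --> \sum_(i <- r | P i) l i.
Proof. by move=> H; apply: cvg_big => //; exact: add_continuous. Qed.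

Lemma continuous_mulmxr (d d' : nat) (M : 'M[R]_(d, d')) :
  continuous (fun x : 'rV[R]_d => x *m M).
Proof.
have E : (fun x : 'rV[R]_d => x *m M) = fun x => \sum_j (x 0 j) *: row j M.
  by apply/funext => x; rewrite mulmx_sum_row.
rewrite E => x; apply: (@cvg_sumr _ _ (nbhs x)) => j _; apply: cvgZ; last exact: cvg_cst.
exact: coord_continuous.
Qed.

Lemma is_derive_mulmxr (V : normedModType R) (d d' : nat) (M : 'M[R]_(d, d'))
    (g : V -> 'rV[R]_d) x v dg :
  is_derive x v g dg -> is_derive x v (fun y => g y *m M) (dg *m M).
Proof.
move=> [gd gE].
have Hg : (fun h => h^-1 *: ((g \o shift x) (h *: v) - g x)) @ 0^' --> dg.
  by rewrite -gE; exact: gd.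
suff H : (fun h => h^-1 *: (((fun y => g y *m M) \o shift x) (h *: v)
            - g x *m M)) @ 0^' --> dg *m M.
  by split; [apply/cvg_ex; eexists; exact: H | exact: cvg_lim H].
apply: cvg_trans (continuous_cvg _ (@continuous_mulmxr _ _ M dg) Hg).
by apply: near_eq_cvg; near=> h => /=;
  rewrite -scalemxAl mulmxBl.
Unshelve. all: by end_near. Qed.

Lemma is_derive_row (V : normedModType R) (d : nat) (g : V -> 'rV[R]_d) x v dg :
  is_derive x v g dg <-> forall j, is_derive x v (fun y => g y 0 j) (dg 0 j).
Proof.
split=> [[gd gE] j|H].
  split; first by move/derivable_mxP: gd.
  by rewrite -gE derive_mx // mxE.
have gd : derivable g x v.
  by apply/derivable_mxP => i j; rewrite ord1; have [] := H j.
split=> //; rewrite derive_mx //; apply/matrixP => i j; rewrite ord1 mxE.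
by have [_ ->] := H j.
Qed.

End DirectionalDerivatives.

(* Locked: otherwise failing unifications unfold it down to filters. *)
HB.lock Definition partial (R : realType) (n : nat) (W : normedModType R) (i : 'I_n)
    (g : 'rV[R]_n -> W) : 'rV[R]_n -> W :=
  fun p => 'D_(delta_mx 0 i) g p.

Lemma partialE (R : realType) (n : nat) (W : normedModType R) i (g : 'rV[R]_n -> W) x :
  partial i g x = 'D_(delta_mx 0 i) g x.
Proof. by rewrite partial.unlock. Qed.

Lemma partial_val (R : realType) (n : nat) (W : normedModType R) i
    (g : 'rV[R]_n -> W) x dg :
  is_derive x (delta_mx 0 i) g dg -> partial i g x = dg.
Proof. by rewrite partialE; case. Qed.

Lemma partial_pd (R : realType) (d n : nat) (i : 'I_n) (g : 'rV[R]_n -> 'rV[R]_d) :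
  pd R d n i g = partial i g.
Proof. by apply/funext => x; rewrite partialE. Qed.

Section ContinuouslyDifferentiable.
Variables (R : realType) (n : nat).
Local Notation V := 'rV[R]_n.
Local Notation "''e_' i" := (delta_mx 0 i : 'rV[R]_n) (at level 8, i at level 2, format "''e_' i").

(** Recursive in [k] so that closure properties go by induction, differentiating once; [Ck_onP]
    identifies it with [Ck_on]. *)
Fixpoint Ck (W : normedModType R) (k : nat) (U : set V) (g : V -> W) : Prop :=
  (forall x, U x -> {for x, continuous g}) /\
  if k is k'.+1 then
    forall i, (forall x, U x -> derivable g x 'e_i) /\ Ck k' U (partial i g)
  else True.

Definition Cinf (W : normedModType R) (U : set V) (g : V -> W) : Prop :=
  forall k, Ck k U g.

Section Basic.
Variable W : normedModType R.
Implicit Types (U : set V) (g : V -> W).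

Lemma Ck_cont k U g x : Ck k U g -> U x -> {for x, continuous g}.
Proof. by case: k => [|k] [H _]; exact: H. Qed.

Lemma Ck_derivable k U g x i : Ck k.+1 U g -> U x -> derivable g x 'e_i.
Proof. by move=> [_ /(_ i)[H _]]; exact: H. Qed.

Lemma Ck_is_derive k U g x i : Ck k.+1 U g -> U x ->
  is_derive x 'e_i g (partial i g x).
Proof. by move=> gk Ux; rewrite partialE; apply: derivableP; exact: Ck_derivable gk Ux. Qed.

Lemma Ck_partial k U g i : Ck k.+1 U g -> Ck k U (partial i g).
Proof. by move=> [_ /(_ i)[_ H]]. Qed.

Lemma CkS_intro k U g : (forall x, U x -> {for x, continuous g}) ->
  (forall i x, U x -> derivable g x 'e_i) -> (forall i, Ck k U (partial i g)) ->
  Ck k.+1 U g.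
Proof. by move=> H1 H2 H3; split=> // i; split => //; exact: H2. Qed.

Lemma CkW k U g : Ck k.+1 U g -> Ck k U g.
Proof.
elim: k g => [|k IH] g [H1 H2]; first by split.
by split=> // i; have [H3 H4] := H2 i; split=> //; exact: IH.
Qed.

Lemma Ck_le k m U g : (k <= m)%N -> Ck m U g -> Ck k U g.
Proof.
move=> /subnK <-; elim: (m - k)%N => [//|j IH]; rewrite addSn => /CkW; exact: IH.
Qed.

Lemma Ck_sub k U U' g : U' `<=` U -> Ck k U g -> Ck k U' g.
Proof.
move=> UU; elim: k g => [|k IH] g [H1 H2]; first by split=> // x /UU; exact: H1.
split=> [x /UU|i]; first exact: H1.
by have [H3 H4] := H2 i; split=> [x /UU|]; [exact: H3|exact: IH].
Qed.

(** Continuity and derivability at a point refer to the ambient space and not to [U], so [Ck] is a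
    conjunction over the points of [U], even when [U] is a singleton. *)
Lemma Ck_pointwise k U g : (forall x, U x -> Ck k [set x] g) -> Ck k U g.
Proof.
elim: k g => [|k IH] g H; first by split=> // x /H[+ _]; exact.
split=> [x /H[+ _]|i]; first exact.
split=> [x /H[_ /(_ i)[+ _]]|]; first exact.
by apply: IH => x /H[_ /(_ i)[_]].
Qed.

Lemma Ck_local k U g :
  (forall x, U x -> exists2 U' : set V, U' x & Ck k U' g) -> Ck k U g.
Proof.
by move=> H; apply: Ck_pointwise => x /H[U' U'x]; apply: Ck_sub => _ ->.
Qed.

Lemma eq_partial U g g' i x : open U -> U x -> (forall x, U x -> g x = g' x) ->
  partial i g x = partial i g' x.
Proof.
move=> oU Ux E; rewrite !partialE; apply: near_eq_derive.
by apply: filterS (open_nbhs_nbhs (conj oU Ux)) => y; exact: E.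
Qed.

Lemma cont_eq_open U g g' x : open U -> U x -> (forall x, U x -> g x = g' x) ->
  {for x, continuous g} -> {for x, continuous g'}.
Proof.
move=> oU Ux E H; rewrite /prop_for /continuous_at -E //.
apply: cvg_trans H; apply: (@near_eq_cvg _ _ (nbhs x)).
by apply: filterS (open_nbhs_nbhs (conj oU Ux)) => y /E ->.
Qed.

Lemma Ck_eq k U g g' : open U -> (forall x, U x -> g x = g' x) ->
  Ck k U g -> Ck k U g'.
Proof.
move=> oU; elim: k g g' => [|k IH] g g' E [H1 H2].
  by split=> // x Ux; apply: (cont_eq_open oU Ux E); exact: H1.
split=> [x Ux|i]; first by apply: (cont_eq_open oU Ux E); exact: H1.
have [H3 H4] := H2 i; split=> [x Ux|].
  apply: near_eq_derivable (H3 _ Ux).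
  by apply: filterS (open_nbhs_nbhs (conj oU Ux)) => y /E ->.
by apply: (IH (partial i g)) => // x Ux; exact: (eq_partial i oU Ux).
Qed.

Lemma CkS_is_derive k U g (dg : 'I_n -> V -> W) : open U ->
  (forall x, U x -> {for x, continuous g}) ->
  (forall i x, U x -> is_derive x 'e_i g (dg i x)) ->
  (forall i, Ck k U (dg i)) -> Ck k.+1 U g.
Proof.
move=> oU H1 H2 H3; apply: CkS_intro => //.
  by move=> i x Ux; have [] := H2 i x Ux.
move=> i.
by apply: Ck_eq (H3 i) => // x Ux; rewrite (partial_val (H2 i _ Ux)).
Qed.

Lemma Ck_cst k U (a : W) : Ck k U (fun=> a).
Proof.
elim: k a => [|k IH] a; first by split=> // x _; exact: cst_continuous.
apply: CkS_intro => [x _|i x _|i]; [exact: cst_continuous|exact: derivable_cst|].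
rewrite (_ : partial i _ = fun=> 0); first exact: IH.
by apply/funext => x; rewrite partialE derive_cst.
Qed.

Lemma CkD k U g g' : open U -> Ck k U g -> Ck k U g' ->
  Ck k U (fun x => g x + g' x).
Proof.
move=> oU; elim: k g g' => [|k IH] g g' Hg Hg'.
  split=> // x Ux.
  exact: (continuousD (Ck_cont Hg Ux) (Ck_cont Hg' Ux)).
apply: (CkS_is_derive (dg := fun i x => partial i g x + partial i g' x)) => //.
- move=> x Ux.
  exact: (continuousD (Ck_cont Hg Ux) (Ck_cont Hg' Ux)).
- move=> i x Ux.
  by apply: is_deriveD; [exact: (Ck_is_derive _ Hg)|exact: (Ck_is_derive _ Hg')].
- by move=> i; apply: IH; exact: Ck_partial.
Qed.

Lemma Ck_sum k U (I : Type) (r : seq I) (P : pred I) (g : I -> V -> W) : open U ->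
  (forall i, P i -> Ck k U (g i)) -> Ck k U (fun x => \sum_(i <- r | P i) g i x).
Proof.
move=> oU H; elim: r => [|a r IH].
  by rewrite (_ : (fun _ => _) = fun=> 0);
    [exact: Ck_cst|apply/funext => x; rewrite big_nil].
have [Pa|Pa] := boolP (P a); last first.
  by apply: Ck_eq IH => // x _; rewrite big_cons (negbTE Pa).
by apply: Ck_eq (CkD oU (H _ Pa) IH) => // x _; rewrite big_cons Pa.
Qed.

End Basic.
Arguments Ck_derivable {W k U g x} i _ _.
Arguments Ck_is_derive {W k U g x} i _ _.
Arguments Ck_partial {W k U g} i _.

Lemma CkZ (W : normedModType R) k U (f : V -> R) (g : V -> W) : open U ->
  Ck k U f -> Ck k U g -> Ck k U (fun x => f x *: g x).
Proof.
move=> oU; elim: k f g => [|k IH] f g Hf Hg.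
  split=> // x Ux.
  exact: (continuousZ (Ck_cont Hf Ux) (Ck_cont Hg Ux)).
apply: (CkS_is_derive (dg := fun i x => f x *: partial i g x + partial i f x *: g x)) => //.
- move=> x Ux.
  exact: (continuousZ (Ck_cont Hf Ux) (Ck_cont Hg Ux)).
- move=> i x Ux.
  by apply: is_deriveZW; [exact: (Ck_is_derive _ Hf)|exact: (Ck_is_derive _ Hg)].
- move=> i; apply: CkD => //; apply: IH; try exact: CkW; exact: Ck_partial.
Qed.

Lemma CkZc (W : normedModType R) k U (a : R) (g : V -> W) : open U ->
  Ck k U g -> Ck k U (fun x => a *: g x).
Proof. by move=> oU; apply: CkZ => //; exact: Ck_cst. Qed.

Lemma CkN (W : normedModType R) k U (g : V -> W) : open U ->
  Ck k U g -> Ck k U (fun x => - g x).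
Proof.
move=> oU /(CkZc (-1) oU); apply: Ck_eq => // x _; exact: scaleN1r.
Qed.

Lemma CkB (W : normedModType R) k U (g g' : V -> W) : open U ->
  Ck k U g -> Ck k U g' -> Ck k U (fun x => g x - g' x).
Proof. by move=> oU Hg Hg'; apply: CkD => //; exact: CkN. Qed.

Lemma is_derive_coord i j (x : V) :
  is_derive x 'e_i (fun y : V => y 0 j) ((j == i)%:R : R).
Proof.
have := (is_derive_row id x 'e_i 'e_i).1 (is_derive_id _ _) j.
by rewrite mxE eqxx.
Qed.

Lemma Ck_coord k U j : open U -> Ck k U (fun x : V => x 0 j).
Proof.
move=> oU; case: k => [|k].
  by split=> // x _; exact: coord_continuous.
apply: (CkS_is_derive (dg := fun i _ => (j == i)%:R : R)) => //.
- by move=> x _; exact: coord_continuous.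
- by move=> i x _; exact: is_derive_coord.
- by move=> i; exact: Ck_cst.
Qed.

Lemma continuous_row (T : topologicalType) (d : nat) (g : T -> 'rV[R]_d) (x : T) :
  {for x, continuous g} <-> forall j, {for x, continuous (fun y => g y 0 j)}.
Proof.
split=> [H j|H].
  exact: (continuous_comp H (@coord_continuous _ _ _ 0 j (g x))).
have -> : g = fun y => \sum_j (g y 0 j) *: delta_mx 0 j.
  by apply/funext => y; rewrite -row_sum_delta.
apply: (@cvg_sumr _ _ _ (nbhs x)) => j _; apply: cvgZ; last exact: cvg_cst.
exact: H.
Qed.

Lemma Ck_row (d : nat) k U (g : V -> 'rV[R]_d) : open U ->
  Ck k U g <-> forall j, Ck k U (fun y => g y 0 j).
Proof.
move=> oU; split; last first.
  move=> H.
  have H' : Ck k U (fun y => \sum_j g y 0 j *: (delta_mx 0 j : 'rV[R]_d)).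
    by apply: Ck_sum => // j _; apply: CkZ => //; exact: Ck_cst.
  by apply: Ck_eq H' => // x _; rewrite -row_sum_delta.
elim: k g => [|k IH] g Hg j.
  by split=> // x /(Ck_cont Hg) /continuous_row.
apply: (CkS_is_derive (dg := fun i x => partial i g x 0 j)) => //.
- by move=> x /(Ck_cont Hg) /continuous_row.
- by move=> i x Ux; have /is_derive_row := Ck_is_derive i Hg Ux; apply.
- by move=> i; apply: IH; exact: Ck_partial.
Qed.

Lemma continuous_mulmxr_comp (T : topologicalType) (d d' : nat) (M : 'M[R]_(d, d'))
    (h : T -> 'rV[R]_d) x :
  {for x, continuous h} -> {for x, continuous (fun x => h x *m M)}.
Proof.
move=> hc; have Cx := @continuous_mulmxr R d d' M (h x).
exact: (@continuous_cvg _ _ _ (nbhs x) _ h _ (h x) Cx hc).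
Qed.

Lemma Ck_mulmxr (d d' : nat) k U (M : 'M[R]_(d, d')) (g : V -> 'rV[R]_d) :
  open U -> Ck k U g -> Ck k U (fun x => g x *m M).
Proof.
move=> oU; elim: k g => [|k IH] g Hg.
  split; last by [].
  by move=> x Ux; apply: continuous_mulmxr_comp; exact: (Ck_cont Hg Ux).
apply: (CkS_is_derive (dg := fun i x => partial i g x *m M) oU).
- by move=> x Ux; apply: continuous_mulmxr_comp; exact: (Ck_cont Hg Ux).
- by move=> i x Ux; apply: is_derive_mulmxr; exact: (Ck_is_derive _ Hg).
- by move=> i; apply: IH; exact: Ck_partial.
Qed.

Lemma Ck_inv k U (f : V -> R) : open U -> (forall x, U x -> f x != 0) ->
  Ck k U f -> Ck k U (fun x => (f x)^-1).
Proof.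
move=> oU f0; elim: k => [|k IH] Hf.
  by split=> // x Ux; exact: (continuousV (f0 _ Ux) (Ck_cont Hf Ux)).
apply: (CkS_is_derive (dg := fun i x => - ((f x)^-1 *: ((f x)^-1 *: partial i f x)))) => //.
- by move=> x Ux; exact: (continuousV (f0 _ Ux) (Ck_cont Hf Ux)).
- move=> i x Ux; have fd := Ck_derivable i Hf Ux.
  split; first exact: derivableV (f0 _ Ux) fd.
  rewrite (deriveV (f0 _ Ux) fd) partialE scaleNr; congr (- _).
  by rewrite /GRing.scale /= mulrA expr2 invfM.
- move=> i; have Hf' := IH (CkW Hf).
  by apply: CkN => //; apply: CkZ => //; apply: CkZ => //; exact: Ck_partial.
Qed.

End ContinuouslyDifferentiable.
Arguments Ck_derivable {R n W k U g x} i _ _.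
Arguments Ck_is_derive {R n W k U g x} i _ _.
Arguments Ck_partial {R n W k U g} i _.

Lemma is_derive_comp_coord (R : realType) (m n : nat) (W : normedModType R)
    (l : 'rV[R]_m -> 'rV[R]_n) (i : 'I_m) (j : 'I_n) (c : R) (g : 'rV[R]_n -> W) x dg :
  (forall h, l (h *: delta_mx 0 i + x) = (h * c) *: delta_mx 0 j + l x) ->
  is_derive (l x) (delta_mx 0 j) g dg ->
  is_derive x (delta_mx 0 i) (g \o l) (c *: dg).
Proof.
move=> hl; apply: (@is_derive_comp_line _ _ _ _ _ _ (fun h => h * c)).
- by near=> h; exact: hl.
- by rewrite mul0r.
- have := @is_deriveM _ _ (fun x : R => x) (fun=> c) (0 : R) 1 1 0 (is_derive_id _ _) (is_derive_cst _ _ _).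
  by move=> H; apply: is_derive_eq; rewrite scaler0 add0r [_ *: _]mulr1.
Unshelve. all: by end_near. Qed.

(** Since [l] sends coordinate directions to multiples of coordinate directions, a partial
    derivative of [g \o l] is a multiple of a partial derivative of [g] composed with [l], and the
    induction closes without a general chain rule. *)
Lemma Ck_comp_coord (R : realType) (m n : nat) (W : normedModType R)
    (l : 'rV[R]_m -> 'rV[R]_n) (s : 'I_m -> 'I_n) (c : 'I_m -> R) k U U'
    (g : 'rV[R]_n -> W) :
  (forall i x h, l (h *: delta_mx 0 i + x) = (h * c i) *: delta_mx 0 (s i) + l x) ->
  continuous l -> open U -> open U' -> (forall x, U' x -> U (l x)) ->
  Ck k U g -> Ck k U' (g \o l).
Proof.
move=> hl cl oU oU' UU; elim: k g => [|k IH] g Hg.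
  split=> // x /UU Ux; exact: (continuous_comp (cl x) (Ck_cont Hg Ux)).
apply: (CkS_is_derive (dg := fun i x => c i *: partial (s i) g (l x))) => //.
- move=> x /UU Ux; exact: (continuous_comp (cl x) (Ck_cont Hg Ux)).
- move=> i x /UU Ux; apply: is_derive_comp_coord (hl i x) _.
  exact: (Ck_is_derive _ Hg).
- by move=> i; apply: CkZc => //; apply: (IH (partial (s i) g)); exact: Ck_partial.
Qed.

(** * Mean values, and limits in terms of distances *)

Section MeanValue.
Variable R : realType.

(** The segment is parametrised by [s] in the unit interval, so that both signs of [t] are covered
    at once. *)
Lemma MVT_dir_open (V : normedModType R) (g dg : V -> R) x v (t : R) :
  (forall s : R, 0 <= s <= 1 ->
     is_derive ((s * t) *: v + x) v g (dg ((s * t) *: v + x))) ->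
  exists2 s : R, 0 < s < 1 & g (t *: v + x) - g x = t * dg ((s * t) *: v + x).
Proof.
move=> H.
pose phi := (fun h : R => g (h *: v + x)) \o (fun s : R => s * t).
have Hphi (s : R) : 0 <= s <= 1 -> is_derive s 1 phi (t * dg ((s * t) *: v + x)).
  move=> /H Hs; apply: is_derive1_compW; first exact: is_derive_line_at.
  have := @is_deriveM _ _ (fun x : R => x) (fun=> t) s 1 1 0
    (is_derive_id _ _) (is_derive_cst _ _ _).
  by move=> ?; apply: is_derive_eq; rewrite scaler0 add0r [_ *: _]mulr1.
have [||s] := @MVT R phi (fun s => t * dg ((s * t) *: v + x)) 0 1 ltr01.
- by move=> s; rewrite in_itv /= => /andP[s0 s1]; apply: Hphi; rewrite !ltW.
- apply: derivable_within_continuous => s; rewrite in_itv /= => s01.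
  by have [] := Hphi s s01.
rewrite in_itv /= => s01; rewrite /phi /= mul1r mul0r scale0r add0r subr0 mulr1.
by move=> E; exists s.
Qed.

Lemma MVT_dir (V : normedModType R) (g dg : V -> R) x v (t : R) :
  (forall s : R, 0 <= s <= 1 ->
     is_derive ((s * t) *: v + x) v g (dg ((s * t) *: v + x))) ->
  exists2 s : R, 0 <= s <= 1 & g (t *: v + x) - g x = t * dg ((s * t) *: v + x).
Proof.
move=> /MVT_dir_open[s /andP[s0 s1] E].
by exists s => //; rewrite !ltW.
Qed.

Lemma continuous_distP (V W : normedModType R) (g : V -> W) x :
  {for x, continuous g} <->
  forall e : R, 0 < e ->
    exists2 r : R, 0 < r & forall y, `|y - x| < r -> `|g y - g x| < e.
Proof.
split=> [/cvgrPdist_lt H e /H /nbhs_ballP[r r0 Hr]|H].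
  exists r => // y yx; rewrite distrC; apply: Hr.
  by rewrite -ball_normE /ball_ /= distrC.
apply/cvgrPdist_lt => e /H[r r0 Hr]; apply/nbhs_ballP; exists r => // y.
by rewrite -ball_normE /ball_ /= distrC => /Hr; rewrite distrC.
Qed.

Lemma is_derive_distP (V W : normedModType R) (g : V -> W) x v dg :
  (forall e : R, 0 < e -> exists2 r : R, 0 < r &
     forall h : R, h != 0 -> `|h| < r ->
       `|h^-1 *: (g (h *: v + x) - g x) - dg| < e) ->
  is_derive x v g dg.
Proof.
move=> H.
suff C : (fun h => h^-1 *: ((g \o shift x) (h *: v) - g x)) @ 0^' --> dg.
  by split; [apply/cvg_ex; exists dg; exact: C|exact: cvg_lim C].
apply/cvgrPdist_lt => e /H[r r0 Hr]; near=> h => /=; rewrite distrC.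
apply: Hr; first by near: h; exact: nbhs_dnbhs_neq.
by near: h; exact: dnbhs0_lt.
Unshelve. all: by end_near. Qed.

Lemma is_derive_dist (V W : normedModType R) (g : V -> W) x v dg :
  is_derive x v g dg -> forall e : R, 0 < e -> exists2 r : R, 0 < r &
     forall h : R, h != 0 -> `|h| < r ->
       `|h^-1 *: (g (h *: v + x) - g x) - dg| < e.
Proof.
move=> [gd gE] e e0.
have Hg : (fun h => h^-1 *: ((g \o shift x) (h *: v) - g x)) @ 0^' --> dg.
  by rewrite -gE; exact: gd.
have [r /= r0 Hr] := (cvgrPdist_lt _ _).1 Hg _ e0.
exists r => // h h0 hr; rewrite distrC; apply: Hr => //.
by rewrite /ball_ /= sub0r normrN.
Qed.

Lemma open_distP (V : normedModType R) (U : set V) x : open U -> U x ->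
  exists2 r : R, 0 < r & forall y, `|y - x| < r -> U y.
Proof.
move=> oU Ux; have /nbhs_ballP[r r0 Hr] := open_nbhs_nbhs (conj oU Ux).
by exists r => // y yx; apply: Hr; rewrite -ball_normE /ball_ /= distrC.
Qed.

Lemma open_dist (V : normedModType R) (U : set V) :
  (forall x, U x -> exists2 r : R, 0 < r & forall y, `|y - x| < r -> U y) -> open U.
Proof.
move=> H; rewrite openE => x /H[r r0 Hr]; apply/nbhs_ballP; exists r => // y.
by rewrite -ball_normE /ball_ /= distrC => /Hr.
Qed.

Lemma open_normball (V : normedModType R) (x : V) (r : R) :
  open [set y | `|y - x| < r].
Proof.
apply: open_dist => y /= yr; exists (r - `|y - x|); first by rewrite subr_gt0.
move=> z zy /=; rewrite -(subrKA y) (le_lt_trans (ler_normD _ _)) //.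
by rewrite -ltrBrDr.
Qed.

(** The increment is split into a leg along [w], controlled by the derivative at [y], and a leg
    along [e], controlled by the mean value theorem and the continuity of [dg]. Only [e] requires
    information around [y], which is what lets [is_derive_C1] add the coordinates one at a time. *)
Lemma is_derive_addl (V : normedModType R) (g dg : V -> R) y e w (c D : R) :
  (\forall z \near y, is_derive z e g (dg z)) -> {for y, continuous dg} ->
  is_derive y w g D -> is_derive y (c *: e + w) g (c * dg y + D).
Proof.
move=> /nbhs_ballP[r1 /= r1_gt0 H1] /continuous_distP H2 H3.
apply: is_derive_distP => eps eps0.
have eps20 : 0 < eps / 2 by rewrite divr_gt0.
have c0 : 0 < `|c| + 1 by rewrite ltr_wpDl.
have [r2 r2_gt0 {}H2] := H2 _ (divr_gt0 eps20 c0).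
have [r3 r3_gt0 {}H3] := is_derive_dist H3 eps20.
(* All points of the leg along [e] lie within [|h| * B] of [y]; the summand 1 keeps [B] positive. *)
pose B := `|c| * `|e| + `|w| + 1.
have B0 : 0 < B by rewrite ltr_wpDl // addr_ge0 // mulr_ge0.
exists (Num.min (Num.min r1 r2 / B) r3).
  by rewrite !lt_min r3_gt0 andbT divr_gt0 // lt_min r1_gt0.
move=> h h0; rewrite !lt_min ltr_pdivlMr // lt_min => /andP[/andP[hr1 hr2] hr3].
have Hpt (s : R) : 0 <= s <= 1 ->
    `|(s * (h * c)) *: e + (h *: w + y) - y| <= `|h| * B.
  move=> /andP[s0 s1]; rewrite addrA addrK.
  rewrite (le_trans (ler_normD _ _)) // !normrZ (ger0_norm s0).
  have P0 : 0 <= `|h| * `|c| * `|e| by rewrite !mulr_ge0.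
  have h1 : 0 <= `|h| by [].
  by have := ler_piMl P0 s1; rewrite /B; nra.
have [s s01 E1] : exists2 s : R, 0 <= s <= 1 &
    g ((h * c) *: e + (h *: w + y)) - g (h *: w + y)
    = (h * c) * dg ((s * (h * c)) *: e + (h *: w + y)).
  apply: MVT_dir => s s01; apply: H1; rewrite -ball_normE /ball_ /= distrC.
  exact: le_lt_trans (Hpt _ s01) _.
set z := (s * (h * c)) *: e + (h *: w + y) in E1.
have Hz : `|dg z - dg y| < eps / 2 / (`|c| + 1).
  by apply: H2; exact: le_lt_trans (Hpt _ s01) _.
have -> : h^-1 *: (g (h *: (c *: e + w) + y) - g y) - (c * dg y + D) =
    c * (dg z - dg y) + (h^-1 *: (g (h *: w + y) - g y) - D).
  have -> : h *: (c *: e + w) + y = (h * c) *: e + (h *: w + y).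
    by rewrite scalerDr scalerA addrA.
  rewrite -(subrKA (g (h *: w + y)) (g _)) E1 /GRing.scale /=.
  by field.
rewrite (le_lt_trans (ler_normD _ _)) // [X in _ < X]splitr ltr_leD //.
  rewrite normrM; have [->|cn0] := eqVneq c 0; first by rewrite normr0 mul0r.
  apply: (@lt_le_trans _ _ (`|c| * (eps / 2 / (`|c| + 1)))).
    by rewrite ltr_pM2l // normr_gt0.
  by rewrite mulrCA ler_piMr ?ltW // ltr_pdivrMr // mul1r ltrDl.
exact/ltW/H3.
Qed.

(** Only [x] is confined to [K]; [y] may lie outside, as do the intermediate points of a difference
    quotient taken near the boundary of a ball. *)
Lemma compact_unif_continuous (V W : normedModType R) (K : set V) (g : V -> W) :
  compact K -> (forall x, K x -> {for x, continuous g}) ->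
  forall e : R, 0 < e -> exists2 r : R, 0 < r &
    forall x y, K x -> `|y - x| < r -> `|g y - g x| < e.
Proof.
move=> /compact_near_coveringP cK cg e e0.
pose P (r : R) (x : V) := forall y, `|y - x| < r -> `|g y - g x| < e.
have H : \forall r \near (0 : R)^'+, K `<=` P r.
  apply: cK => x Kx.
  have e20 : 0 < e / 2 by rewrite divr_gt0.
  have [r r0 Hr] := (continuous_distP _ _).1 (cg x Kx) _ e20.
  have r20 : 0 < r / 2 by rewrite divr_gt0.
  exists ([set z | `|z - x| < r / 2], [set s : R | s < r / 2]).
    split=> /=; last exact: nbhs_right_lt.
    by apply: open_nbhs_nbhs; split; [exact: open_normball|rewrite /= subrr normr0].
  move=> [z s] /= [zx sr] y yz.
  rewrite -(subrKA (g x)) (le_lt_trans (ler_normD _ _)) // [X in _ < X]splitr ltrD //.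
    apply: Hr; rewrite -(subrKA z) (le_lt_trans (ler_normD _ _)) //.
    by rewrite [X in _ < X]splitr ltrD // (lt_trans yz).
  rewrite distrC; apply: Hr; apply: (lt_trans zx).
  by rewrite ltr_pdivrMr // ltr_pMr // ltr1n.
have [r [r0 Hr]] : exists r : R, 0 < r /\ K `<=` P r.
  have /filter_ex[r [r0 Hr]] : \forall r \near (0 : R)^'+, 0 < r /\ K `<=` P r.
    by near=> r; split; near: r => //; exact: nbhs_right_gt.
  by exists r.
by exists r => // x y Kx yx; exact: Hr.
Unshelve. all: by end_near. Qed.

End MeanValue.

(** * The sup norm on row vectors and the symmetry of second derivatives *)

Section RowVectors.
Variables (R : realType) (n : nat).
Implicit Types x y : 'rV[R]_n.

Lemma normr_coord x j : `|x 0 j| <= `|x|.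
Proof.
by rewrite [leRHS]/Num.Def.normr /= mx_normrE; apply: (le_bigmax _ _ (0, j)).
Qed.

Lemma normr_row_lt x (r : R) : 0 < r -> (forall j, `|x 0 j| < r) -> `|x| < r.
Proof.
move=> r0 H; rewrite [ltLHS]/Num.Def.normr /= mx_normrE.
by apply/bigmax_ltP; split=> // -[i j] _ /=; rewrite ord1; exact: H.
Qed.

Lemma normr_row_le x (r : R) : 0 <= r -> (forall j, `|x 0 j| <= r) -> `|x| <= r.
Proof.
move=> r0 H; rewrite [leLHS]/Num.Def.normr /= mx_normrE.
by apply/bigmax_leP; split=> // -[i j] _ /=; rewrite ord1; exact: H.
Qed.

Lemma normr_delta_le1 i : `|delta_mx 0 i : 'rV[R]_n| <= 1.
Proof. by apply: normr_row_le => // j; rewrite mxE /=; case: eqP; rewrite ?normr1 ?normr0. Qed.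

Lemma compact_normball x (r : R) : compact [set y : 'rV[R]_n | `|y - x| <= r].
Proof.
apply: bounded_closed_compact.
  exists (`|x| + r); split; first exact: num_real.
  move=> M HM y /= yr; apply/ltW/(le_lt_trans _ HM).
  by rewrite -(subrK x y) (le_trans (ler_normD _ _)) // addrC lerD2l.
rewrite (_ : [set _ | _] = closed_ball_ Num.Def.normr x r).
  exact: closed_closed_ball_.
by apply/seteqP; split=> y /=; rewrite /closed_ball_ /= distrC.
Qed.

Lemma is_derive_C1 (U : set 'rV[R]_n) (g : 'rV[R]_n -> R) y h :
  open U -> Ck 1 U g -> U y ->
  is_derive y h g (\sum_i h 0 i * partial i g y).
Proof.
move=> oU Hg Uy; rewrite [X in is_derive _ X](row_sum_delta h).
elim/big_rec2 : _ => [|i D w _ H]; first exact: is_derive0.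
apply: is_derive_addl H.
- apply: filterS (open_nbhs_nbhs (conj oU Uy)) => z; exact: (Ck_is_derive i Hg).
- exact: (Ck_cont (Ck_partial i Hg) Uy).
Qed.

(** The second difference on the left is symmetric in [i] and [j]. Two mean values turn it into
    [t ^+ 2] times a mixed derivative at a nearby point; exchanging [i] and [j] gives the other
    mixed derivative, and continuity concludes in [partialC]. *)
Let Schwarz_aux (U : set 'rV[R]_n) (g : 'rV[R]_n -> R) x i j (r : R) :
  Ck 2 U g -> 0 < r -> (forall y, `|y - x| < r -> U y) ->
  forall t : R, 0 < t -> t + t < r ->
  exists2 z, `|z - x| <= t + t &
   g (t *: delta_mx 0 j + (t *: delta_mx 0 i + x)) - g (t *: delta_mx 0 i + x)
   - (g (t *: delta_mx 0 j + x) - g x) = t * (t * partial j (partial i g) z).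
Proof.
move=> Hg r0 Hr t t0 tr.
have Hpt (a b : R) : `|a| <= t -> `|b| <= t ->
    `|a *: delta_mx 0 i + (b *: delta_mx 0 j + x) - x| <= t + t.
  move=> at_ bt; rewrite addrA addrK (le_trans (ler_normD _ _)) // !normrZ.
  by apply: lerD; (apply: le_trans (ler_wpM2l _ (normr_delta_le1 _)) _; rewrite ?mulr1).
have HU (a b : R) : `|a| <= t -> `|b| <= t ->
    U (a *: delta_mx 0 i + (b *: delta_mx 0 j + x)).
  by move=> at_ bt; apply: Hr; exact: le_lt_trans (Hpt _ _ at_ bt) tr.
have st (s : R) : 0 <= s <= 1 -> `|s * t| <= t.
  move=> /andP[s0 s1]; have t0W := ltW t0.
  by rewrite ger0_norm ?mulr_ge0 // ler_piMl.
have t00 : `|0 : R| <= t by rewrite normr0 ltW.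
have tt : `|t| <= t by rewrite gtr0_norm.
pose psi := (fun y => g (t *: delta_mx 0 j + y)) - g.
pose dpsi := fun y => partial i g (t *: delta_mx 0 j + y) - partial i g y.
have [s1 s101] : exists2 s : R, 0 <= s <= 1 &
    psi (t *: delta_mx 0 i + x) - psi x = t * dpsi ((s * t) *: delta_mx 0 i + x).
  apply: MVT_dir => s s01; apply: is_deriveB.
    rewrite -[X in is_derive _ _ _ X]scale1r.
    apply: (@is_derive_comp_coord _ _ _ _ (fun y => t *: delta_mx 0 j + y)).
      by move=> h; rewrite mulr1 addrCA.
    apply: (Ck_is_derive _ (CkW Hg)); rewrite addrCA; apply: HU => //; exact: st.
  apply: (Ck_is_derive _ (CkW Hg)); have := HU (s * t) 0 (st _ s01) t00.
  by rewrite scale0r add0r.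
set p := (s1 * t) *: delta_mx 0 i + x => E1.
have [s2 s201] : exists2 s : R, 0 <= s <= 1 &
    partial i g (t *: delta_mx 0 j + p) - partial i g p =
    t * partial j (partial i g) ((s * t) *: delta_mx 0 j + p).
  apply: MVT_dir => s s01; apply: (Ck_is_derive _ (Ck_partial i Hg)).
  by rewrite /p addrCA; apply: HU; exact: st.
move=> E2; exists ((s2 * t) *: delta_mx 0 j + p).
  by rewrite /p addrCA; apply: Hpt; exact: st.
by rewrite -E2; move: E1; rewrite /psi /dpsi !fctE => <-; rewrite /psi !opprB /=; ring.
Qed.

Lemma partialC (U : set 'rV[R]_n) (g : 'rV[R]_n -> R) x i j :
  open U -> Ck 2 U g -> U x ->
  partial i (partial j g) x = partial j (partial i g) x.
Proof.
move=> oU Hg Ux; apply/eqP; rewrite -subr_eq0 -normr_le0; apply/ler_addgt0Pr => e e0.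
rewrite add0r.
have e20 : 0 < e / 2 by rewrite divr_gt0.
have C k l := (continuous_distP _ _).1 (Ck_cont (Ck_partial k (Ck_partial l Hg)) Ux) _ e20.
have [r1 r10 H1] := C i j; have [r2 r20 H2] := C j i.
have [r3 r30 H3] := open_distP oU Ux.
pose r := Num.min (Num.min r1 r2) r3.
have r0 : 0 < r by rewrite !lt_min r10 r20 r30.
pose t := r / 3.
have t0 : 0 < t by rewrite divr_gt0.
have tr : t + t < r by rewrite /t; lra.
have HU y : `|y - x| < r -> U y.
  by move=> yr; apply: H3; apply: lt_le_trans yr _; rewrite ge_min lexx orbT.
have [z zr Ez] := Schwarz_aux i j Hg r0 HU t0 tr.
have [w wr Ew] := Schwarz_aux j i Hg r0 HU t0 tr.
have E : partial j (partial i g) z = partial i (partial j g) w.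
  have tn0 : t != 0 by rewrite gt_eqF.
  apply: (mulfI tn0); apply: (mulfI tn0); apply: etrans (etrans (esym Ez) _) Ew.
  rewrite [in LHS](addrCA (t *: delta_mx 0 j)).
  move: (g _) (g _) (g _) (g x) => a b c d.
  by rewrite !opprB addrACA [RHS]addrACA; congr (_ + _); rewrite addrC.
have Hz : `|partial j (partial i g) z - partial j (partial i g) x| < e / 2.
  apply: H2; apply: le_lt_trans zr _; apply: lt_le_trans tr _.
  by rewrite /r !ge_min lexx !orbT.
have Hw : `|partial i (partial j g) w - partial i (partial j g) x| < e / 2.
  apply: H1; apply: le_lt_trans wr _; apply: lt_le_trans tr _.
  by rewrite /r !ge_min lexx.
move: E Hz Hw; move: (partial j (partial i g) z) (partial i (partial j g) w).
move: (partial i (partial j g) x) (partial j (partial i g) x) => p q a b -> Hz Hw.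
rewrite -(subrKA b) (le_trans (ler_normD _ _)) // [leRHS]splitr.
by rewrite lerD // ltW // distrC.
Qed.

Lemma partial_row (d : nat) (g : 'rV[R]_n -> 'rV[R]_d) i j x :
  derivable g x (delta_mx 0 i) ->
  partial i g x 0 j = partial i (fun y => g y 0 j) x.
Proof. by move=> gd; rewrite !partialE derive_mx // mxE. Qed.

Lemma partialC_row (d : nat) (U : set 'rV[R]_n) (g : 'rV[R]_n -> 'rV[R]_d) x i j :
  open U -> Ck 2 U g -> U x ->
  partial i (partial j g) x = partial j (partial i g) x.
Proof.
move=> oU Hg Ux; apply/rowP => k.
have Hk := (Ck_row _ _ oU).1 Hg k.
have E l m : partial l (partial m g) x 0 k =
    partial l (partial m (fun y => g y 0 k)) x.
  rewrite partial_row //; last exact: (Ck_derivable _ (Ck_partial _ Hg)).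
  apply: (eq_partial _ oU Ux) => y Uy; rewrite partial_row //.
  exact: (Ck_derivable _ Hg).
rewrite (E i j).
rewrite (E j i).
exact: (partialC i j oU Hk Ux).
Qed.

End RowVectors.

(** * Integrals over the unit interval and averages over a family of maps *)

HB.lock Definition int01 (R : realType) (f : R -> R) : R :=
  Rintegral (@lebesgue_measure R) `[0%R, 1%R]%classic f.

Section UnitIntegral.
Variable R : realType.
Local Notation mu := (@lebesgue_measure R).
Local Notation I01 := (`[0%R, 1%R]%classic : set R).
Implicit Types f g : R -> R.

Definition cont01 f := forall t : R, 0 <= t <= 1 -> {for t, continuous f}.

Lemma cont01_within f : cont01 f -> {within I01, continuous f}.
Proof.
by move=> H; apply: continuous_in_subspaceT => t; rewrite inE /= in_itv /=; exact: H.
Qed.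

Lemma cont01_integrable f : cont01 f -> mu.-integrable I01 (EFin \o f).
Proof.
move=> H; apply: continuous_compact_integrable; first exact: segment_compact.
exact: cont01_within.
Qed.

Lemma cont01M f g : cont01 f -> cont01 g -> cont01 (fun t => f t * g t).
Proof. by move=> Hf Hg t t01; exact: (continuousM (Hf t t01) (Hg t t01)). Qed.

Lemma cont01_cst (a : R) : cont01 (fun=> a).
Proof. by move=> t _; exact: cst_continuous. Qed.

Lemma cont01_bounded f : cont01 f ->
  exists2 B : R, 0 < B & forall t : R, 0 <= t <= 1 -> `|f t| <= B.
Proof.
move=> Hf.
have Hn : {within I01, continuous (fun t => `|f t|)}.
  apply: cont01_within => t t01.
  exact: (continuous_comp (Hf t t01) (@norm_continuous _ _ (f t))).
have [c _ Hc] := @EVT_max R (fun t => `|f t|) 0 1 ler01 Hn.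
exists (`|f c| + 1); first by rewrite ltr_wpDl.
by move=> t t01; rewrite (le_trans (Hc t _)) ?in_itv //= lerDl.
Qed.

Lemma eq_int01 f g : (forall t : R, 0 <= t <= 1 -> f t = g t) -> int01 f = int01 g.
Proof.
move=> H; rewrite int01.unlock; apply: eq_Rintegral => t.
by rewrite inE /= in_itv /=; exact: H.
Qed.

Lemma int01_cst (a : R) : int01 (fun=> a) = a.
Proof.
rewrite int01.unlock Rintegral_cst; last exact: measurable_itv.
by rewrite /= lebesgue_measure_itv /= lte01 oppr0 addr0 mulr1.
Qed.

Lemma int01D f g : cont01 f -> cont01 g ->
  int01 (fun t => f t + g t) = int01 f + int01 g.
Proof.
move=> Hf Hg; rewrite int01.unlock; apply: RintegralD.
- exact: measurable_itv.
- exact: cont01_integrable.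
- exact: cont01_integrable.
Qed.

Lemma int01Z f (a : R) : cont01 f -> int01 (fun t => a * f t) = a * int01 f.
Proof.
move=> Hf; rewrite int01.unlock; apply: RintegralZl.
- exact: measurable_itv.
- exact: cont01_integrable.
Qed.

Lemma int01B f g : cont01 f -> cont01 g ->
  int01 (fun t => f t - g t) = int01 f - int01 g.
Proof.
move=> Hf Hg; rewrite int01.unlock; apply: RintegralB.
- exact: measurable_itv.
- exact: cont01_integrable.
- exact: cont01_integrable.
Qed.

Lemma int01_le f (B : R) : cont01 f -> (forall t : R, 0 <= t <= 1 -> `|f t| <= B) ->
  `|int01 f| <= B.
Proof.
move=> Hf HB; rewrite -[leRHS]int01_cst int01.unlock.
have Hn : cont01 (fun t => `|f t|).
  move=> t t01; exact: (continuous_comp (Hf t t01) (@norm_continuous _ _ (f t))).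
have L : `|Rintegral mu I01 f| <= Rintegral mu I01 (fun t => `|f t|).
  apply: le_normr_Rintegral; first exact: measurable_itv.
  exact: cont01_integrable.
apply: (le_trans L); apply: le_Rintegral.
- exact: measurable_itv.
- exact: cont01_integrable.
- exact/cont01_integrable/cont01_cst.
- by move=> t /=; rewrite in_itv /=; exact: HB.
Qed.

Lemma int01_FTC (F f : R -> R) : cont01 f ->
  (forall t : R, 0 <= t <= 1 -> is_derive t 1 F (f t)) -> int01 f = F 1 - F 0.
Proof.
move=> Hf HF.
have cF (t : R) : 0 <= t <= 1 -> {for t, continuous F}.
  by move=> /HF[Fd _]; apply: differentiable_continuous; exact/derivable1_diffP.
rewrite int01.unlock /Rintegral (@continuous_FTC2 R f F 0 1 ltr01) //.
- exact: cont01_within.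
- split.
  + move=> t; rewrite in_itv /= => /andP[t0 t1].
    by have [] := HF t; rewrite ?ltW.
  + by apply: cvg_at_right_filter; apply: cF; rewrite lexx ler01.
  + by apply: cvg_at_left_filter; apply: cF; rewrite lexx ler01.
- move=> t; rewrite in_itv /= => /andP[t0 t1]; rewrite derive1E.
  by have [] := HF t; rewrite ?ltW.
Qed.

End UnitIntegral.

Section Average.
Variables (R : realType) (n : nat) (l : R -> 'rV[R]_n -> 'rV[R]_n) (c : 'I_n -> R -> R).
Hypothesis l_line : forall t i x (h : R),
  l t (h *: delta_mx 0 i + x) = (h * c i t) *: delta_mx 0 i + l t x.
Hypothesis l_cont : forall (t : R) x (e : R), 0 < e -> exists2 r : R, 0 < r &
  forall t' y, `|t' - t| < r -> `|y - x| < r -> `|l t' y - l t x| < e.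
Hypothesis c_cont : forall i, cont01 (c i).
Variables U U' : set 'rV[R]_n.
Hypotheses (oU : open U) (oU' : open U').
Hypothesis UU' : forall (t : R) x, 0 <= t <= 1 -> U' x -> U (l t x).

(** Two families are used: translations along a coordinate, which give Steklov averages, and
    contractions of a coordinate, which give the integral of Hadamard's lemma. The weight absorbs
    the factors [c i t] produced by differentiating under the integral sign. *)
Definition average (w : R -> R) (g : 'rV[R]_n -> R) (x : 'rV[R]_n) : R :=
  int01 (fun t => w t * g (l t x)).

Let g_joint (g : 'rV[R]_n -> R) x (t : R) : Ck 0 U g -> U' x -> 0 <= t <= 1 ->
  forall e : R, 0 < e -> exists2 r : R, 0 < r &
  forall t' y, `|t' - t| < r -> `|y - x| < r -> `|g (l t' y) - g (l t x)| < e.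
Proof.
move=> Hg Ux t01 e e0.
have [r1 r10 H1] := (continuous_distP _ _).1 (Ck_cont Hg (UU' t01 Ux)) _ e0.
have [r r0 Hr] := l_cont t x r10.
by exists r => // t' y t't yx; apply: H1; exact: Hr.
Qed.

Lemma average_cont01 g x : Ck 0 U g -> U' x -> cont01 (fun t => g (l t x)).
Proof.
move=> Hg Ux t t01; apply/continuous_distP => e /(g_joint Hg Ux t01)[r r0 Hr].
by exists r => // t' t't; apply: Hr => //; rewrite subrr normr0.
Qed.

(** The tube lemma: compactness of the unit interval makes the continuity in [y] uniform in [t]. *)
Lemma average_tube (g : 'rV[R]_n -> R) x : Ck 0 U g -> U' x ->
  forall e : R, 0 < e -> exists2 r : R, 0 < r &
  forall y (t : R), 0 <= t <= 1 -> `|y - x| < r -> `|g (l t y) - g (l t x)| < e.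
Proof.
move=> Hg Ux e e0; have e20 : 0 < e / 2 by rewrite divr_gt0.
pose P (r t : R) := forall y, `|y - x| < r -> `|g (l t y) - g (l t x)| < e.
have H : \forall r \near (0 : R)^'+, `[0%R, 1%R]%classic `<=` P r.
  apply: ((compact_near_coveringP _).1 (@segment_compact R 0 1)) => t /=.
  rewrite in_itv /= => t01; have [r r0 Hr] := g_joint Hg Ux t01 e20.
  exists ([set s : R | `|s - t| < r], [set s : R | s < r]).
    split=> /=; last exact: nbhs_right_lt.
    by apply: open_nbhs_nbhs; split; [exact: open_normball|rewrite /= subrr normr0].
  move=> [s r'] /= [st r'r] y yx.
  rewrite -(subrKA (g (l t x))) (le_lt_trans (ler_normD _ _)) // [X in _ < X]splitr.
  rewrite ltrD //; first by apply: Hr => //; exact: lt_trans yx _.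
  by rewrite distrC; apply: Hr => //; rewrite subrr normr0.
have /filter_ex[r [r0 Hr]] : \forall r \near (0 : R)^'+,
    0 < r /\ `[0%R, 1%R]%classic `<=` P r.
  by near=> r; split; near: r => //; exact: nbhs_right_gt.
by exists r => // y t t01 yx; apply: (Hr t) => //=; rewrite in_itv.
Unshelve. all: by end_near. Qed.

Lemma average_continuous w g x : cont01 w -> Ck 0 U g -> U' x ->
  {for x, continuous (average w g)}.
Proof.
move=> Hw Hg Ux; apply/continuous_distP => e e0.
have [B B0 HB] := cont01_bounded Hw.
have eB0 : 0 < e / 2 / B by rewrite !divr_gt0.
have [r r0 Hr] := average_tube Hg Ux eB0.
have [r1 r10 Hr1] := open_distP oU' Ux.
exists (Num.min r r1); first by rewrite lt_min r0.
move=> y; rewrite lt_min => /andP[yr /Hr1 Uy].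
rewrite /average -int01B; try by apply: cont01M => //; exact: average_cont01.
rewrite (@le_lt_trans _ _ (e / 2)) //; last by rewrite ltr_pdivrMr // ltr_pMr // ltr1n.
apply: int01_le => [t t01|t t01].
  apply: continuousB; apply: continuousM; try exact: Hw;
    exact: (average_cont01 _ _ t01).
rewrite -mulrBr normrM; apply: le_trans (ler_pM _ _ (HB t t01) (ltW (Hr _ _ t01 yr))) _ => //.
by rewrite mulrC divfK // gt_eqF.
Qed.

(** The mean value theorem replaces the difference quotient of the integrand by [partial i g] at an
    image under [l t] of an intermediate point, and [average_tube] makes the error small uniformly
    in [t]. *)
Lemma average_is_derive w g x i : cont01 w -> Ck 1 U g -> U' x ->
  is_derive x (delta_mx 0 i) (average w g)
    (average (fun t => w t * c i t) (partial i g) x).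
Proof.
move=> Hw Hg Ux; apply: is_derive_distP => e e0.
have Hwc := cont01M Hw (@c_cont i); have Hg' := Ck_partial i Hg.
have [B B0 HB] := cont01_bounded Hwc.
have eB0 : 0 < e / 2 / B by rewrite !divr_gt0.
have [r r0 Hr] := average_tube Hg' Ux eB0.
have [r1 r10 Hr1] := open_distP oU' Ux.
exists (Num.min r r1); first by rewrite lt_min r0.
move=> h h0; rewrite lt_min => /andP[hr hr1].
have Hpt (s : R) : 0 <= s <= 1 -> `|(s * h) *: delta_mx 0 i + x - x| <= `|h|.
  move=> /andP[s0 s1]; rewrite addrK normrZ normrM (ger0_norm s0).
  rewrite -[leRHS]mul1r -[leRHS]mulr1 ler_pM ?normr_delta_le1 ?mulr_ge0 //.
  by rewrite ler_wpM2r.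
have Us (s : R) : 0 <= s <= 1 -> U' ((s * h) *: delta_mx 0 i + x).
  by move=> s01; apply: Hr1; exact: le_lt_trans (Hpt s s01) _.
have Uh : U' (h *: delta_mx 0 i + x).
  by have := Us 1; rewrite mul1r; apply; rewrite lexx ler01.
have H0 := CkW Hg.
have C1 := average_cont01 H0 Uh; have C2 := average_cont01 H0 Ux.
have C3 := average_cont01 Hg' Ux.
have -> : h^-1 *: (average w g (h *: delta_mx 0 i + x) - average w g x)
    - average (fun t => w t * c i t) (partial i g) x =
  int01 (fun t => h^-1 * (w t * g (l t (h *: delta_mx 0 i + x)) - w t * g (l t x))
            - w t * c i t * partial i g (l t x)).
  rewrite int01B; last 2 first.
  - apply: cont01M; first exact: cont01_cst.
    by move=> t t01; apply: continuousB; apply: continuousM;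
      [exact: Hw|exact: C1|exact: Hw|exact: C2].
  - exact: cont01M.
  rewrite int01Z; last by move=> t t01; apply: continuousB; apply: continuousM;
      [exact: Hw|exact: C1|exact: Hw|exact: C2].
  by rewrite int01B //; exact: cont01M.
rewrite (@le_lt_trans _ _ (e / 2)) //; last by rewrite ltr_pdivrMr // ltr_pMr // ltr1n.
apply: int01_le => [t t01|t t01].
  apply: continuousB; last by apply: cont01M.
  apply: continuousM; first exact: cst_continuous.
  by apply: continuousB; apply: continuousM;
      [exact: Hw|exact: C1|exact: Hw|exact: C2].
have [s s01] : exists2 s : R, 0 <= s <= 1 &
    g ((h * c i t) *: delta_mx 0 i + l t x) - g (l t x)
    = (h * c i t) * partial i g ((s * (h * c i t)) *: delta_mx 0 i + l t x).
  apply: MVT_dir => s s01; apply: (Ck_is_derive _ Hg).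
  by rewrite mulrA -l_line; apply: UU' => //; exact: Us.
rewrite mulrA -!l_line => E.
rewrite -mulrBr E.
have -> : h^-1 * (w t * (h * c i t * partial i g (l t ((s * h) *: delta_mx 0 i + x))))
   - w t * c i t * partial i g (l t x) = w t * c i t *
   (partial i g (l t ((s * h) *: delta_mx 0 i + x)) - partial i g (l t x)).
  by move: (partial i g _) (partial i g _) => a b; field.
rewrite normrM.
apply: le_trans (ler_pM _ _ (HB t t01) (ltW (Hr _ _ t01 (le_lt_trans (Hpt s s01) hr)))) _ => //.
by rewrite mulrC divfK // gt_eqF.
Qed.

Lemma Ck_average k w g : cont01 w -> Ck k U g -> Ck k U' (average w g).
Proof.
elim: k w g => [|k IH] w g Hw Hg.
  by split=> // x Ux; exact: average_continuous.
have H0 : Ck 0 U g by exact: Ck_le Hg.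
have H1 : Ck 1 U g by exact: Ck_le Hg.
apply: (CkS_is_derive (dg := fun i => average (fun t => w t * c i t) (partial i g))).
- exact: oU'.
- by move=> x Ux; exact: average_continuous.
- by move=> i x Ux; exact: average_is_derive.
- by move=> i; apply: IH; [exact: cont01M|exact: Ck_partial].
Qed.

End Average.

(** * Regularity of solutions of elliptic systems *)

Section DeriveRules.
Variables (R : realType) (V : normedModType R).
Implicit Types (f g : V -> R) (x v : V) (df dg : R).

Lemma is_derive_mul f g x v df dg : is_derive x v f df -> is_derive x v g dg ->
  is_derive x v (fun y => f y * g y) (df * g x + f x * dg).
Proof.
move=> Hf Hg; have := is_deriveZW Hf Hg.
by move=> H; apply: is_derive_eq; rewrite addrC.
Qed.

Lemma is_derive_addf (W : normedModType R) (f g : V -> W) x v (df dg : W) :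
  is_derive x v f df -> is_derive x v g dg ->
  is_derive x v (fun y => f y + g y) (df + dg).
Proof. exact: is_deriveD. Qed.

Lemma is_derive_mulc (a : R) f x v df : is_derive x v f df ->
  is_derive x v (fun y => a * f y) (a * df).
Proof.
move=> Hf; have := is_derive_mul (is_derive_cst a x v) Hf.
by move=> H; apply: is_derive_eq; rewrite mul0r add0r.
Qed.

Lemma is_derive_sqr f x v df : is_derive x v f df ->
  is_derive x v (fun y => f y ^+ 2) (2 * (f x * df)).
Proof.
move=> Hf; have H := is_derive_mul Hf Hf.
rewrite (_ : (fun y => f y ^+ 2) = (fun y => f y * f y)).
  by apply: is_derive_eq; rewrite mulrC mulr2n mulrDl mul1r.
by apply/funext => y; rewrite expr2.
Qed.

Lemma is_derive_sumf (W : normedModType R) (I : Type) (r : seq I) (P : pred I)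
    (f : I -> V -> W) x v (df : I -> W) :
  (forall i, P i -> is_derive x v (f i) (df i)) ->
  is_derive x v (fun y => \sum_(i <- r | P i) f i y) (\sum_(i <- r | P i) df i).
Proof.
move=> H; elim: r => [|a r IH].
  rewrite big_nil (_ : (fun _ => _) = cst 0); first exact: is_derive_cst.
  by apply/funext => y; rewrite big_nil.
rewrite big_cons (_ : (fun _ => _) = fun y => (if P a then f a y else 0)
    + \sum_(i <- r | P i) f i y); last first.
  by apply/funext => y; rewrite big_cons; case: ifP; rewrite ?add0r.
case: ifP => Pa; first by apply: is_derive_addf => //; exact: H.
by rewrite -[X in is_derive _ _ _ X]add0r; apply: is_derive_addf => //; exact: is_derive_cst.
Qed.

Lemma second_derivative_at_max (U : set V) (f df : V -> R) y v (ddf : R) :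
  open U -> U y -> (forall z, U z -> is_derive z v f (df z)) ->
  is_derive y v df ddf -> (forall z, U z -> f z <= f y) -> ddf <= 0.
Proof.
move=> oU Uy Hf Hdf fmax; rewrite leNgt; apply/negP => dd0.
have [r1 r10 H1] := is_derive_dist Hdf dd0.
have [r2 r20 H2] := open_distP oU Uy.
pose r := Num.min r1 (r2 / (`|v| + 1)).
have v0 : 0 < `|v| + 1 by rewrite ltr_wpDl.
have r0 : 0 < r by rewrite lt_min r10 divr_gt0.
(* With this sign [h * df y] is nonnegative, and a positive second derivative would make [f] larger
   at [h *: v + y] than at its maximum [y]. *)
pose h := if 0 <= df y then r / 2 else - (r / 2).
have ha : 0 <= h * df y.
  rewrite /h; case: (leP 0 (df y)) => a0; first by rewrite mulr_ge0 // ltW // divr_gt0.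
  by rewrite mulNr -mulrN mulr_ge0 // ?oppr_ge0 ltW // divr_gt0.
have hr : `|h| = r / 2.
  by rewrite /h; case: ifP => _; rewrite ?normrN gtr0_norm // divr_gt0.
have hr' : `|h| < r by rewrite hr ltr_pdivrMr // ltr_pMr // ltr1n.
have hn0 : h != 0 by rewrite -normr_gt0 hr divr_gt0.
have Us (s : R) : 0 <= s <= 1 -> U ((s * h) *: v + y).
  move=> /andP[s0 s1]; apply: H2; rewrite addrK normrZ normrM (ger0_norm s0).
  apply: (@le_lt_trans _ _ (`|h| * `|v|)).
    by rewrite ler_wpM2r // ler_piMl.
  apply: (@le_lt_trans _ _ (`|h| * (`|v| + 1))); first by rewrite ler_wpM2l // lerDl.
  by rewrite -ltr_pdivlMr // (lt_le_trans hr') // ge_min lexx orbT.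
have [s /andP[s0 s1] E] : exists2 s : R, 0 < s < 1 &
    f (h *: v + y) - f y = h * df ((s * h) *: v + y).
  by apply: MVT_dir_open => s s01; apply: Hf; exact: Us.
have sh0 : s * h != 0 by rewrite mulf_neq0 // gt_eqF.
have shr : `|s * h| < r1.
  rewrite normrM (gtr0_norm s0) (@le_lt_trans _ _ `|h|) //; first by rewrite ler_piMl // ltW.
  by rewrite (lt_le_trans hr') // ge_min lexx.
have := H1 _ sh0 shr; set D := df _; rewrite ltr_norml => /andP[q0 _].
have {}q0 : 0 < (s * h)^-1 * (D - df y).
  by move: q0; rewrite ltrBrDr addrC subrr.
have le0 : h * D <= 0.
  rewrite /D -E subr_le0; apply: fmax; have := Us 1; rewrite mul1r; apply.
  by rewrite lexx ler01.
have : 0 < s * h ^+ 2 * ((s * h)^-1 * (D - df y)).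
  by rewrite mulr_gt0 // mulr_gt0 // exprn_even_gt0.
rewrite (_ : _ * (_ * _) = h * D - h * df y); last by field; rewrite hn0 gt_eqF.
by move=> ?; lra.
Qed.

End DeriveRules.

Lemma partial_sum (R : realType) (n : nat) (W : normedModType R) (I : Type)
    (r : seq I) (P : pred I) i (f : I -> 'rV[R]_n -> W) x :
  (forall j, P j -> derivable (f j) x (delta_mx 0 i)) ->
  partial i (fun y => \sum_(j <- r | P j) f j y) x =
  \sum_(j <- r | P j) partial i (f j) x.
Proof.
move=> H; apply: partial_val; apply: is_derive_sumf => j Pj.
by rewrite partialE; apply: derivableP; exact: H.
Qed.

(** * Bernstein's gradient bound for harmonic functions *)

Section Bernstein.
Variables (R : realType) (n : nat).

Lemma continuous_sumsq (x : 'rV[R]_n) :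
  continuous (fun y : 'rV[R]_n => \sum_i (y 0 i - x 0 i) ^+ 2).
Proof.
have oT : open (setT : set 'rV[R]_n) by exact: openT.
move=> y; apply: (@Ck_cont _ _ _ 0 setT) => //.
apply: Ck_sum => // i _.
apply: (@Ck_eq _ _ _ 0 setT
  (fun y : 'rV[R]_n => (y 0 i - x 0 i) *: (y 0 i - x 0 i))) => //.
by apply: CkZ => //; apply: CkB => //; first [exact: Ck_coord|exact: Ck_cst].
Qed.

Lemma compact_euclidean_ball (x : 'rV[R]_n) (r : R) : 0 <= r ->
  compact [set y : 'rV[R]_n | \sum_i (y 0 i - x 0 i) ^+ 2 <= r ^+ 2].
Proof.
move=> r0; set K := [set y | _].
have cK : closed K.
  apply: (@preimage_closed _ _ (fun y : 'rV[R]_n => \sum_i (y 0 i - x 0 i) ^+ 2)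
     [set t : R | t <= r ^+ 2]); last exact: closed_le.
  by move=> y _; exact: continuous_sumsq.
have KN : K `<=` [set y : 'rV[R]_n | `|y - x| <= r].
  move=> y /= H; apply: normr_row_le => // j.
  rewrite -(@ler_pXn2r _ 2) ?nnegrE // !mxE real_normK ?num_real //.
  apply: le_trans H; rewrite (bigD1 j) //= lerDl.
  by apply: sumr_ge0 => i _; exact: sqr_ge0.

exact: (subclosed_compact cK (@compact_normball R n x r) KN).
Qed.

Variables (g : 'rV[R]_n -> R) (x : 'rV[R]_n) (rho M : R).
Hypotheses (rho0 : 0 < rho) (M0 : 0 < M).
Let B := [set y : 'rV[R]_n | `|y - x| < rho].
Hypothesis gC3 : Ck 3 B g.
Hypothesis gharm : forall y, B y -> \sum_k partial k (partial k g) y = 0.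
Hypothesis gM : forall y, B y -> `|g y| <= M.

Let oB : open B. Proof. exact: open_normball. Qed.
Let r := rho / 2.
Let r0 : 0 < r. Proof. by rewrite divr_gt0. Qed.
Let q (y : 'rV[R]_n) : R := \sum_i (y 0 i - x 0 i) ^+ 2.
Let eta y := r ^+ 2 - q y.
Let G y := \sum_i (partial i g y) ^+ 2.
(** On the Euclidean ball of radius [r] the Laplacian of [eta ^+ 2 * G] is at least
    [- (24 + 4 n) r^2 G], and that of [g ^+ 2] is [2 G]; this value of [lam] makes the two
    balance. *)
Let lam := (12 + 2 * n%:R) * r ^+ 2.
(** The last term adds [2 n M^2] to the Laplacian and makes it strictly positive, so that an
    interior maximum contradicts the second derivative test directly. The factor [eta ^+ 2] removes
    the unknown gradient from the boundary. *)
Let Phi y := eta y ^+ 2 * G y + (lam * g y ^+ 2 + M ^+ 2 * q y).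

Let eta1 k (y : 'rV[R]_n) : R := - (2 * (y 0 k - x 0 k)).
Let G1 k (y : 'rV[R]_n) : R := \sum_i 2 * (partial i g y * partial k (partial i g) y).
Let G2 k (y : 'rV[R]_n) : R := \sum_i 2 * (partial k (partial i g) y ^+ 2
                     + partial i g y * partial k (partial k (partial i g)) y).
Let Phi1 k (y : 'rV[R]_n) : R := 2 * (eta y * eta1 k y) * G y + eta y ^+ 2 * G1 k y
  + (lam * (2 * (g y * partial k g y)) + M ^+ 2 * (2 * (y 0 k - x 0 k))).
Let Phi2 k (y : 'rV[R]_n) : R := 2 * (eta1 k y ^+ 2 - 2 * eta y) * G y
  + 4 * (eta y * eta1 k y) * G1 k y + eta y ^+ 2 * G2 k y
  + (lam * (2 * (partial k g y ^+ 2 + g y * partial k (partial k g) y))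
  + M ^+ 2 * 2).

Let dcoord k i (y : 'rV[R]_n) :
  is_derive y (delta_mx 0 k) (fun y : 'rV[R]_n => y 0 i - x 0 i) ((i == k)%:R : R).
Proof.
have := is_derive_addf (is_derive_coord k i y) (is_derive_cst (- x 0 i) y (delta_mx 0 k)).
by rewrite addr0.
Qed.

Let dq k y : is_derive y (delta_mx 0 k) q (2 * (y 0 k - x 0 k)).
Proof.
have := @is_derive_sumf _ _ _ _ (index_enum 'I_n) predT
  (fun i (y : 'rV[R]_n) => (y 0 i - x 0 i) ^+ 2) y (delta_mx 0 k) _
  (fun i _ => is_derive_sqr (dcoord k i y)).
rewrite (bigD1 k) //= big1 => [|i ik]; last by rewrite (negbTE ik) !mulr0.
by rewrite eqxx mulr1 addr0.
Qed.

Let deta k y : is_derive y (delta_mx 0 k) eta (eta1 k y).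
Proof.
have := is_derive_addf (is_derive_cst (r ^+ 2) y (delta_mx 0 k))
  (is_derive_mulc (-1) (dq k y)).
rewrite add0r mulN1r; congr (is_derive _ _ _ _).
by apply/funext => z; rewrite /eta mulN1r.
Qed.

Let deta1 k y : is_derive y (delta_mx 0 k) (eta1 k) (- 2).
Proof.
have := is_derive_mulc (- 2) (dcoord k k y); rewrite eqxx mulr1.
by congr (is_derive _ _ _ _); apply/funext => z; rewrite /eta1 mulNr.
Qed.

Let dG k y : B y -> is_derive y (delta_mx 0 k) G (G1 k y).
Proof.
move=> By; apply: is_derive_sumf => i _; apply: is_derive_sqr.
exact: (Ck_is_derive k (Ck_partial i gC3)).
Qed.

Let dG1 k y : B y -> is_derive y (delta_mx 0 k) (G1 k) (G2 k y).
Proof.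
move=> By; apply: is_derive_sumf => i _; apply: is_derive_mulc.
rewrite expr2; apply: is_derive_mul.
  exact: (Ck_is_derive k (Ck_partial i gC3)).
exact: (Ck_is_derive k (Ck_partial k (Ck_partial i gC3))).
Qed.

Let dPhi k y : B y -> is_derive y (delta_mx 0 k) Phi (Phi1 k y).
Proof.
move=> By; apply: is_derive_addf.
  by apply: is_derive_mul; [exact: is_derive_sqr|exact: dG].
apply: is_derive_addf; last exact: is_derive_mulc.
by apply: is_derive_mulc; apply: is_derive_sqr; exact: (Ck_is_derive k gC3).
Qed.

Let dPhi1 k y : B y -> is_derive y (delta_mx 0 k) (Phi1 k) (Phi2 k y).
Proof.
move=> By.
have D1 : is_derive y (delta_mx 0 k)
    (fun y => 2 * (eta y * eta1 k y) * G y + eta y ^+ 2 * G1 k y)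
    (2 * (eta1 k y ^+ 2 - 2 * eta y) * G y
     + 4 * (eta y * eta1 k y) * G1 k y + eta y ^+ 2 * G2 k y).
  have := is_derive_addf
    (is_derive_mul (is_derive_mulc 2 (is_derive_mul (deta k y) (deta1 k y))) (dG k By))
    (is_derive_mul (is_derive_sqr (deta k y)) (dG1 k By)).
  by move=> H; apply: is_derive_eq; ring.
apply: (is_derive_addf D1); apply: is_derive_addf.
  apply: is_derive_mulc; apply: is_derive_mulc.
  by rewrite expr2; apply: is_derive_mul;
    [exact: (Ck_is_derive k gC3)|exact: (Ck_is_derive k (Ck_partial k gC3))].
rewrite -[X in _ * X]mulr1; apply: is_derive_mulc; apply: is_derive_mulc.
by have := dcoord k k y; rewrite eqxx.
Qed.

Let harm_partial i y : B y -> \sum_k partial k (partial k (partial i g)) y = 0.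
Proof.
move=> By.
have E k : partial k (partial k (partial i g)) y = partial i (partial k (partial k g)) y.
  rewrite (@eq_partial _ _ _ B _ (partial i (partial k g))) //; last first.
    by move=> z Bz; apply: (partialC k i oB (CkW gC3) Bz).
  exact: (partialC k i oB (Ck_partial k gC3) By).
rewrite (eq_bigr _ (fun k _ => E k)) -partial_sum; last first.
  by move=> k _; exact: (Ck_derivable i (Ck_partial k (Ck_partial k gC3))).
rewrite (@eq_partial _ _ _ B _ (fun=> 0)) // partialE; exact: derive_cst.
Qed.

Let sum_Phi2 y : (0 < n)%N -> B y -> q y <= r ^+ 2 -> 0 < \sum_k Phi2 k y.
Proof.
move=> n0 By qr.
have q0 : 0 <= q y by apply: sumr_ge0 => i _; exact: sqr_ge0.
have G0 : 0 <= G y by apply: sumr_ge0 => i _; exact: sqr_ge0.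
have eta0 : 0 <= eta y by rewrite subr_ge0.
have etar : eta y <= r ^+ 2 by rewrite gerBl.
pose L k := \sum_i ((- 6 * eta1 k y ^+ 2 - 4 * eta y) * partial i g y ^+ 2
    + 2 * eta y ^+ 2 * (partial i g y * partial k (partial k (partial i g)) y))
  + (lam * (2 * (partial k g y ^+ 2 + g y * partial k (partial k g) y)) + M ^+ 2 * 2).
(* The mixed term [4 * (eta y * eta1 k y) * G1 k y] is absorbed by completing a square with the
   squared second derivatives, which turns the coefficient 2 of [eta1 k y ^+ 2] into -6. *)
have HL k : L k <= Phi2 k y.
  rewrite /L /Phi2 lerD2r /G /G1 /G2 !mulr_sumr -!big_split /=.
  apply: ler_sum => i _.
  move: (partial i g y) (partial k (partial i g) y) (partial k _ y) => a b c.
  move: (eta1 k y) (eta y) => e1 e.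
  rewrite -subr_ge0 (_ : _ - _ = 2 * (2 * (e1 * a) + e * b) ^+ 2); last by ring.
  by rewrite mulr_ge0 // sqr_ge0.
apply: (@lt_le_trans _ _ (\sum_k L k)); last by apply: ler_sum => k _; exact: HL.
have -> : \sum_k L k = G y * (- 24 * q y - 4 * n%:R * eta y + 2 * lam)
    + n%:R * (M ^+ 2 * 2).
  rewrite /L big_split /= exchange_big /= big_split /=.
  have -> : \sum_(k < n) M ^+ 2 * 2 = n%:R * (M ^+ 2 * 2).
    by rewrite sumr_const card_ord mulr_natl.
  have -> : \sum_k lam * (2 * (partial k g y ^+ 2 + g y * partial k (partial k g) y))
      = 2 * lam * G y.
    rewrite -mulr_sumr -mulr_sumr big_split /= -mulr_sumr gharm // mulr0 addr0.
    by rewrite -/(G y); ring.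
  rewrite addrA; congr (_ + _).
  have -> : \sum_j \sum_i ((-6 * eta1 i y ^+ 2 - 4 * eta y) * partial j g y ^+ 2 +
      2 * eta y ^+ 2 * (partial j g y * partial i (partial i (partial j g)) y))
      = \sum_j (- 24 * q y - 4 * n%:R * eta y) * partial j g y ^+ 2.
    apply: eq_bigr => j _; rewrite big_split /= -mulr_suml -!mulr_sumr.
    rewrite harm_partial // !mulr0 addr0; congr (_ * _).
    rewrite big_split /= sumr_const card_ord -[X in _ + X]mulr_natl -mulr_sumr.
    have -> : \sum_i eta1 i y ^+ 2 = 4 * q y.
      by rewrite mulr_sumr; apply: eq_bigr => i _; rewrite /eta1; ring.
    by ring.
  by rewrite -mulr_sumr -/(G y); ring.
have n0' : 0 < n%:R :> R by rewrite ltr0n.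
apply: ltr_wpDl; last by rewrite !mulr_gt0 // exprn_gt0.
apply: mulr_ge0 => //; rewrite /lam.
have : n%:R * eta y <= n%:R * r ^+ 2 by rewrite ler_wpM2l // ltW.
by nra.
Qed.

Lemma gradient_estimate i :
  (rho / 2) ^+ 2 * partial i g x ^+ 2 <= (13 + 2 * n%:R) * M ^+ 2.
Proof.
have n0 : (0 < n)%N by case: (n) i => [[]|].
pose K := [set y : 'rV[R]_n | q y <= r ^+ 2].
have KB : K `<=` B.
  move=> y Ky; apply: (@le_lt_trans _ _ r); last first.
    by rewrite /r ltr_pdivrMr // ltr_pMr // ltr1n.
  apply: normr_row_le; first exact: ltW.
  move=> j; rewrite -(@ler_pXn2r _ 2) ?nnegrE //; last exact: ltW.
  rewrite !mxE real_normK ?num_real //; apply: le_trans Ky.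
  rewrite /q (bigD1 j) //= lerDl.
  by apply: sumr_ge0 => k _; exact: sqr_ge0.
have Bx : B x by rewrite /B /= subrr normr0.
have qx : q x = 0 by rewrite /q big1 // => k _; rewrite subrr expr0n.
have Kx : K x by rewrite /K /= qx exprn_ge0 // ltW.
have cPhi y : B y -> {for y, continuous Phi}.
  have oT : open (setT : set 'rV[R]_n) by exact: openT.
  have Cq z : {for z, continuous q} by exact: continuous_sumsq.
  have Cp j z : B z -> {for z, continuous (partial j g)}.
    by move=> Bz; exact: (Ck_cont (Ck_partial j gC3) Bz).
  have Csq (f : 'rV[R]_n -> R) z : {for z, continuous f} ->
      {for z, continuous (fun y => f y ^+ 2)}.
    move=> Hf; rewrite (_ : (fun y => f y ^+ 2) = f \* f); first exact: continuousM.
    by apply/funext => w; rewrite expr2.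
  move=> By; apply: continuousD.
    apply: continuousM.
      apply: Csq; apply: continuousB; last exact: Cq.
      exact: cst_continuous.
    apply: (@cvg_sumr _ _ _ (nbhs y)) => j _; exact: (Csq _ _ (Cp j _ By)).
  apply: continuousD.
    apply: continuousM; first exact: cst_continuous.
    by apply: Csq; exact: (Ck_cont gC3 By).
  apply: continuousM; [exact: cst_continuous|exact: Cq].
have [] := @EVT_max_rV R n Phi K.
- by exists x.
- by apply: compact_euclidean_ball; exact: ltW.
- by apply: continuous_in_subspaceT => y; rewrite inE => /KB; exact: cPhi.
move=> y; rewrite inE => Ky ymax.
have /cPhi By := KB _ Ky.
have {}ymax z : K z -> Phi z <= Phi y by move=> Kz; apply: ymax; rewrite inE.
(* Otherwise the maximum is interior, every second derivative of [Phi] there is nonpositive, and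
   [sum_Phi2] is contradicted. On the sphere [eta = 0] the bound on [g] alone estimates [Phi]. *)
have etay : eta y = 0.
  apply: contrapT => /eqP etan0.
  have qlt : q y < r ^+ 2 by rewrite lt_neqAle Ky andbT -subr_eq0 -oppr_eq0 opprB.
  have Ni : open [set z : 'rV[R]_n | B z /\ q z < r ^+ 2].
    apply: openI => //.
    apply: (@open_comp _ _ q [set t : R | t < r ^+ 2]); last exact: open_lt.
    by move=> z _; exact: continuous_sumsq.
  have := sum_Phi2 n0 (KB _ Ky) Ky; apply/negP; rewrite -leNgt.
  apply: sumr_le0 => k _.
  apply: (second_derivative_at_max Ni _ _ (dPhi1 k (KB _ Ky))).
  - by split=> //; exact: KB.
  - by move=> z [Bz _]; exact: dPhi.
  - by move=> z [_ qz]; apply: ymax; exact: ltW.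
have qy : q y = r ^+ 2 by move/eqP: etay; rewrite subr_eq0 => /eqP.
have E1 : Phi y <= (13 + 2 * n%:R) * M ^+ 2 * r ^+ 2.
  rewrite /Phi etay expr0n /= mul0r add0r qy /lam.
  have : g y ^+ 2 <= M ^+ 2.
    rewrite -(real_normK (num_real _)) ler_pXn2r ?nnegrE ?(ltW M0) //.
    exact: (gM (KB _ Ky)).
  have r20 : 0 <= r ^+ 2 by exact: sqr_ge0.
  move=> gM2; have nn0 : 0 <= n%:R :> R by [].
  have : (12 + 2 * n%:R) * r ^+ 2 * g y ^+ 2 <= (12 + 2 * n%:R) * r ^+ 2 * M ^+ 2.
    by rewrite ler_wpM2l // mulr_ge0 //; lra.
  by nra.
have E2 : r ^+ 2 * (r ^+ 2 * partial i g x ^+ 2) <= Phi x.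
  rewrite /Phi /eta qx subr0 mulr0 addr0.
  apply: (@le_trans _ _ ((r ^+ 2) ^+ 2 * G x)).
    rewrite [(r ^+ 2) ^+ 2]expr2 -mulrA !ler_wpM2l ?sqr_ge0 //.
    rewrite /G (bigD1 i) //= lerDl; apply: sumr_ge0 => k _; exact: sqr_ge0.
  by rewrite lerDl mulr_ge0 ?sqr_ge0 // /lam mulr_ge0 ?sqr_ge0.
have r20 : 0 < r ^+ 2 by rewrite exprn_gt0.
rewrite -(ler_pM2l r20) (le_trans E2) // (le_trans (ymax _ Kx)) //.
by rewrite mulrC.
Qed.

End Bernstein.

(** * Steklov averages *)

Section Steklov.
Variables (R : realType) (n : nat) (eps : R).
Hypothesis eps0 : 0 < eps.
Local Notation ball_ x r := ([set y : 'rV[R]_n | `|y - x| < r]).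
Implicit Types (g : 'rV[R]_n -> R) (x y : 'rV[R]_n).

Let shiftl (i : 'I_n) (t : R) (x : 'rV[R]_n) := (t * eps) *: delta_mx 0 i + x.

Definition steklov i g := average (shiftl i) (fun=> 1) g.

Let shiftl_line i t j x (h : R) :
  shiftl i t (h *: delta_mx 0 j + x) = (h * 1) *: delta_mx 0 j + shiftl i t x.
Proof. by rewrite /shiftl mulr1 addrCA. Qed.

Let shiftl_cont i (t : R) x (e : R) : 0 < e -> exists2 r : R, 0 < r &
  forall t' y, `|t' - t| < r -> `|y - x| < r -> `|shiftl i t' y - shiftl i t x| < e.
Proof.
move=> e0; exists (Num.min (e / 2 / eps) (e / 2)).
  by rewrite lt_min !divr_gt0.
move=> t' y; rewrite !lt_min => /andP[tt _] /andP[_ yx].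
rewrite /shiftl opprD addrACA -scalerBl -mulrBl (le_lt_trans (ler_normD _ _)) //.
rewrite [X in _ < X]splitr ler_ltD // normrZ normrM (gtr0_norm eps0).
rewrite -[leRHS]mulr1 ler_pM ?normr_delta_le1 ?mulr_ge0 // ?(ltW eps0) //.
by rewrite -ler_pdivlMr // ltW.
Qed.

Let shiftl_ball i x (r t : R) y : 0 <= t <= 1 -> ball_ x (r - eps) y ->
  ball_ x r (shiftl i t y).
Proof.
move=> /andP[t0 t1] /=; rewrite ltrBrDl => H; rewrite /shiftl -addrA.
apply: le_lt_trans (ler_normD _ _) _; apply: le_lt_trans H; rewrite lerD2r.
rewrite normrZ normrM (ger0_norm t0) (gtr0_norm eps0) -[leRHS]mulr1.
by rewrite ler_pM ?normr_delta_le1 ?mulr_ge0 // ?(ltW eps0) // ler_piMl // ltW.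
Qed.

Let c1 (i : 'I_n) : cont01 (fun=> 1 : R). Proof. exact: cont01_cst. Qed.

Let stek_cont01 i g x r y : Ck 0 (ball_ x r) g -> ball_ x (r - eps) y ->
  cont01 (fun t => 1 * g (shiftl i t y)).
Proof.
move=> Hg By; apply: cont01M; first exact: cont01_cst.
exact: (average_cont01 (@shiftl_cont i)
  (fun t y t01 By => @shiftl_ball i x r t y t01 By) Hg By).
Qed.

Lemma Ck_steklov k i g x r : Ck k (ball_ x r) g -> Ck k (ball_ x (r - eps)) (steklov i g).
Proof.
move=> Hg; have oB s : open (ball_ x s) by exact: open_normball.
exact: (Ck_average (shiftl_line i) (@shiftl_cont i) c1 (oB _)
  (fun t y t01 By => @shiftl_ball i x r t y t01 By) (@cont01_cst _ 1) Hg).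
Qed.

Lemma eq_steklov i g g' x r y : (forall z, ball_ x r z -> g z = g' z) ->
  ball_ x (r - eps) y -> steklov i g y = steklov i g' y.
Proof.
by move=> H By; apply: eq_int01 => t t01; rewrite H //; exact: shiftl_ball.
Qed.

Lemma partial_steklov i j g x r y : Ck 1 (ball_ x r) g -> ball_ x (r - eps) y ->
  partial j (steklov i g) y = steklov i (partial j g) y.
Proof.
move=> Hg By; have oB s : open (ball_ x s) by exact: open_normball.
rewrite (partial_val (average_is_derive (shiftl_line i) (@shiftl_cont i) c1 (oB (r - eps))
  (fun t y t01 By => @shiftl_ball i x r t y t01 By) j (@cont01_cst _ 1) Hg By)).
by apply: eq_int01 => t t01; rewrite mulr1.
Qed.

(** By the fundamental theorem of calculus, the derivative in the direction of averaging is a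
    difference quotient of [g] itself. This is where one order of differentiability is gained. *)
Lemma partial_steklov_self i g x r y : Ck 1 (ball_ x r) g -> ball_ x (r - eps) y ->
  partial i (steklov i g) y = eps^-1 *: (g (eps *: delta_mx 0 i + y) - g y).
Proof.
move=> Hg By; rewrite (partial_steklov _ _ Hg By).
have Hd (t : R) : 0 <= t <= 1 ->
   is_derive t 1 (fun t => eps^-1 * g (shiftl i t y)) (1 * partial i g (shiftl i t y)).
  move=> t01; rewrite mul1r.
  have Ht : is_derive (t * eps) 1 (fun h : R => g (h *: delta_mx 0 i + y))
      (partial i g (shiftl i t y)).
    by apply: is_derive_line_at; apply: (Ck_is_derive i Hg); exact: shiftl_ball.
  have := is_derive1_compW (f := fun h : R => g (h *: delta_mx 0 i + y))
     (p := fun s => s * eps) Ht (is_derive_mul (is_derive_id t 1) (is_derive_cst eps t 1)).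
  move=> /(is_derive_mulc eps^-1) H; apply: is_derive_eq.
  by rewrite mulr0 addr0 mul1r /cst [eps *: _]/(eps * _) mulrA mulVf ?mul1r // gt_eqF.
rewrite /steklov /average (int01_FTC (@stek_cont01 i _ _ _ _ (Ck_partial i Hg) By) Hd).
by rewrite /shiftl mul1r mul0r scale0r add0r -mulrBr.
Qed.

Lemma steklov_near i g x r y (a e : R) : Ck 0 (ball_ x r) g -> ball_ x (r - eps) y ->
  (forall z, ball_ x r z -> `|g z - a| <= e) -> `|steklov i g y - a| <= e.
Proof.
move=> Hg By H; rewrite -[X in _ - X](int01_cst a) -int01B.
- apply: int01_le => [t t01|t t01].
    by apply: continuousB; [exact: (@stek_cont01 i _ _ _ _ Hg By t t01)|exact: cst_continuous].
  by rewrite mul1r; apply: H; exact: shiftl_ball.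
- exact: (@stek_cont01 i _ _ _ _ Hg By).
- exact: cont01_cst.
Qed.

Lemma steklov_sum i x r y (I : Type) (s : seq I) (f : I -> 'rV[R]_n -> R) (a : I -> R) :
  (forall j, Ck 0 (ball_ x r) (f j)) -> ball_ x (r - eps) y ->
  steklov i (fun z => \sum_(j <- s) f j z * a j) y = \sum_(j <- s) steklov i (f j) y * a j.
Proof.
move=> Hf By; have oB : open (ball_ x r) by exact: open_normball.
have Hsum s' : Ck 0 (ball_ x r) (fun z => \sum_(j <- s') f j z * a j).
  apply: Ck_sum => // j _; apply: (@Ck_eq _ _ _ 0 _ (fun z => a j *: f j z)) => //.
    by move=> z _; rewrite mulrC.
  exact: CkZc.
elim: s => [|j s IH].
  rewrite big_nil; apply: etrans (int01_cst 0); apply: eq_int01 => t t01.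
  by rewrite big_nil mulr0.
rewrite big_cons -IH mulrC /steklov /average -int01Z; last exact: (@stek_cont01 i _ _ _ _ (Hf j) By).
rewrite -int01D.
- by apply: eq_int01 => t t01; rewrite big_cons; ring.
- by apply: cont01M; [exact: cont01_cst|exact: (@stek_cont01 i _ _ _ _ (Hf j) By)].
- exact: (@stek_cont01 i _ _ _ _ (Hsum s) By).
Qed.

Definition steklovs (s : seq 'I_n) g := foldr steklov g s.

Let subS (r : R) m : r - m.+1%:R * eps = r - m%:R * eps - eps.
Proof. by rewrite -addn1 natrD mulrDl mul1r opprD addrA. Qed.

Lemma Ck_steklovs k s g x r : Ck k (ball_ x r) g ->
  Ck k (ball_ x (r - (size s)%:R * eps)) (steklovs s g).
Proof.
by move=> Hg; elim: s => [|i s IH] /=; [rewrite mul0r subr0|rewrite subS; exact: Ck_steklov].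
Qed.

Lemma partial_steklovs j s g x r y : Ck 1 (ball_ x r) g ->
  ball_ x (r - (size s)%:R * eps) y ->
  partial j (steklovs s g) y = steklovs s (partial j g) y.
Proof.
move=> Hg; elim: s y => [//|i s IH] y /=; rewrite subS => By.
rewrite (partial_steklov _ _ (Ck_steklovs s Hg) By).
exact: eq_steklov IH By.
Qed.

(** Serves three purposes in [solution_estimate]: with [a = 0] it preserves the sup bound, with
    [a = e = 0] it transports the equation, and with [a] the value of a derivative at the centre it
    measures the approximation. *)
Lemma steklovs_near s g x r y (a e : R) : Ck 0 (ball_ x r) g ->
  ball_ x (r - (size s)%:R * eps) y ->
  (forall z, ball_ x r z -> `|g z - a| <= e) -> `|steklovs s g y - a| <= e.
Proof.
move=> Hg By H; elim: s y By => [|i s IH] y /=.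
  by rewrite mul0r subr0; exact: H.
by rewrite subS => By; apply: (steklov_near i (Ck_steklovs s Hg) By).
Qed.

Lemma steklovs_sum s x r y (I : Type) (s' : seq I) (f : I -> 'rV[R]_n -> R) (a : I -> R) :
  (forall j, Ck 0 (ball_ x r) (f j)) -> ball_ x (r - (size s)%:R * eps) y ->
  steklovs s (fun z => \sum_(j <- s') f j z * a j) y =
  \sum_(j <- s') steklovs s (f j) y * a j.
Proof.
move=> Hf; elim: s y => [//|i s IH] y /=; rewrite subS => By.
rewrite (eq_steklov i IH By); apply: (@steklov_sum i x _ y _ _ _ _ _ By).
by move=> j; exact: Ck_steklovs.
Qed.

(** The average in direction [j] turns [partial j] into a difference quotient, and all averages
    applied after it commute with [partial j]. *)
Let Ck_partial_steklovs k s g x r j : Ck k.+1 (ball_ x r) g -> j \in s ->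
  Ck k.+1 (ball_ x (r - (size s)%:R * eps)) (partial j (steklovs s g)).
Proof.
move=> Hg; elim: s => [//|i s IH]; rewrite inE => /orP js /=; rewrite subS.
set r' := r - _; have oB t : open (ball_ x t) by exact: open_normball.
have Hh := Ck_steklovs s Hg; have Hh1 : Ck 1 (ball_ x r') (steklovs s g) by exact: Ck_le Hh.
have [ij|ij] := eqVneq j i.
  apply: (@Ck_eq _ _ _ k.+1 _ (fun y => eps^-1 *:
      (steklovs s g (eps *: delta_mx 0 i + y) - steklovs s g y)) _ (oB _)).
    by move=> y By; rewrite ij (partial_steklov_self _ Hh1 By).
  apply: (CkZc _ (oB _)); apply: (CkB (oB _)); last first.
    by apply: Ck_sub Hh => y /= By; apply: lt_trans By _; rewrite gtrBl.
  apply: (@Ck_comp_coord _ n n _ (fun y => eps *: delta_mx 0 i + y) id (fun=> 1)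
      k.+1 (ball_ x r') _ _ _ _ (oB _) (oB _)) => //.
  - by move=> l y h; rewrite mulr1 addrCA.
  - move=> y; apply/continuous_distP => e e0'; exists e => // z zy.
    by rewrite opprD addrACA subrr add0r.
  - move=> y By; have := @shiftl_ball i x r' 1 y; rewrite /shiftl mul1r; apply => //.
    by rewrite lexx ler01.
have {}js : j \in s by case: js => // /eqP E; rewrite E eqxx in ij.
apply: (@Ck_eq _ _ _ k.+1 _ (steklov i (partial j (steklovs s g))) _ (oB _)).
  by move=> y By; rewrite (partial_steklov _ _ Hh1 By).
by apply: Ck_steklov; exact: IH.
Qed.

Lemma steklovs_smoothing k s g x r : Ck k.+1 (ball_ x r) g -> (forall j, j \in s) ->
  Ck k.+2 (ball_ x (r - (size s)%:R * eps)) (steklovs s g).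
Proof.
move=> Hg js; have H1 := Ck_steklovs s Hg; apply: CkS_intro.
- by move=> y By; exact: (Ck_cont H1 By).
- by move=> i y By; exact: (Ck_derivable i H1 By).
- by move=> i; exact: Ck_partial_steklovs.
Qed.

End Steklov.

(** * Derivability from uniformly Cauchy difference quotients *)

Section UniformDifferenceQuotients.
Variables (R : realType) (V : normedModType R) (d : nat).
Variables (f : V -> 'rV[R]_d) (x v : V) (r : R).
Hypothesis r0 : 0 < r.
Hypothesis f_cont : forall y, `|y - x| < r -> {for y, continuous f}.
Local Notation Q h y := (h^-1 *: (f (h *: v + y) - f y)).
Hypothesis Q_cauchy : forall e : R, 0 < e -> exists2 s : R, 0 < s &
  forall (h h' : R) y, `|y - x| < r -> h != 0 -> h' != 0 -> `|h| < s -> `|h'| < s ->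
    `|Q h y - Q h' y| <= e.

Lemma derivable_of_cauchy y : `|y - x| < r -> derivable f y v.
Proof.
move=> yr; apply/cauchy_cvgP/cauchy_ballP => /= e e0.
have e20 : 0 < e / 2 by rewrite divr_gt0.
have [s s0 Hs] := Q_cauchy e20.
exists (([set w | exists2 h : R, h != 0 /\ `|h| < s & w = Q h y]),
        ([set w | exists2 h : R, h != 0 /\ `|h| < s & w = Q h y])).
  have H : \forall h \near (0 : R)^', [set w | exists2 h : R, h != 0 /\ `|h| < s & w = Q h y] (Q h y).
    near=> h; exists h => //; split; first by near: h; exact: nbhs_dnbhs_neq.
    by near: h; exact: dnbhs0_lt.
  by split.
move=> [w w'] /= [[h [h0 hs] ->] [h' [h'0 h's] ->]].
rewrite -ball_normE /ball_ /=; apply: (@le_lt_trans _ _ (e / 2)); first exact: Hs.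
by rewrite ltr_pdivrMr // ltr_pMr // ltr1n.
Unshelve. all: by end_near. Qed.

Lemma derive_of_cauchy_dist (e : R) : 0 < e -> exists2 s : R, 0 < s &
  forall (h : R) y, `|y - x| < r -> h != 0 -> `|h| < s -> `|Q h y - 'D_v f y| <= e.
Proof.
move=> e0; have e20 : 0 < e / 2 by rewrite divr_gt0.
have [s s0 Hs] := Q_cauchy e20; exists s => // h y yr h0 hs.
have [s' s'0 Hs'] := is_derive_dist (derivableP (derivable_of_cauchy yr)) e20.
pose h' := Num.min s s' / 2.
have m0 : 0 < Num.min s s' by rewrite lt_min s0.
have h'0 : 0 < h' by rewrite divr_gt0.
have h'm : `|h'| < Num.min s s'.
  by rewrite gtr0_norm // ltr_pdivrMr // ltr_pMr // ltr1n.
move: h'm; rewrite lt_min => /andP[h's h's'].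
rewrite -(subrKA (Q h' y)) (le_trans (ler_normD _ _)) // [leRHS]splitr lerD //.
  by apply: Hs => //; rewrite gt_eqF.
by apply/ltW/Hs' => //; rewrite gt_eqF.
Qed.

(** Near [x] the derivative is a uniform limit of the continuous functions [y] to [Q h y]. One [h]
    is fixed with error [e / 4], at both points, and the continuity of that single quotient accounts
    for the third [e / 4]. *)
Lemma derive_of_cauchy_continuous : {for x, continuous ('D_v f)}.
Proof.
apply/continuous_distP => e e0.
have e40 : 0 < e / 4 by rewrite divr_gt0.
have e34 : e / 4 + (e / 4 + e / 4) < e by lra.
have [s s0 Hs] := derive_of_cauchy_dist e40.
have xx : `|x - x| < r by rewrite subrr normr0.
pose h := Num.min s (r / (`|v| + 1)) / 2.
have v0 : 0 < `|v| + 1 by rewrite ltr_wpDl.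
have m0 : 0 < Num.min s (r / (`|v| + 1)) by rewrite lt_min s0 divr_gt0.
have h0 : 0 < h by rewrite divr_gt0.
have hm : `|h| < Num.min s (r / (`|v| + 1)).
  by rewrite gtr0_norm // ltr_pdivrMr // ltr_pMr // ltr1n.
move: hm; rewrite lt_min => /andP[hs hr].
have hn0 : h != 0 by rewrite gt_eqF.
have he : 0 < h * (e / 4) / 2 by rewrite divr_gt0 // mulr_gt0.
have hvx : `|h *: v + x - x| < r.
  rewrite addrK normrZ (@le_lt_trans _ _ (`|h| * (`|v| + 1))) ?ler_wpM2l ?lerDl //.
  by rewrite -ltr_pdivlMr.
have [r1 r10 H1] := (continuous_distP _ _).1 (f_cont hvx) _ he.
have [r2 r20 H2] := (continuous_distP _ _).1 (f_cont xx) _ he.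
exists (Num.min r (Num.min r1 r2)); first by rewrite !lt_min r0 r10.
move=> y; rewrite !lt_min => /and3P[yr yr1 yr2].
have HQ : `|Q h y - Q h x| <= e / 4.
  rewrite -scalerBr normrZ normfV (gtr0_norm h0) ler_pdivrMl //.
  rewrite [- (_ - f x)]opprD opprK addrACA [- f y + _]addrC.
  rewrite (le_trans (ler_normD _ _)) // [leRHS]splitr lerD //.
    apply/ltW/H1; rewrite opprD addrACA subrr add0r; exact: yr1.
  by rewrite distrC; apply/ltW/H2.
have A1 := Hs h y yr hn0 hs; have A2 := Hs h x xx hn0 hs.
move: A1 A2 HQ; move: (Q h y) (Q h x) ('D_v f y) ('D_v f x) => a b p q A1 A2 HQ.
apply: (@le_lt_trans _ _ (e / 4 + (e / 4 + e / 4))); last by [].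
rewrite -(subrKA a) (le_trans (ler_normD _ _)) // lerD //; first by rewrite distrC.
by rewrite -(subrKA b) (le_trans (ler_normD _ _)) // lerD.
Qed.

End UniformDifferenceQuotients.

(** * Gradient estimate for solutions of class C^1 *)

Section Elliptic.
Variables (R : realType) (n d : nat) (E E' : 'I_n -> 'M[R]_d).
(* The symbol of the adjoint operator inverts the symbol of [E] up to the
   squared norm, so that solutions are harmonic. *)
Hypothesis EE' : forall i k, E i *m E' k + E k *m E' i = ((i == k)%:R *+ 2)%:M.
Local Notation ball_ x r := ([set y : 'rV[R]_n | `|y - x| < r]).
Implicit Types (u : 'rV[R]_n -> 'rV[R]_d) (U : set 'rV[R]_n).

Definition solution U u : Prop :=
  Ck 1 U u /\ forall y, U y -> \sum_i partial i u y *m E i = 0.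

Lemma solution_sub U U' u : U' `<=` U -> solution U u -> solution U' u.
Proof. by move=> UU [u1 u2]; split=> [|y /UU]; [exact: Ck_sub u1|exact: u2]. Qed.

(** Differentiating the equation along [k] and applying [E' k] gives a vanishing sum of
    [w k i *m (E i *m E' k)]. As [w] is symmetric the product of matrices may be symmetrised, and
    [EE'] leaves twice the Laplacian. *)
Lemma solution_harmonic U u y : open U -> Ck 2 U u -> solution U u -> U y ->
  \sum_k partial k (partial k u) y = 0.
Proof.
move=> oU u2 [_ Hu] Uy.
pose w k i := partial k (partial i u) y.
have wC k i : w k i = w i k by exact: (partialC_row k i oU u2 Uy).
have H0 k : \sum_i w k i *m E i = 0.
  have -> : \sum_i w k i *m E i = partial k (fun z => \sum_i partial i u z *m E i) y.
    apply/esym/partial_val; apply: is_derive_sumf => i _; apply: is_derive_mulmxr.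
    exact: (Ck_is_derive k (Ck_partial i u2)).
  by rewrite (eq_partial (g' := fun=> 0) k oU Uy) // partialE derive_cst.
have S0 : \sum_k \sum_i w k i *m (E i *m E' k) = 0.
  apply: big1 => k _.
  apply: etrans (_ : (\sum_i w k i *m E i) *m E' k = 0); last by rewrite H0 mul0mx.
  rewrite mulmx_suml.
  by apply: eq_bigr => i _; rewrite mulmxA.
have : \sum_k \sum_i w k i *m (E i *m E' k) + \sum_k \sum_i w k i *m (E i *m E' k) = 0.
  by rewrite S0 addr0.
rewrite {2}exchange_big /= -big_split /=.
rewrite (eq_bigr (fun k => w k k *+ 2)); last first.
  move=> k _; rewrite -big_split /= (bigD1 k) //= big1 ?addr0.
    by rewrite -mulmxDr EE' eqxx mul_mx_scalar scaler_nat.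
  move=> i ik; rewrite (wC i k) -mulmxDr EE' (negbTE ik) mul0rn.
  by rewrite mul_mx_scalar scale0r.
rewrite sumrMnl => /eqP; rewrite -scaler_nat scaler_eq0 pnatr_eq0 /= => /eqP.
by [].
Qed.

(** [gradient_estimate] at radius [rho / 2] bounds the derivative by [4 M / rho] times the square
    root of [13 + 2 n]; bounding that root by [13 + 2 n] avoids square roots. *)
Definition ellC : R := 4 * (13 + 2 * n%:R).

Lemma ellC_gt0 : 0 < ellC.
Proof. by rewrite mulr_gt0 // ltr_wpDr // mulr_ge0. Qed.

Lemma solution_estimate u x (rho M : R) i : 0 < rho -> 0 < M ->
  solution (ball_ x rho) u -> (forall y, ball_ x rho y -> `|u y| <= M) ->
  `|partial i u x| <= ellC * M / rho.
Proof.
move=> rho0 M0 [u1 Hu] uM.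
have K0 : 0 <= ellC * M / rho by rewrite ltW // divr_gt0 // mulr_gt0 // ellC_gt0.
apply: normr_row_le => // j; apply/ler_addgt0Pr => e e0.
have oB r : open (ball_ x r) by exact: open_normball.
have Bx : ball_ x rho x by rewrite /= subrr normr0.
pose uc k := fun y => u y 0 k.
have uc1 k : Ck 1 (ball_ x rho) (uc k) by exact: ((Ck_row _ _ (oB rho)).1 u1 k).
have pE l k y : ball_ x rho y -> partial l u y 0 k = partial l (uc k) y.
  by move=> By; apply: partial_row; exact: (Ck_derivable l u1 By).
have [r' r'0 Hr'] := (continuous_distP _ _).1 (Ck_cont (Ck_partial i (uc1 j)) Bx) _ e0.
(* Averaging twice in each direction takes class C^1 to class C^3. The [N] averages of step [eps]
   consume a margin [N * eps], kept below [rho / 2], so that half the ball survives, and below [r'],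
   where [partial i (uc j)] varies by less than [e]. *)
pose s := enum 'I_n; pose N := (size (s ++ s))%:R : R.
have js (k : 'I_n) : k \in s by rewrite mem_enum.
pose m := Num.min (rho / 2) r'.
have m0 : 0 < m by rewrite lt_min r'0 divr_gt0.
have N0 : 0 < N + 1 by rewrite ltr_wpDl.
pose eps := m / (N + 1).
have eps0 : 0 < eps by rewrite divr_gt0.
have Neps : N * eps < m.
  by rewrite /eps mulrCA gtr_pMr // ltr_pdivrMr // mul1r ltrDl.
have sizeN : N = (size s)%:R + (size s)%:R by rewrite /N size_cat natrD.
pose v k := steklovs eps (s ++ s) (uc k).
have vE k : v k = steklovs eps s (steklovs eps s (uc k)) by rewrite /v /steklovs foldr_cat.
have subB : ball_ x (rho / 2) `<=` ball_ x (rho - N * eps).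
  move=> y /= yr; apply: lt_le_trans yr _.
  have : N * eps < rho / 2 by apply: lt_le_trans Neps _; rewrite ge_min lexx.
  by move=> ?; lra.
have v3 k : Ck 3 (ball_ x (rho / 2)) (v k).
  rewrite vE; apply: (Ck_sub subB); rewrite sizeN mulrDl opprD addrA.
  apply: steklovs_smoothing => //.
  exact: steklovs_smoothing.
have dv l k y : ball_ x (rho / 2) y ->
    partial l (v k) y = steklovs eps (s ++ s) (partial l (uc k)) y.
  by move=> /subB By; rewrite (partial_steklovs eps0 l (uc1 k) By).
(* The coefficients are constant, so the left side is the average of the vanishing left side for
   [u]. *)
have veq y k : ball_ x (rho / 2) y ->
    \sum_l \sum_a partial l (v a) y * E l a k = 0.
  move=> By.
  have C0 (p : 'I_n * 'I_d) : Ck 0 (ball_ x rho) (partial p.1 (uc p.2)).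
    exact: (Ck_partial p.1 (uc1 p.2)).
  rewrite pair_big /=.
  rewrite (eq_bigr (fun p : 'I_n * 'I_d =>
     steklovs eps (s ++ s) (partial p.1 (uc p.2)) y * E p.1 p.2 k)); last first.
    by move=> p _; rewrite dv.
  rewrite -(steklovs_sum eps0 _ (fun p => E p.1 p.2 k) C0 (subB _ By)).
  apply/eqP; rewrite -normr_le0 -[X in `|X|]subr0.
  apply: (@steklovs_near _ _ eps eps0 _ _ x rho) => [||z Bz].
  - apply: Ck_sum => // p _.
    apply: (@Ck_eq _ _ _ 0 _ (fun z => E p.1 p.2 k *: partial p.1 (uc p.2) z)) => //.
      by move=> z _; rewrite mulrC.
    by apply: CkZc => //; exact: C0.
  - exact: subB.
  rewrite subr0 normr_le0; apply/eqP; move/rowP/(_ k): (Hu z Bz).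
  rewrite summxE mxE => Ez; apply: etrans Ez.
  apply: (@etrans _ _ (\sum_l \sum_a partial l (uc a) z * E l a k)).
    by rewrite pair_big.
  by apply: eq_bigr => l _; rewrite mxE; apply: eq_bigr => a _; rewrite pE.
pose V (y : 'rV[R]_n) : 'rV[R]_d := \row_k v k y.
have Vk k : (fun y => V y 0 k) = v k by apply/funext => y; rewrite mxE.
have V3 : Ck 3 (ball_ x (rho / 2)) V by apply/(Ck_row _ _ (oB _)) => k; rewrite Vk.
have V2 : Ck 2 (ball_ x (rho / 2)) V by exact: CkW.
have V1 : Ck 1 (ball_ x (rho / 2)) V by exact: CkW.
have pV l k y : ball_ x (rho / 2) y -> partial l V y 0 k = partial l (v k) y.
  by move=> By; rewrite partial_row ?Vk //; exact: (Ck_derivable l V1 By).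
have Vsol : solution (ball_ x (rho / 2)) V.
  split=> // y By; apply/rowP => k; rewrite summxE mxE; apply: etrans (veq y k By).
  by apply: eq_bigr => l _; rewrite mxE; apply: eq_bigr => a _; rewrite pV.
have vharm y : ball_ x (rho / 2) y -> \sum_k partial k (partial k (v j)) y = 0.
  move=> By; have /rowP/(_ j) := solution_harmonic (oB _) V2 Vsol By.
  rewrite summxE mxE => Ez; apply: etrans Ez; apply: eq_bigr => k _.
  rewrite partial_row; last exact: (Ck_derivable k (Ck_partial k V2) By).
  by apply: (eq_partial k (oB _) By) => z Bz; rewrite pV.
have vM y : ball_ x (rho / 2) y -> `|v j y| <= M.
  move=> /subB By; rewrite -[v j y]subr0.
  apply: (@steklovs_near _ _ eps eps0 _ _ x rho _ _ _ _ By) => [|z Bz].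
    exact: CkW (uc1 j).
  by rewrite subr0; apply: le_trans (normr_coord _ _) _; exact: uM.
have r20 : 0 < rho / 2 by rewrite divr_gt0.
have GE := gradient_estimate r20 M0 (v3 j) vharm vM i.
have vK : `|partial i (v j) x| <= ellC * M / rho.
  rewrite -(@ler_pXn2r _ 2) ?nnegrE // real_normK ?num_real //.
  have n0 : 0 <= n%:R :> R by [].
  rewrite expr_div_n exprMn ler_pdivlMr ?exprn_gt0 // /ellC.
  have : (13 + 2 * n%:R) * M ^+ 2 <= (13 + 2 * n%:R) ^+ 2 * M ^+ 2.
    by rewrite ler_wpM2r ?sqr_ge0 //; nra.
  rewrite exprMn.
  move: GE; rewrite (_ : (rho / 2 / 2) ^+ 2 = rho ^+ 2 / 16); last by field.
  by move=> *; nra.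
have close : `|partial i (v j) x - partial i (uc j) x| <= e.
  have Bx2 : ball_ x (rho / 2) x by rewrite /= subrr normr0.
  rewrite dv //.
  pose r2 := Num.min rho r'.
  apply: (@steklovs_near _ _ eps eps0 _ _ x r2) => [||z Bz].
  - apply: Ck_sub (Ck_partial i (uc1 j)) => z /= zr.
    by apply: lt_le_trans zr _; rewrite ge_min lexx.
  - rewrite /= subrr normr0 subr_gt0 -/N; apply: lt_le_trans Neps _.
    rewrite /m /r2 le_min !ge_min lexx orbT andbT; apply/orP; left.
    by rewrite ler_pdivrMr // ler_peMr ?ltW // ltr1n.
  - by apply/ltW/Hr'; apply: lt_le_trans Bz _; rewrite ge_min lexx orbT.
rewrite pE // -[partial i (uc j) x](subKr (partial i (v j) x)).
by rewrite (le_trans (ler_normB _ _)) // lerD.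
Qed.

End Elliptic.

(** * Smoothness and growth of the derivatives of solutions *)

Section EllipticRegularity.
Variables (R : realType) (n d : nat) (E E' : 'I_n -> 'M[R]_d).
Hypothesis EE' : forall i k, E i *m E' k + E k *m E' i = ((i == k)%:R *+ 2)%:M.
Local Notation ball_ x r := ([set y : 'rV[R]_n | `|y - x| < r]).
Implicit Types (u : 'rV[R]_n -> 'rV[R]_d) (U : set 'rV[R]_n).

Lemma solutionB U u u' : open U -> solution E U u -> solution E U u' ->
  solution E U (fun y => u y - u' y).
Proof.
move=> oU [u1 Hu] [u1' Hu']; split; first exact: CkB.
move=> y Uy.
apply: (@etrans _ _ (\sum_i partial i u y *m E i - \sum_i partial i u' y *m E i)).
  2: by rewrite Hu // Hu' // subrr.
rewrite -sumrB; apply: eq_bigr => i _; rewrite -mulmxBl; congr (_ *m _); apply: partial_val.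
by apply: is_deriveB; [exact: (Ck_is_derive i u1)|exact: (Ck_is_derive i u1')].
Qed.

Lemma solutionZ U u (a : R) : open U -> solution E U u ->
  solution E U (fun y => a *: u y).
Proof.
move=> oU [u1 Hu]; split; first exact: CkZc.
move=> y Uy; apply: (@etrans _ _ (a *: \sum_i partial i u y *m E i)).
  2: by rewrite Hu // scaler0.
rewrite scaler_sumr; apply: eq_bigr => i _; rewrite scalemxAl; congr (_ *m _); apply: partial_val.
by apply: is_deriveZ; exact: (Ck_is_derive i u1).
Qed.

Lemma solution_translate U U' u w : open U -> open U' ->
  (forall y, U' y -> U (w + y)) ->
  solution E U u -> solution E U' (fun y => u (w + y)).
Proof.
move=> oU oU' UU [u1 Hu]; split.
  apply: (@Ck_comp_coord _ n n _ (fun y => w + y) id (fun=> 1) 1 U) => //.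
  - by move=> l y h; rewrite mulr1 addrCA.
  - move=> y; apply/continuous_distP => e e0'; exists e => // z zy.
    by rewrite opprD addrACA subrr add0r.
move=> y /UU Uy; apply: etrans (Hu _ Uy); apply: eq_bigr => i _.
congr (_ *m _); apply: partial_val; rewrite -[X in is_derive _ _ _ X]scale1r.
apply: (@is_derive_comp_coord _ _ _ _ (fun y => w + y)).
  by move=> h; rewrite mulr1 addrCA.
exact: (Ck_is_derive i u1 Uy).
Qed.

Lemma partial_translate u (w y : 'rV[R]_n) i :
  derivable u (w + y) (delta_mx 0 i) ->
  partial i (fun y => u (w + y)) y = partial i u (w + y).
Proof.
move=> H; apply: partial_val; rewrite -[X in is_derive _ _ _ X]scale1r.
apply: (@is_derive_comp_coord _ _ _ _ (fun y => w + y)).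
  by move=> h; rewrite mulr1 addrCA.
by rewrite partialE; exact: derivableP.
Qed.

Local Notation dq u h j y := (h^-1 *: (u (h *: delta_mx 0 j + y) - u y)).

Let dq_close U u x (rho : R) j : 0 < rho -> (forall y, `|y - x| < rho -> U y) ->
  Ck 1 U u -> forall e : R, 0 < e -> exists2 s : R, 0 < s &
  forall (h : R) y, `|y - x| < rho / 2 -> h != 0 -> `|h| < s ->
  `|dq u h j y - partial j u y| <= e.
Proof.
move=> rho0 HU u1 e e0.
have rho2 : 0 < rho / 2 by rewrite divr_gt0.
have Cont y : [set y | `|y - x| <= rho / 2] y -> {for y, continuous (partial j u)}.
  move=> /= yr; apply: (Ck_cont (Ck_partial j u1)); apply: HU.
  by apply: le_lt_trans yr _; lra.
have [s s0 Hs] := compact_unif_continuous (@compact_normball R n x (rho / 2)) Cont e0.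
exists (Num.min s (rho / 2)); first by rewrite lt_min s0.
move=> h y yr h0; rewrite lt_min => /andP[hs hr]; apply: normr_row_le; first exact: ltW.
move=> k.
have Hpt (t : R) : 0 <= t <= 1 -> `|(t * h) *: delta_mx 0 j + y - y| <= `|h|.
  move=> /andP[t0 t1]; rewrite addrK normrZ normrM (ger0_norm t0).
  rewrite -[leRHS]mul1r -[leRHS]mulr1 ler_pM ?normr_delta_le1 ?mulr_ge0 //.
  by rewrite ler_wpM2r.
have Ut (t : R) : 0 <= t <= 1 -> U ((t * h) *: delta_mx 0 j + y).
  move=> t01; apply: HU; rewrite -(subrKA y) (le_lt_trans (ler_normD _ _)) //.
  by have := Hpt t t01; lra.
have [t t01 Et] : exists2 t : R, 0 <= t <= 1 &
   u (h *: delta_mx 0 j + y) 0 k - u y 0 k =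
   h * partial j u ((t * h) *: delta_mx 0 j + y) 0 k.
  apply: (@MVT_dir _ _ (fun y => u y 0 k) (fun y => partial j u y 0 k)) => t t01.
  have /is_derive_row := Ck_is_derive j u1 (Ut t t01); exact.
rewrite !mxE Et mulrA mulVf // mul1r.
have := Hs y ((t * h) *: delta_mx 0 j + y) (ltW yr) (le_lt_trans (Hpt t t01) hs).
move=> /ltW; apply: le_trans.
by have := normr_coord (partial j u ((t * h) *: delta_mx 0 j + y) - partial j u y) k; rewrite !mxE.
Qed.

(** The difference of two difference quotients of [u] is again a solution, and it is uniformly small
    because [u] is C^1. The gradient estimate makes its derivatives small as well, which says that
    the quotients of [partial i u] are uniformly Cauchy. *)
Let dq_partial_cauchy U u x (rho : R) i j : 0 < rho ->
  (forall y, `|y - x| < rho -> U y) -> open U -> solution E U u ->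
  forall e : R, 0 < e -> exists2 s : R, 0 < s &
  forall (h h' : R) y, `|y - x| < rho / 4 -> h != 0 -> h' != 0 ->
    `|h| < s -> `|h'| < s ->
    `|dq (partial i u) h j y - dq (partial i u) h' j y| <= e.
Proof.
move=> rho0 HU oU solu e e0; have [u1 Hu] := solu.
have C0 := ellC_gt0 R n.
(* Two errors of this size add up to the bound [M = e * (rho / 4) / ellC], for which the gradient
   estimate on a ball of radius [rho / 4] returns exactly [e]. *)
have e10 : 0 < e * (rho / 4) / ellC R n / 2 by rewrite !divr_gt0 // mulr_gt0 // divr_gt0.
have [s s0 Hs] := dq_close j rho0 HU u1 e10.
exists (Num.min s (rho / 2)); first by rewrite lt_min s0 divr_gt0.
move=> h h' y yr h0 h'0; rewrite !lt_min => /andP[hs hr] /andP[h's h'r].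
have oB z r : open (ball_ z r) by exact: open_normball.
have Usub (k : R) z : `|k| < rho / 2 -> `|z - x| < rho / 2 -> U (k *: delta_mx 0 j + z).
  move=> kr zr; apply: HU; rewrite -addrA (le_lt_trans (ler_normD _ _)) //.
  have := ler_wpM2l (normr_ge0 k) (@normr_delta_le1 R n j).
  by rewrite normrZ mulr1; lra.
have solh k : `|k| < rho / 2 -> solution E (ball_ x (rho / 2)) (fun y => dq u k j y).
  move=> kr; apply: (solutionZ _ (oB _ _)); apply: (solutionB (oB _ _)).
    by apply: (solution_translate oU (oB _ _)) solu => z zr; exact: Usub.
  by apply: solution_sub solu => z /= zr; apply: HU; lra.
pose w y := dq u h j y - dq u h' j y.
have subB : ball_ y (rho / 4) `<=` ball_ x (rho / 2).
  move=> z /= zy; rewrite -(subrKA y) (le_lt_trans (ler_normD _ _)) //; lra.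
have solw : solution E (ball_ y (rho / 4)) w.
  exact: (solution_sub subB (solutionB (oB _ _) (solh _ hr) (solh _ h'r))).
have rho4 : 0 < rho / 4 by rewrite divr_gt0.
have M0 : 0 < e * (rho / 4) / ellC R n by rewrite !divr_gt0 // mulr_gt0.
have wM z : ball_ y (rho / 4) z -> `|w z| <= e * (rho / 4) / ellC R n.
  move=> /subB zx; rewrite /w -(subrKA (partial j u z)) (le_trans (ler_normD _ _)) //.
  by rewrite [leRHS]splitr lerD //; [exact: Hs|rewrite distrC; exact: Hs].
have := solution_estimate EE' i rho4 M0 solw wM.
have -> : ellC R n * (e * (rho / 4) / ellC R n) / (rho / 4) = e.
  by field; rewrite !gt_eqF.
suff -> : partial i w y = dq (partial i u) h j y - dq (partial i u) h' j y by [].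
apply: partial_val; apply: is_deriveB; apply: is_deriveZ; apply: is_deriveB.
- rewrite -partial_translate; last first.
    apply: (Ck_derivable i u1); apply: Usub => //; lra.
  have [H1 _] := solution_translate (w := h *: delta_mx 0 j) oU (oB x (rho / 2)) (fun z zr => Usub _ _ hr zr) solu.
  apply: (Ck_is_derive i H1) => /=; lra.
- by apply: (Ck_is_derive i u1); apply: HU; lra.
- rewrite -partial_translate; last first.
    apply: (Ck_derivable i u1); apply: Usub => //; lra.
  have [H1 _] := solution_translate (w := h' *: delta_mx 0 j) oU (oB x (rho / 2)) (fun z zr => Usub _ _ h'r zr) solu.
  apply: (Ck_is_derive i H1) => /=; lra.
- by apply: (Ck_is_derive i u1); apply: HU; lra.
Qed.

Lemma solution_C2 U u : open U -> solution E U u -> Ck 2 U u.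
Proof.
move=> oU solu; have [u1 Hu] := solu.
apply: CkS_intro => [x Ux|i x Ux|i].
- exact: (Ck_cont u1 Ux).
- exact: (Ck_derivable i u1 Ux).
have H x j : U x -> derivable (partial i u) x (delta_mx 0 j) /\
    {for x, continuous ('D_(delta_mx 0 j) (partial i u))}.
  move=> Ux; have [rho rho0 HU] := open_distP oU Ux.
  have rho4 : 0 < rho / 4 by rewrite divr_gt0.
  have Qc := dq_partial_cauchy i j rho0 HU oU solu.
  have Cp y : `|y - x| < rho / 4 -> {for y, continuous (partial i u)}.
    by move=> yr; apply: (Ck_cont (Ck_partial i u1)); apply: HU; lra.
  split; last exact: (derive_of_cauchy_continuous rho4 Cp Qc).
  by apply: (derivable_of_cauchy Qc); rewrite subrr normr0.
apply: CkS_intro => [x Ux|j x Ux|j].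
- exact: (Ck_cont (Ck_partial i u1) Ux).
- by have [] := H x j Ux.
- split=> // x Ux; have [_] := H x j Ux.
  by rewrite partial.unlock.
Qed.

(** The bootstrap: the step from C^1 to C^2 makes a derivative of a solution a C^1 solution, to
    which the same step applies again. *)
Lemma solution_partial U u i : open U -> solution E U u -> solution E U (partial i u).
Proof.
move=> oU solu; have u2 := solution_C2 oU solu; have [u1 Hu] := solu.
split; first exact: Ck_partial u2.
move=> y Uy.
apply: (@etrans _ _ (partial i (fun z => \sum_k partial k u z *m E k) y)).
  apply/esym/partial_val; apply: is_derive_sumf => k _; apply: is_derive_mulmxr.
  rewrite (partialC_row k i oU u2 Uy); exact: (Ck_is_derive i (Ck_partial k u2)).
by rewrite (eq_partial (g' := fun=> 0) i oU Uy) // partialE derive_cst.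
Qed.

Lemma solution_Cinf U u : open U -> solution E U u -> Cinf U u.
Proof.
move=> oU solu k; elim: k u solu => [|k IH] u solu.
  by have [u1 _] := solu; exact: CkW.
have [u1 Hu] := solu; apply: CkS_intro => [x Ux|i x Ux|i].
- exact: (Ck_cont u1 Ux).
- exact: (Ck_derivable i u1 Ux).
- by apply: IH; exact: solution_partial.
Qed.

Definition partials (W : normedModType R) (s : seq 'I_n) (g : 'rV[R]_n -> W) :=
  foldr (fun i h => partial i h) g s.

Lemma solution_partials U u s : open U -> solution E U u -> solution E U (partials s u).
Proof. by move=> oU solu; elim: s => [//|i s IH]; exact: solution_partial. Qed.

Let partials_bound u x (rho del M : R) s y : 0 < del -> 0 < M ->
  solution E (ball_ x rho) u -> (forall y, ball_ x rho y -> `|u y| <= M) ->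
  ball_ x (rho - (size s)%:R * del) y ->
  `|partials s u y| <= (ellC R n / del) ^+ size s * M.
Proof.
move=> del0 M0 solu uM; have C0 := ellC_gt0 R n.
elim: s y => [|i s IH] y By; first by rewrite expr0 mul1r; apply: uM; move: By; rewrite mul0r subr0.
have oB : open (ball_ x rho) by exact: open_normball.
pose M' := (ellC R n / del) ^+ size s * M.
have M'0 : 0 < M' by rewrite mulr_gt0 // exprn_gt0 // divr_gt0.
have yx : `|y - x| < rho - (size s)%:R * del - del.
  by move: By => /=; rewrite -natr1 mulrDl mul1r opprD addrA.
have sub1 : ball_ y del `<=` ball_ x (rho - (size s)%:R * del).
  move=> z /= zy; rewrite -(subrKA y) (le_lt_trans (ler_normD _ _)) //; lra.
have sub2 : ball_ y del `<=` ball_ x rho.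
  move=> z /sub1 /= H; apply: lt_le_trans H _; rewrite gerBl mulr_ge0 //; exact: ltW.
have sol1 : solution E (ball_ y del) (partials s u).
  by apply: (solution_sub sub2); exact: solution_partials.
have := solution_estimate EE' i del0 M'0 sol1 (fun z Bz => IH z (sub1 z Bz)).
by move=> H; apply: le_trans H _; rewrite /M' exprS mulrAC -[X in _ <= X]mulrA mulrAC mulrA.
Qed.

(** The quotient of [k ^ k] by the factorial is a single term of the exponential series at [k]. *)
Let pow_fact (k : nat) : (k%:R ^+ k : R) <= expR 1 ^+ k * k`!%:R.
Proof.
case: k => [|k]; first by rewrite !expr0 fact0 mul1r.
have := @expR_ge1Dxn R k.+1%:R k (ler0n _ _).
have -> : expR k.+1%:R = expR 1 ^+ k.+1 :> R by rewrite -expRM_natl mulr1.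
move=> H.
rewrite -ler_pdivrMr ?ltr0n ?fact_gt0 //; apply: le_trans H; by rewrite lerDr.
Qed.

(* The gradient estimate, iterated [k] times with radius [rho / 2k], gives the
   bounds [k^k C^k] on the derivatives of order [k]. *)
Lemma solution_growth U u x : open U -> solution E U u -> U x ->
  exists r M C : R, [/\ 0 < r, 0 <= M, 0 <= C &
    forall s y, `|y - x| < r ->
      `|partials s u y| <= M * C ^+ size s * (size s)`!%:R].
Proof.
move=> oU solu Ux; have [rho rho0 HU] := open_distP oU Ux; have [u1 Hu] := solu.
have rho2 : 0 < rho / 2 by rewrite divr_gt0.
have C0 := ellC_gt0 R n.
have oB : open (ball_ x (rho / 2)) by exact: open_normball.
pose K := [set y : 'rV[R]_n | `|y - x| <= rho / 2].
have Cn y : K y -> {for y, continuous (fun y => `|u y|)}.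
  move=> /= yr; have uc : {for y, continuous u}.
    by apply: (Ck_cont u1); apply: HU; move: yr; rewrite /K /=; lra.
  exact: (continuous_comp uc (@norm_continuous _ _ (u y))).
have [||c _ Hc] := @EVT_max_rV R n (fun y => `|u y|) K _ (@compact_normball R n x (rho / 2)).
- by exists x; rewrite /K /= subrr normr0 ltW.
- by apply: continuous_in_subspaceT => y; rewrite inE; exact: Cn.
pose M := `|u c| + 1.
have M0 : 0 < M by rewrite ltr_wpDl.
have uM y : ball_ x (rho / 2) y -> `|u y| <= M.
  move=> By; apply: (@le_trans _ _ `|u c|); last by rewrite lerDl.
  by apply: Hc; rewrite inE; exact: ltW.
have solB : solution E (ball_ x (rho / 2)) u.
  by apply: solution_sub solu => y /= yr; apply: HU; lra.
exists (rho / 4), M, (ellC R n * 4 / rho * expR 1); split.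
- by rewrite divr_gt0.
- exact: ltW.
- by rewrite mulr_ge0 ?expR_ge0 // divr_ge0 ?ltW // mulr_gt0.
move=> s y yr.
have [s0|s0] := posnP (size s).
  rewrite s0 expr0 mulr1 fact0 mulr1; move/size0nil: s0 => -> /=.
  by apply: uM => /=; lra.
have k0 : 0 < (size s)%:R :> R by rewrite ltr0n.
pose del := rho / 4 / (size s)%:R.
have del0 : 0 < del by rewrite !divr_gt0.
have := @partials_bound u x (rho / 2) del M s y del0 M0 solB uM.
have -> : rho / 2 - (size s)%:R * del = rho / 4.
  by rewrite /del; field; rewrite gt_eqF.
move=> /(_ yr) H; apply: le_trans H _.
have -> : ellC R n / del = ellC R n * 4 / rho * (size s)%:R.
  by rewrite /del; field; rewrite !gt_eqF.
set a := ellC R n * 4 / rho; set k := size s.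
have a0 : 0 <= a by rewrite divr_ge0 ?ltW // mulr_gt0.
clearbody a.
apply: (@le_trans _ _ (a ^+ k * (expR 1 ^+ k * k`!%:R) * M)).
  by rewrite exprMn ler_wpM2r ?(ltW M0) // ler_wpM2l ?exprn_ge0 // pow_fact.
by rewrite exprMn (_ : M * _ * _ = a ^+ k * (expR 1 ^+ k * k`!%:R) * M) //; ring.
Qed.

End EllipticRegularity.

(** * Taylor series indexed by words *)

Section Words.
Variables (R : realType) (n : nat).

(** Bridges the two indexings: the coefficients in [analytic_on] are indexed by functions on ['I_k],
    iterated derivatives by sequences. *)
Definition word (T : finType) (k : nat) (s : {ffun 'I_k -> T}) : seq T :=
  [seq s i | i <- enum 'I_k].

Lemma size_word (T : finType) k (s : {ffun 'I_k -> T}) : size (word s) = k.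
Proof. by rewrite size_map size_enum_ord. Qed.

Lemma sum_words0 (T : finType) (W : nmodType) (F : seq T -> W) :
  \sum_(s : {ffun 'I_0 -> T}) F (word s) = F [::].
Proof.
have f0 : {ffun 'I_0 -> T} := ffun0 (card_ord 0).
rewrite (bigD1 f0) //= big1 ?addr0; last first.
  by move=> s /eqP []; apply/ffunP => -[].
by congr F; apply: size0nil; rewrite size_word.
Qed.

Lemma sum_wordsS (T : finType) (W : nmodType) (F : seq T -> W) k :
  \sum_(s : {ffun 'I_k.+1 -> T}) F (word s) =
  \sum_a \sum_(s : {ffun 'I_k -> T}) F (a :: word s).
Proof.
pose f (p : T * {ffun 'I_k -> T}) : {ffun 'I_k.+1 -> T} :=
  [ffun i => if unlift ord0 i is Some j then p.2 j else p.1].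
pose f' (s : {ffun 'I_k.+1 -> T}) : T * {ffun 'I_k -> T} :=
  (s ord0, [ffun j => s (lift ord0 j)]).
have fK : cancel f f'.
  move=> [a s]; rewrite /f /f' ffunE unlift_none /=; congr (_, _).
  by apply/ffunP => j; rewrite !ffunE liftK.
have f'K : cancel f' f.
  move=> s; apply/ffunP => i; rewrite ffunE /=.
  by case: unliftP => [j ->|->] //; rewrite ffunE.
rewrite (reindex f) /=; last by exists f' => x _; [exact: fK|exact: f'K].
rewrite pair_big /=; apply: eq_bigr => -[a s] _ /=; congr F.
rewrite /word enum_ordSl /= ffunE unlift_none; congr (_ :: _).
rewrite -map_comp; apply: eq_map => j /=.
by rewrite ffunE liftK.
Qed.

Lemma monomial_word k (s : {ffun 'I_k -> 'I_n}) (h : 'rV[R]_n) :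
  monomial R n k s h = \prod_(i <- word s) h 0 i.
Proof. by rewrite /monomial /word big_map big_enum. Qed.

End Words.

Section Taylor.
Variable R : realType.

(** [psi p t] is the Taylor polynomial of order [p] about the moving point [t], evaluated at 1; its
    derivative telescopes to one term. The mean value theorem applied to it yields Cauchy's form of
    the remainder, hence the factorial of [m] and not of [m.+1]. *)
Lemma Taylor_remainder (phi : nat -> R -> R) (m : nat) (B : R) :
  (forall k (t : R), 0 <= t <= 1 -> is_derive t 1 (phi k) (phi k.+1 t)) ->
  (forall t : R, 0 <= t <= 1 -> `|phi m.+1 t| <= B) ->
  `|phi 0%N 1 - \sum_(k < m.+1) phi k 0 / k`!%:R| <= B / m`!%:R.
Proof.
move=> dphi phiB.
pose psi p (t : R) := \sum_(k < p.+1) phi k t * (1 - t) ^+ k / k`!%:R.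
have dpsi p (t : R) : 0 <= t <= 1 ->
    is_derive t 1 (psi p) (phi p.+1 t * (1 - t) ^+ p / p`!%:R).
  move=> t01; elim: p => [|p IH].
    have -> : psi 0%N = phi 0%N.
      by apply/funext => z; rewrite /psi big_ord1 expr0 mulr1 divr1.
    by rewrite expr0 mulr1 divr1; exact: dphi.
  have -> : psi p.+1 = fun z => psi p z + phi p.+1 z * (p.+1`!%:R^-1 * (1 - z) ^+ p.+1).
    apply/funext => z; rewrite /psi big_ord_recr /=; congr (_ + _).
    by rewrite -mulrA [_ * _^-1]mulrC.
  have d1 : is_derive t 1 (fun z : R => 1 - z) (-1).
    have := is_deriveB (is_derive_cst (1 : R) t 1) (is_derive_id t 1).
    by rewrite sub0r.
  have dX q : is_derive t 1 (fun z : R => (1 - z) ^+ q.+1) (- (q.+1%:R * (1 - t) ^+ q)).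
    elim: q => [|q IHq].
      have -> : (fun z : R => (1 - z) ^+ 1) = fun z => 1 - z by apply/funext.
      by rewrite expr0 mulr1.
    have -> : (fun z : R => (1 - z) ^+ q.+2) = fun z => (1 - z) * (1 - z) ^+ q.+1.
      by apply/funext => z; rewrite exprS.
    have := is_derive_mul d1 IHq => H; apply: is_derive_eq.
    by rewrite -[q.+2%:R]natr1 [(1 - t) ^+ q.+1]exprS; ring.
  have := is_derive_addf IH (is_derive_mul (dphi p.+1 t t01)
    (is_derive_mulc p.+1`!%:R^-1 (dX p))).
  move=> H; apply: is_derive_eq.
  have f0 : p`!%:R != 0 :> R by rewrite pnatr_eq0 -lt0n fact_gt0.
  have p0 : p.+1%:R != 0 :> R by rewrite pnatr_eq0.
  rewrite factS natrM; move: (p`!%:R) (p.+1%:R) f0 p0 => F P f0 p0.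
  by move: (phi p.+1 t) (phi p.+2 t) => A B'; field; rewrite f0 p0.
have [||c c01] := @MVT R (psi m) (fun t => phi m.+1 t * (1 - t) ^+ m / m`!%:R) 0 1 ltr01.
- by move=> t; rewrite in_itv /= => /andP[t0 t1]; apply: dpsi; rewrite !ltW.
- apply: derivable_within_continuous => t; rewrite in_itv /= => t01.
  by have [] := dpsi m t t01.
have -> : psi m 1 = phi 0%N 1.
  rewrite /psi big_ord_recl /= expr0 mulr1 divr1 big1 ?addr0 // => k _.
  by rewrite subrr expr0n /= mulr0 mul0r.
have -> : psi m 0 = \sum_(k < m.+1) phi k 0 / k`!%:R.
  by apply: eq_bigr => k _; rewrite subr0 expr1n mulr1.
move: c01; rewrite in_itv /= => /andP[c0 c1] ->; rewrite subr0 mulr1.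
rewrite normrM normfV (ger0_norm (ler0n _ _)) ler_wpM2r ?invr_ge0 //.
rewrite normrM -[leRHS]mulr1 ler_pM // ?phiB ?(ltW c0) ?(ltW c1) //.
rewrite normrX exprn_ile1 // ger0_norm ?subr_ge0 ?(ltW c1) //.
by rewrite gerBl ltW.
Qed.

End Taylor.

Section Growth.
Variables (R : realType) (n d : nat).
Implicit Types (U : set 'rV[R]_n) (g : 'rV[R]_n -> 'rV[R]_d).

(** Bounds on all derivatives near each point, from which [analytic_on] follows. Unlike power series
    they pass through sums, matrices and coordinate maps without any rearrangement. *)
Definition analytic_growth U g : Prop := Cinf U g /\
  forall x, U x -> exists r M C : R, [/\ 0 < r, 0 <= M, 0 <= C &
    forall s y, `|y - x| < r ->
      `|partials s g y| <= M * C ^+ size s * (size s)`!%:R].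

Lemma Cinf_partials U g s : Cinf U g -> Cinf U (partials s g).
Proof.
by move=> Hg; elim: s => [//|i s IH] k; exact: (Ck_partial i (IH k.+1)).
Qed.

Let term g (h : 'rV[R]_n) w y := (\prod_(i <- w) h 0 i) *: partials w g y.

(** The derivative of order [k] of [g] along [h]. Summing over ordered words counts every mixed
    derivative with its multiplicity, so that no multinomial coefficients appear. *)
Let taylor_term g (h : 'rV[R]_n) k y : 'rV[R]_d :=
  \sum_(s : {ffun 'I_k -> 'I_n}) term g h (word s) y.

Let taylor_term_derive U g h k y : open U -> Cinf U g -> U y ->
  is_derive y h (taylor_term g h k) (taylor_term g h k.+1 y).
Proof.
move=> oU Hg Uy.
have Hw w : is_derive y h (term g h w) (\sum_i term g h (i :: w) y).
  apply/is_derive_row => j.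
  have Hp : Ck 1 U (fun z => partials w g z 0 j).
    by apply: ((Ck_row _ _ oU).1 (Cinf_partials w Hg _) j).
  have := is_derive_mulc (\prod_(i <- w) h 0 i) (is_derive_C1 h oU Hp Uy).
  have -> : (fun z => term g h w z 0 j)
     = (fun z => (\prod_(i <- w) h 0 i) * partials w g z 0 j).
    by apply/funext => z; rewrite /term mxE.
  move=> H; apply: is_derive_eq.
  rewrite summxE mulr_sumr; apply: eq_bigr => i _; rewrite /term mxE big_cons /=.
  rewrite partial_row; last exact: (Ck_derivable i (Cinf_partials w Hg 1)).
  by rewrite mulrCA mulrA.
rewrite /taylor_term (sum_wordsS (fun w => term g h w y)) exchange_big /=.
by apply: is_derive_sumf => s _; exact: Hw.
Qed.

Lemma analytic_growth_analytic U g : open U -> analytic_growth U g ->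
  analytic_on R d n U g.
Proof.
move=> oU [Hg Hgr] x Ux; have [r1 [M [C [r10 M0 C0 HM]]]] := Hgr x Ux.
have [r2 r20 HU] := open_distP oU Ux.
(* There are [n ^ k] words of length [k], so the terms of order [k] are dominated by [M * q ^+ k];
   the summand 1 keeps [a] positive. The radius [a^-1 / 4] gives [q <= 1/4]: one factor 1/2 absorbs
   the [m.+1] left over by Cauchy's remainder, the other gives convergence. *)
pose a := n%:R * C + 1.
have a0 : 0 < a by rewrite ltr_wpDl // mulr_ge0.
pose r := Num.min (Num.min r1 r2) (a^-1 / 4).
have r0 : 0 < r by rewrite !lt_min r10 r20 divr_gt0 // invr_gt0.
exists r; split=> //.
exists (fun k s => k`!%:R^-1 *: partials (word s) g x) => y yr.
set h := y - x.
have [[hr1 hr2] hr3] : (`|h| < r1 /\ `|h| < r2) /\ `|h| < a^-1 / 4.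
  by move: yr; rewrite /r !lt_min => /andP[/andP[-> ->] ->].
pose q := n%:R * (C * `|h|).
have q0 : 0 <= q by rewrite !mulr_ge0.
have q4 : q <= 4^-1.
  apply: (@le_trans _ _ (a * `|h|)).
    by rewrite /q mulrA ler_wpM2r // lerDl.
  by have := ler_wpM2l (ltW a0) (ltW hr3); rewrite mulrA mulfV ?gt_eqF // mul1r.
have fk k : 0 < k`!%:R :> R by rewrite ltr0n fact_gt0.
have mon_le k (s : {ffun 'I_k -> 'I_n}) : `|\prod_(i <- word s) h 0 i| <= `|h| ^+ k.
  move: (word s) (size_word s) => w <-; elim: w => [|i w IH].
    by rewrite big_nil expr0 normr1.
  by rewrite big_cons normrM exprS ler_pM // normr_coord.
have term_le k z : `|z - x| < r1 -> `|taylor_term g h k z| <= M * q ^+ k * k`!%:R.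
  move=> zr; rewrite /taylor_term; apply: le_trans (ler_norm_sum _ _ _) _.
  apply: (@le_trans _ _ (\sum_(s : {ffun 'I_k -> 'I_n}) (M * C ^+ k * k`!%:R * `|h| ^+ k))).
    apply: ler_sum => s _; rewrite /term normrZ mulrC ler_pM //.
    by have := HM (word s) z zr; rewrite size_word.
  rewrite sumr_const card_ffun !card_ord -[leLHS]mulr_natr natrX /q !exprMn.
  by rewrite le_eqVlt; apply/orP; left; apply/eqP; ring.
have abs_le k : \sum_(s : {ffun 'I_k -> 'I_n})
    `|k`!%:R^-1 *: partials (word s) g x| * `|monomial R n k s h| <= M * q ^+ k.
  apply: (@le_trans _ _ (\sum_(s : {ffun 'I_k -> 'I_n}) (M * C ^+ k * `|h| ^+ k))).
    apply: ler_sum => s _; rewrite monomial_word ler_pM //.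
    rewrite normrZ normfV gtr0_norm // mulrC ler_pdivrMr //.
    by have := HM (word s) x; rewrite size_word subrr normr0; apply.
  rewrite sumr_const card_ffun !card_ord -[leLHS]mulr_natr natrX /q !exprMn.
  by rewrite le_eqVlt; apply/orP; left; apply/eqP; ring.
split.
  apply: nondecreasing_is_cvgn.
    apply/nondecreasing_seqP => m; rewrite big_ord_recr /= lerDl.
    by apply: sumr_ge0 => s _; rewrite mulr_ge0.
  exists (M * 2) => _ [m _ <-].
  apply: (@le_trans _ _ (M * \sum_(k < m) 2^-1 ^+ k)).
    rewrite mulr_sumr; apply: ler_sum => k _; apply: le_trans (abs_le k) _.
    rewrite ler_wpM2l // lerXn2r ?nnegrE ?invr_ge0 //.
    by apply: le_trans q4 _; rewrite lef_pV2 ?posrE // ler_nat.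
  rewrite ler_wpM2l //.
  have : \sum_(k < m) (2^-1 : R) ^+ k <= 2 - 2 * 2^-1 ^+ m.
    elim: m => [|m IH]; first by rewrite big_ord0 expr0 mulr1 subrr.
    by rewrite big_ord_recr /= exprS; lra.
  by move=> /le_trans; apply; rewrite gerBl mulr_ge0 // exprn_ge0 // invr_ge0.
have partial_sumE m : \sum_(k < m) \sum_(s : {ffun 'I_k -> 'I_n})
    monomial R n k s h *: (k`!%:R^-1 *: partials (word s) g x)
    = \sum_(k < m) k`!%:R^-1 *: taylor_term g h k x.
  apply: eq_bigr => k _; rewrite /taylor_term scaler_sumr; apply: eq_bigr => s _.
  by rewrite monomial_word /term !scalerA mulrC.
have Hrem m : `|g y - \sum_(k < m.+1) \sum_(s : {ffun 'I_k -> 'I_n})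
    monomial R n k s h *: (k`!%:R^-1 *: partials (word s) g x)| <= M * 2^-1 ^+ m.
  rewrite partial_sumE; apply: normr_row_le.
    by rewrite mulr_ge0 // exprn_ge0 // invr_ge0.
  move=> j.
  pose phi k (t : R) := taylor_term g h k (t *: h + x) 0 j.
  have Hpt (t : R) : 0 <= t <= 1 -> `|t *: h + x - x| <= `|h|.
    by move=> /andP[t0 t1]; rewrite addrK normrZ ger0_norm // ler_piMl.
  have dphi k (t : R) : 0 <= t <= 1 -> is_derive t 1 (phi k) (phi k.+1 t).
    move=> t01; have Ut : U (t *: h + x) by apply: HU; exact: le_lt_trans (Hpt t t01) _.
    have := (is_derive_row _ _ _ _).1 (taylor_term_derive h k oU Hg Ut) j.
    exact: is_derive_line_at.
  have := @Taylor_remainder R phi m (M * q ^+ m.+1 * m.+1`!%:R) dphi.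
  have phiB (t : R) : 0 <= t <= 1 -> `|phi m.+1 t| <= M * q ^+ m.+1 * m.+1`!%:R.
    move=> t01; apply: le_trans (normr_coord _ _) _; apply: term_le.
    exact: le_lt_trans (Hpt t t01) _.
  move=> /(_ phiB).
  have -> : phi 0%N 1 = g y 0 j.
    rewrite /phi /taylor_term (sum_words0 (fun w => term g h w _)) /term big_nil /=.
    by rewrite !scale1r /h subrK.
  have -> : \sum_(k < m.+1) phi k 0 / k`!%:R
     = (\sum_(k < m.+1) k`!%:R^-1 *: taylor_term g h k x) 0 j.
    by rewrite summxE; apply: eq_bigr => k _; rewrite mxE /phi scale0r add0r mulrC.
  rewrite !mxE => H; apply: le_trans H _.
  rewrite factS natrM mulrA mulfK ?gt_eqF // -mulrA ler_wpM2l //.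
  rewrite exprS.
  have : q ^+ m <= 4^-1 ^+ m by rewrite lerXn2r ?nnegrE ?invr_ge0.
  have m2 : m.+1%:R <= 2 ^+ m * 2 :> R.
    rewrite -exprSr -natrX ler_nat; exact/ltnW/ltn_expl.
  have -> : 4^-1 ^+ m = 2^-1 ^+ m * 2^-1 ^+ m :> R.
    by rewrite -exprMn -invfM -natrM.
  have : 2^-1 ^+ m * 2 ^+ m = 1 :> R by rewrite -exprMn mulVf // expr1n.
  have : 0 < 2^-1 ^+ m :> R by rewrite exprn_gt0 // invr_gt0.
  have : 0 <= q ^+ m by rewrite exprn_ge0.
  move: (q ^+ m) (2^-1 ^+ m) (2 ^+ m) m2 => A D T m2 A0 D0 DT AD.
  apply: (@le_trans _ _ (4^-1 * (D * D) * (T * 2))).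
    by rewrite ler_pM // ?mulr_ge0 // ler_pM.
  have -> : 4^-1 * (D * D) * (T * 2) = 2^-1 * D * (D * T).
    have -> : 4^-1 = 2^-1 * 2^-1 :> R by rewrite -invfM -natrM.
    by field.
  by rewrite DT mulr1; lra.
apply/cvgrPdist_lt => e e0.
have G0 : (fun m : nat => M * 2^-1 ^+ m) @ \oo --> (0 : R).
  rewrite -[X in _ --> X](mulr0 M); apply: cvgM; first exact: cvg_cst.
  by apply: cvg_expr; rewrite ger0_norm ?invr_ge0 // invf_lt1 // ltr1n.
have := (cvgrPdist_lt _ _).1 G0 e e0.
case=> m0 _ Hm; exists m0.+1 => // -[//|m] /= m0m.
apply: le_lt_trans (Hrem m) _.
by apply: le_lt_trans (ler_norm _) _; have := Hm m m0m; rewrite sub0r normrN.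
Qed.

End Growth.

(** * Even functions of one coordinate and the Darboux operator *)

Section Parity.
Variables (R : realType) (n d : nat).
Implicit Types (U : set 'rV[R]_n) (H : 'rV[R]_n -> 'rV[R]_d) (b : 'I_n).

Definition flip b (p : 'rV[R]_n) : 'rV[R]_n :=
  \row_i (if i == b then - p 0 i else p 0 i).

Definition parity b U (a : R) H := forall p, U p -> H (flip b p) = a *: H p.

Lemma flip_id b (p : 'rV[R]_n) : p 0 b = 0 -> flip b p = p.
Proof. by move=> p0; apply/rowP => i; rewrite mxE; case: eqP => // ->; rewrite p0 oppr0. Qed.

Lemma flip_line b i x (h : R) :
  flip b (h *: delta_mx 0 i + x) = (h * (if i == b then -1 else 1)) *: delta_mx 0 i + flip b x.
Proof.
apply/rowP => j; rewrite !mxE eqxx /=.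
have [->|jb] := eqVneq j b.
  by rewrite (eq_sym b); case: eqP => _; rewrite ?mulr1 ?mulrN1 ?mulr0 opprD // oppr0.
have [ji|ji] := eqVneq j i; last by rewrite !mulr0.
by rewrite -ji (negbTE jb) !mulr1.
Qed.

Lemma continuous_flip b : continuous (flip b).
Proof.
move=> p; apply/continuous_row => j.
have -> : (fun y => flip b y 0 j) = (fun y : 'rV[R]_n => (if j == b then -1 else 1) * y 0 j).
  by apply/funext => y; rewrite mxE; case: eqP; rewrite ?mulN1r ?mul1r.
apply: continuousM; first exact: cst_continuous.
exact: coord_continuous.
Qed.

Lemma Ck_flip k b U H : open U -> (forall p, U p -> U (flip b p)) ->
  Ck k U H -> Ck k U (fun p => H (flip b p)).
Proof.
move=> oU Uf; apply: (Ck_comp_coord (s := id) _ (@continuous_flip b)) => //.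
by move=> i x h; exact: flip_line.
Qed.

Lemma partial_flip b U H i p : open U -> (forall p, U p -> U (flip b p)) ->
  Ck 1 U H -> U p ->
  partial i (fun p => H (flip b p)) p = (if i == b then -1 else 1) *: partial i H (flip b p).
Proof.
move=> oU Uf H1 Up; apply: partial_val.
apply: (is_derive_comp_coord (fun h => flip_line b i p h)).
by apply: (Ck_is_derive i H1); exact: Uf.
Qed.

Lemma parity_partial b U a H i : open U -> (forall p, U p -> U (flip b p)) ->
  Ck 1 U H -> parity b U a H ->
  parity b U (if i == b then - a else a) (partial i H).
Proof.
move=> oU Uf H1 Ha p Up; have Ufp := Uf p Up.
have := partial_flip i oU Uf H1 Up.
rewrite (eq_partial (g' := fun p => a *: H p) i oU Up); last by move=> q Uq; exact: Ha.
have -> : partial i (fun p => a *: H p) p = a *: partial i H p.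
  by apply: partial_val; apply: is_deriveZ; exact: (Ck_is_derive i H1).
by case: eqP => _ E; rewrite ?scaleNr E ?scaleN1r ?opprK ?scale1r.
Qed.

Lemma odd_eq0 b U H (p : 'rV[R]_n) : parity b U (-1) H -> U p -> p 0 b = 0 -> H p = 0.
Proof.
move=> Ho Up p0; have := Ho p Up; rewrite flip_id // scaleN1r => /eqP.
by rewrite -subr_eq0 opprK -mulr2n -scaler_nat scaler_eq0 pnatr_eq0 /= => /eqP.
Qed.

(** Allows an identity to be divided by the coordinate [b]: the complement of the hyperplane is
    dense. *)
Lemma eq_off_hyperplane b U H H' : open U ->
  (forall p, U p -> {for p, continuous H}) -> (forall p, U p -> {for p, continuous H'}) ->
  (forall p, U p -> p 0 b != 0 -> H p = H' p) -> forall p, U p -> H p = H' p.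
Proof.
move=> oU HC HC' E p Up; have [p0|p0] := eqVneq (p 0 b) 0; last exact: E.
apply/eqP; rewrite -subr_eq0 -normr_le0; apply/ler_addgt0Pr => e e0; rewrite add0r.
have e20 : 0 < e / 2 by rewrite divr_gt0.
have [r1 r10 H1] := (continuous_distP _ _).1 (HC p Up) _ e20.
have [r2 r20 H2] := (continuous_distP _ _).1 (HC' p Up) _ e20.
have [r3 r30 H3] := open_distP oU Up.
pose r := Num.min (Num.min r1 r2) r3.
have r0 : 0 < r by rewrite !lt_min r10 r20.
pose q := (r / 2) *: delta_mx 0 b + p.
have : `|q - p| < r.
  rewrite addrK normrZ (le_lt_trans (ler_wpM2l _ (normr_delta_le1 _ _))) // mulr1.
  by rewrite gtr0_norm ?divr_gt0 // ltr_pdivrMr // ltr_pMr // ltr1n.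
rewrite !lt_min => /andP[/andP[qr1 qr2] qr3].
have qb : q 0 b != 0 by rewrite !mxE !eqxx mulr1 p0 addr0 gt_eqF // divr_gt0.
have := H1 q qr1; have := H2 q qr2; rewrite (E q (H3 _ qr3) qb).
move: (H p) (H' p) (H' q) => x y z zy zx.
by rewrite -(subrKA z) (le_trans (ler_normD _ _)) // [leRHS]splitr lerD // ltW // distrC.
Qed.

End Parity.

(** * Division of an odd function by its coordinate *)

Section QuotientByCoordinate.
Variables (R : realType) (n d : nat) (b : 'I_n).
Implicit Types (U : set 'rV[R]_n) (H : 'rV[R]_n -> 'rV[R]_d).

(** For an odd smooth [H] the value on the hyperplane is the limit of the quotient, which is what
    makes [divc H] smooth. *)
Definition divc H (p : 'rV[R]_n) : 'rV[R]_d :=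
  if p 0 b == 0 then partial b H p else (p 0 b)^-1 *: H p.

Let scale_b (t : R) (x : 'rV[R]_n) : 'rV[R]_n :=
  \row_i (if i == b then t * x 0 i else x 0 i).

Let cb (i : 'I_n) (t : R) : R := if i == b then t else 1.

Let scale_b_line t i x (h : R) :
  scale_b t (h *: delta_mx 0 i + x) = (h * cb i t) *: delta_mx 0 i + scale_b t x.
Proof.
apply/rowP => j; rewrite !mxE /cb eqxx /=.
have [->|jb] := eqVneq j b.
  rewrite (eq_sym b); case: eqP => _; rewrite ?mulr1 ?mulr0 ?add0r //.
  by rewrite mulrDr mulrC.
have [ji|ji] := eqVneq j i; last by rewrite !mulr0.
by rewrite -ji (negbTE jb) !mulr1.
Qed.

Let scale_b_cont (t : R) x (e : R) : 0 < e -> exists2 r : R, 0 < r &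
  forall t' y, `|t' - t| < r -> `|y - x| < r -> `|scale_b t' y - scale_b t x| < e.
Proof.
move=> e0; pose B := `|t| + `|x| + 2.
have B0 : 0 < B by rewrite ltr_wpDl // addr_ge0.
exists (Num.min 1 (e / B)); first by rewrite lt_min ltr01 divr_gt0.
move=> t' y; rewrite !lt_min => /andP[t1 te] /andP[y1 ye].
apply: normr_row_lt => // j; rewrite !mxE.
have yj : `|y 0 j - x 0 j| < e / B.
  by apply: le_lt_trans ye; have := normr_coord (y - x) j; rewrite !mxE.
have eB : e / B <= e.
  rewrite ler_pdivrMr // ler_peMr // ?ltW // /B.
  by have := normr_ge0 t; have := normr_ge0 x; lra.
case: eqP => _; last exact: lt_le_trans yj _.
have -> : t' * y 0 j - t * x 0 j = t' * (y 0 j - x 0 j) + (t' - t) * x 0 j by ring.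
rewrite (le_lt_trans (ler_normD _ _)) // !normrM.
have t'B : `|t'| <= `|t| + 1.
  by rewrite -(subrK t t') (le_trans (ler_normD _ _)) // addrC lerD2l ltW.
have xB := normr_coord x j.
have eBE : e = e / B * B by rewrite divfK // gt_eqF.
have eB0 : 0 < e / B by rewrite divr_gt0.
rewrite [X in _ < X]eBE.
apply: (@le_lt_trans _ _ ((`|t| + 1) * (e / B) + (e / B) * `|x|)).
  by rewrite lerD // ler_pM // ltW.
by rewrite mulrC -mulrDr ltr_pM2l // /B; lra.
Qed.

Let cb_cont i : cont01 (cb i).
Proof.
move=> t _; rewrite /cb; case: eqP => _; last exact: cst_continuous.
exact: cvg_id.
Qed.

Lemma divcE U H (p : 'rV[R]_n) : parity b U (-1) H -> U p -> p 0 b *: divc H p = H p.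
Proof.
move=> Ho Up; rewrite /divc; case: eqP => [p0|/eqP p0]; last by rewrite scalerA mulfV // scale1r.
by rewrite p0 scale0r (odd_eq0 Ho Up p0).
Qed.

Lemma parity_divc U H : (forall p, U p -> U (flip b p)) ->
  parity b U (-1) H -> parity b U 1 (divc H).
Proof.
move=> Uf Ho p Up; rewrite scale1r; have [p0|p0] := eqVneq (p 0 b) 0.
  by rewrite flip_id.
rewrite /divc (negbTE p0) !mxE eqxx oppr_eq0 (negbTE p0) Ho //.
by rewrite scaleN1r scalerN invrN scaleNr opprK.
Qed.

Lemma parity_divc_other U H (c : 'I_n) (a : R) : open U ->
  (forall p, U p -> U (flip c p)) -> c != b -> Ck 1 U H ->
  parity c U a H -> parity c U a (divc H).
Proof.
move=> oU Uf cb' H1 Ha p Up; rewrite /divc !mxE [b == c]eq_sym (negbTE cb').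
case: ifP => _; last by rewrite Ha // scalerA mulrC -scalerA.
by have := parity_partial b oU Uf H1 Ha Up; rewrite [b == c]eq_sym (negbTE cb').
Qed.

(* Hadamard: near [p 0 b = 0] the quotient is the average of [partial b H]
   over the segment joining [p] to the hyperplane. *)
Lemma Cinf_divc U H : open U -> Cinf U H -> parity b U (-1) H -> Cinf U (divc H).
Proof.
move=> oU HC Ho k; apply: Ck_local => p Up.
have [p0|p0] := eqVneq (p 0 b) 0; last first.
  pose U' := [set q | U q /\ q 0 b != 0].
  have oU' : open U'.
    apply: openI => //.
    apply: (@open_comp _ _ (fun q : 'rV[R]_n => q 0 b) [set t : R | t != 0]); last exact: open_neq.
    by move=> q _; exact: coord_continuous.
  exists U' => //.
  apply: (@Ck_eq _ _ _ k U' (fun q => (q 0 b)^-1 *: H q)) => //.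
    by move=> q [_ q0]; rewrite /divc (negbTE q0).
  apply: CkZ => //; last by apply: Ck_sub (HC k) => q [].
  by apply: Ck_inv => //; [move=> q []|exact: Ck_coord].
have [r r0 HU] := open_distP oU Up.
pose B := [set q : 'rV[R]_n | `|q - p| < r].
have oB : open B by exact: open_normball.
have sB (t : R) q : 0 <= t <= 1 -> B q -> B (scale_b t q).
  move=> /andP[t0 t1] Bq; apply: normr_row_lt => // j; rewrite !mxE.
  have := normr_coord (q - p) j; rewrite !mxE => qj.
  case: eqP => [jb|_]; last exact: le_lt_trans qj _.
  move: qj; rewrite jb p0 !subr0 => qj; apply: le_lt_trans Bq.
  by rewrite normrM ger0_norm // (le_trans _ qj) // ler_piMl.
exists B; first by rewrite /B /= subrr normr0.
have BU : B `<=` U by move=> q; exact: HU.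
pose Hj j q := H q 0 j.
have HjC j m : Ck m B (Hj j) by apply: ((Ck_row _ _ oB).1 _ j); exact: Ck_sub (HC m).
apply/(Ck_row _ _ oB) => j.
apply: (@Ck_eq _ _ _ k B (average scale_b (fun=> 1) (partial b (Hj j)))) => //; last first.
  apply: (Ck_average scale_b_line scale_b_cont cb_cont oB sB (@cont01_cst _ 1)).
  exact: (Ck_partial b (HjC j k.+1)).
move=> q Bq; have Uq := BU q Bq.
have Hd (t : R) : 0 <= t <= 1 ->
    is_derive t 1 (fun t => Hj j (scale_b t q)) (q 0 b * partial b (Hj j) (scale_b t q)).
  move=> t01; pose q0 := scale_b 0 q.
  have lE (s : R) : scale_b s q = (s * q 0 b) *: delta_mx 0 b + q0.
    apply/rowP => i; rewrite !mxE eqxx /=; case: eqP => [->|_].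
      by rewrite mulr1 mul0r addr0.
    by rewrite mulr0 add0r.
  have Ht : is_derive (t * q 0 b) 1 (fun h : R => Hj j (h *: delta_mx 0 b + q0))
      (partial b (Hj j) (scale_b t q)).
    rewrite lE; apply: is_derive_line_at; apply: (Ck_is_derive b (HjC j 1)).
    by rewrite -lE; exact: sB.
  have := is_derive1_compW (f := fun h : R => Hj j (h *: delta_mx 0 b + q0))
     (p := fun s => s * q 0 b) Ht (is_derive_mul (is_derive_id t 1) (is_derive_cst (q 0 b) t 1)).
  have -> : (fun t => Hj j (scale_b t q)) =
     (fun h : R => Hj j (h *: delta_mx 0 b + q0)) \o (fun s => s * q 0 b).
    by apply/funext => s /=; rewrite lE.
  by move=> Z; apply: is_derive_eq; rewrite mulr0 addr0 mul1r.
have C1 : cont01 (fun t => partial b (Hj j) (scale_b t q)).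
  exact: (average_cont01 scale_b_cont sB (Ck_partial b (HjC j 1)) Bq).
have C2 : cont01 (fun t => q 0 b * partial b (Hj j) (scale_b t q)).
  by apply: cont01M => //; exact: cont01_cst.
have := int01_FTC C2 Hd; rewrite int01Z //.
have -> : scale_b 1 q = q by apply/rowP => i; rewrite mxE mul1r; case: eqP.
have -> : Hj j (scale_b 0 q) = 0.
  have Us : U (scale_b 0 q) by apply: BU; apply: sB => //; rewrite lexx ler01.
  by rewrite /Hj (odd_eq0 Ho Us) ?mxE // eqxx mul0r.
rewrite subr0 /average => FT.
have -> : int01 (fun t => 1 * partial b (Hj j) (scale_b t q)) =
    int01 (fun t => partial b (Hj j) (scale_b t q)).
  by apply: eq_int01 => t _; rewrite mul1r.
rewrite /divc; case: eqP => [q0|/eqP q0].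
  rewrite partial_row; last exact: (Ck_derivable b (HC 1%N) Uq).
  rewrite -[RHS]int01_cst; apply: eq_int01 => t _; congr (partial _ _ _).
  by apply/rowP => i; rewrite mxE; case: eqP => // ->; rewrite q0 mulr0.
by rewrite mxE -/(Hj j q) -FT mulrA mulVf // mul1r.
Qed.

End QuotientByCoordinate.

(** * The Euler-Poisson-Darboux equation *)

Section Darboux.
Variables (R : realType) (n d : nat) (b : 'I_n) (U : set 'rV[R]_n).
Hypotheses (oU : open U) (Uf : forall p, U p -> U (flip b p)).
Implicit Types H : 'rV[R]_n -> 'rV[R]_d.

(** The derivative with respect to half the square of the coordinate [b]. Unlike [partial b] it
    preserves evenness, so that it can be iterated. *)
Definition radial H := divc b (partial b H).

Definition smooth_even H := Cinf U H /\ parity b U 1 H.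

Lemma parity_radial_aux H : smooth_even H -> parity b U (-1) (partial b H).
Proof. by move=> [HC He]; have := parity_partial b oU Uf (HC 1%N) He; rewrite eqxx. Qed.

Lemma smooth_even_radial H : smooth_even H -> smooth_even (radial H).
Proof.
move=> He; have Ho := parity_radial_aux He; have [HC _] := He; split.
  by apply: Cinf_divc => // k; exact: (Ck_partial b (HC k.+1)).
exact: parity_divc.
Qed.

Lemma smooth_even_partial H i : i != b -> smooth_even H -> smooth_even (partial i H).
Proof.
move=> ib [HC He]; split; first by move=> k; exact: (Ck_partial i (HC k.+1)).
by have := parity_partial i oU Uf (HC 1%N) He; rewrite (negbTE ib).
Qed.

Lemma smooth_evenD H H' : smooth_even H -> smooth_even H' ->
  smooth_even (fun p => H p + H' p).
Proof.
move=> [HC He] [HC' He']; split; first by move=> k; exact: CkD.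
by move=> p Up; rewrite He // He' // !scale1r.
Qed.

Lemma smooth_evenZ H (a : R) : smooth_even H -> smooth_even (fun p => a *: H p).
Proof.
move=> [HC He]; split; first by move=> k; exact: CkZc.
by move=> p Up; rewrite He // !scale1r.
Qed.

Lemma smooth_even_sqr H : smooth_even H -> smooth_even (fun p => p 0 b ^+ 2 *: H p).
Proof.
move=> [HC He]; split.
  move=> k; apply: CkZ => //.
  apply: (@Ck_eq _ _ _ k U (fun p : 'rV[R]_n => p 0 b *: p 0 b)) => //.
  by apply: CkZ => //; exact: Ck_coord.
by move=> p Up; rewrite He // !mxE eqxx sqrrN !scale1r.
Qed.

Lemma smooth_even_sum (I : Type) (r : seq I) (P : pred I) (F : I -> 'rV[R]_n -> 'rV[R]_d) :
  (forall i, P i -> smooth_even (F i)) ->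
  smooth_even (fun p => \sum_(i <- r | P i) F i p).
Proof.
move=> HF; split; first by move=> k; apply: Ck_sum => // i /HF[].
move=> p Up; rewrite scale1r; apply: eq_bigr => i /HF[_ He].
by rewrite He // scale1r.
Qed.

Lemma partial_radial H p : smooth_even H -> U p ->
  partial b H p = p 0 b *: radial H p.
Proof. by move=> He Up; rewrite (divcE (parity_radial_aux He) Up). Qed.

Definition lap_other H p := \sum_(i | i != b) partial i (partial i H) p.

(* The Euler-Poisson-Darboux operator: the Laplacian of the function obtained
   from [H] by replacing the coordinate [b] with the norm of [c] variables. *)
Definition darboux (c : R) H p :=
  lap_other H p + c *: radial H p + p 0 b ^+ 2 *: radial (radial H) p.

Lemma smooth_even_lap_other H : smooth_even H -> smooth_even (lap_other H).
Proof.
move=> He; apply: smooth_even_sum => i ib.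
exact: (smooth_even_partial ib (smooth_even_partial ib He)).
Qed.

Lemma smooth_even_darboux c H : smooth_even H -> smooth_even (darboux c H).
Proof.
move=> He; have HB := smooth_even_radial He; have HBB := smooth_even_radial HB.
apply: smooth_evenD; last exact: smooth_even_sqr.
by apply: smooth_evenD; [exact: smooth_even_lap_other|exact: smooth_evenZ].
Qed.

Let dcoord_b i (p : 'rV[R]_n) :
  is_derive p (delta_mx 0 i) (fun p : 'rV[R]_n => p 0 b) ((b == i)%:R : R).
Proof. exact: is_derive_coord. Qed.

Let partial_coordZ i H p : Ck 1 U H -> U p ->
  partial i (fun p => p 0 b *: H p) p = p 0 b *: partial i H p + (b == i)%:R *: H p.
Proof.
by move=> H1 Up; apply: partial_val; apply: is_deriveZW => //; exact: (Ck_is_derive i H1).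
Qed.

Let lap_other_coordZ H p : Cinf U H -> U p ->
  lap_other (fun p => p 0 b *: H p) p = p 0 b *: lap_other H p.
Proof.
move=> HC Up; rewrite /lap_other scaler_sumr; apply: eq_bigr => i ib.
rewrite (eq_partial (g' := fun p => p 0 b *: partial i H p) i oU Up).
  rewrite (partial_coordZ i (Ck_partial i (HC 2%N)) Up).
  by rewrite eq_sym (negbTE ib) scale0r addr0.
move=> q Uq; rewrite (partial_coordZ i (HC 1%N) Uq).
by rewrite eq_sym (negbTE ib) scale0r addr0.
Qed.

Let eq_lap_other H H' p : U p -> (forall q, U q -> H q = H' q) ->
  lap_other H p = lap_other H' p.
Proof.
move=> Up E; apply: eq_bigr => i ib; apply: (eq_partial i oU Up) => q Uq.
exact: (eq_partial i oU Uq).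
Qed.

Let partial_lap_other H p : Cinf U H -> U p ->
  partial b (lap_other H) p = lap_other (partial b H) p.
Proof.
move=> HC Up; rewrite /lap_other partial_sum; last first.
  by move=> i _; exact: (Ck_derivable b (Ck_partial i (Ck_partial i (HC 3%N)))).
apply: eq_bigr => i ib; have H2 := Ck_partial i (HC 3%N).
rewrite (partialC_row b i oU H2 Up); apply: (eq_partial i oU Up) => q Uq.
exact: (partialC_row b i oU (HC 2%N) Uq).
Qed.

(** Differentiate the equation along [b] and divide by [p 0 b]: the factor [p 0 b ^+ 2] in front of
    [radial (radial H)] contributes [2 *: radial (radial H)], which raises the parameter by 2. *)
Lemma darboux_radial c H : smooth_even H -> (forall p, U p -> darboux c H p = 0) ->
  forall p, U p -> darboux (c + 2) (radial H) p = 0.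
Proof.
move=> He E.
have HB := smooth_even_radial He; have HBB := smooth_even_radial HB.
have HBBB := smooth_even_radial HBB.
have [HC _] := He; have [HBC _] := HB; have [HBBC _] := HBB.
apply: (eq_off_hyperplane (b := b) oU).
- move=> p Up; have [DC _] := smooth_even_darboux (c + 2) HB.
  exact: (Ck_cont (DC 0%N) Up).
- by move=> p _; exact: cst_continuous.
move=> p Up p0.
have D0 : partial b (darboux c H) p = 0.
  by rewrite (eq_partial (g' := fun=> 0) b oU Up) // partialE derive_cst.
have L1 : is_derive p (delta_mx 0 b) (lap_other H) (p 0 b *: lap_other (radial H) p).
  have [LC _] := smooth_even_lap_other He.
  have := Ck_is_derive b (LC 1%N) Up; rewrite (partial_lap_other HC Up).
  rewrite (eq_lap_other (H' := fun p => p 0 b *: radial H p) Up); last first.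
    by move=> q Uq; exact: partial_radial.
  by rewrite lap_other_coordZ.
have L2 : is_derive p (delta_mx 0 b) (fun p => c *: radial H p)
    (c *: (p 0 b *: radial (radial H) p)).
  apply: is_deriveZ; rewrite -(partial_radial HB Up).
  exact: (Ck_is_derive b (HBC 1%N) Up).
have L3 : is_derive p (delta_mx 0 b) (fun p => p 0 b ^+ 2 *: radial (radial H) p)
    (p 0 b ^+ 2 *: (p 0 b *: radial (radial (radial H)) p)
     + (2 * p 0 b) *: radial (radial H) p).
  apply: is_deriveZW.
    have := is_derive_sqr (dcoord_b b p); rewrite eqxx mulr1; exact.
  rewrite -(partial_radial HBB Up); exact: (Ck_is_derive b (HBBC 1%N) Up).
have := partial_val (is_derive_addf (is_derive_addf L1 L2) L3).
rewrite -/(darboux c H) D0 => D1.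
apply: (@scalerI _ _ (p 0 b)) => //; rewrite scaler0 D1 /darboux.
move: (lap_other _ p) (radial (radial H) p) (radial _ p) => X Y Z.
by apply/rowP => j; rewrite !mxE; ring.
Qed.

(** With [Q = divc b O], the second derivative of [p 0 b *: Q] along [b] is [p 0 b] times [3 *:
    radial Q + p 0 b ^+ 2 *: radial (radial Q)]; dividing the Laplace equation by [p 0 b] gives the
    parameter 3. *)
Lemma darboux_of_harmonic O : Cinf U O -> parity b U (-1) O ->
  (forall p, U p -> \sum_i partial i (partial i O) p = 0) ->
  forall p, U p -> darboux 3 (divc b O) p = 0.
Proof.
move=> OC Oo Oharm.
pose Q := divc b O.
have HQ : smooth_even Q by split; [exact: Cinf_divc|exact: parity_divc].
have HB := smooth_even_radial HQ; have HBB := smooth_even_radial HB.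
have [QC _] := HQ; have [QBC _] := HB.
have OE q : U q -> O q = q 0 b *: Q q by move=> Uq; rewrite (divcE Oo Uq).
apply: (eq_off_hyperplane (b := b) oU).
- move=> p Up; have [DC _] := smooth_even_darboux 3 HQ.
  exact: (Ck_cont (DC 0%N) Up).
- by move=> p _; exact: cst_continuous.
move=> p Up p0.
have O1 q : U q -> partial b O q = q 0 b ^+ 2 *: radial Q q + Q q.
  move=> Uq; rewrite (eq_partial b oU Uq OE) (partial_coordZ b (QC 1%N) Uq).
  by rewrite eqxx scale1r (partial_radial HQ Uq) scalerA.
have O2 : partial b (partial b O) p =
    p 0 b *: (3 *: radial Q p + p 0 b ^+ 2 *: radial (radial Q) p).
  rewrite (eq_partial b oU Up O1).
  have D1 : is_derive p (delta_mx 0 b) (fun p => p 0 b ^+ 2 *: radial Q p)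
     (p 0 b ^+ 2 *: (p 0 b *: radial (radial Q) p) + (2 * p 0 b) *: radial Q p).
    apply: is_deriveZW.
      have := is_derive_sqr (dcoord_b b p); rewrite eqxx mulr1; exact.
    rewrite -(partial_radial HB Up); exact: (Ck_is_derive b (QBC 1%N) Up).
  have D2 : is_derive p (delta_mx 0 b) Q (p 0 b *: radial Q p).
    rewrite -(partial_radial HQ Up); exact: (Ck_is_derive b (QC 1%N) Up).
  rewrite (partial_val (is_derive_addf D1 D2)).
  move: (radial (radial Q) p) (radial Q p) => X Y.
  by apply/rowP => j; rewrite !mxE; ring.
have := Oharm p Up; rewrite (bigD1 b) //= O2.
rewrite -/(lap_other O p) (eq_lap_other Up OE) (lap_other_coordZ QC Up).
rewrite -scalerDr => /eqP; rewrite scaler_eq0 (negbTE p0) /= => /eqP.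
by rewrite /darboux -/Q addrC addrA.
Qed.

End Darboux.

(** * The Laplacian and operations with constant coefficients *)

Definition laplacian (R : realType) (n : nat) (W : normedModType R)
    (g : 'rV[R]_n -> W) : 'rV[R]_n -> W :=
  fun p => \sum_i partial i (partial i g) p.

Section Laplacian.
Variables (R : realType) (n d : nat) (U : set 'rV[R]_n).
Hypothesis oU : open U.
Implicit Types g : 'rV[R]_n -> 'rV[R]_d.

Lemma eq_laplacian g g' : (forall p, U p -> g p = g' p) ->
  forall p, U p -> laplacian g p = laplacian g' p.
Proof.
move=> E p Up; apply: eq_bigr => i _; apply: (eq_partial i oU Up) => q Uq.
exact: (eq_partial i oU Uq).
Qed.

Lemma eq_iter_laplacian k g g' : (forall p, U p -> g p = g' p) ->
  forall p, U p -> iter k (@laplacian R n 'rV[R]_d) g p = iter k (@laplacian R n 'rV[R]_d) g' p.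
Proof. by move=> E; elim: k => [//|k IH] p Up /=; exact: eq_laplacian. Qed.

Lemma Cinf_laplacian g : Cinf U g -> Cinf U (laplacian g).
Proof.
by move=> gC k; apply: Ck_sum => // i _; exact: (Ck_partial i (Ck_partial i (gC k.+2))).
Qed.

Lemma Cinf_iter_laplacian k g : Cinf U g -> Cinf U (iter k (@laplacian R n 'rV[R]_d) g).
Proof. by move=> gC; elim: k => [//|k IH] /=; exact: Cinf_laplacian. Qed.

Lemma laplacianD g g' p : Cinf U g -> Cinf U g' -> U p ->
  laplacian (fun p => g p + g' p) p = laplacian g p + laplacian g' p.
Proof.
move=> gC gC' Up; rewrite -big_split /=; apply: eq_bigr => i _.
rewrite (eq_partial (g' := fun p => partial i g p + partial i g' p) i oU Up).
  apply: partial_val; apply: is_derive_addf.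
    exact: (Ck_is_derive i (Ck_partial i (gC 2%N)) Up).
  exact: (Ck_is_derive i (Ck_partial i (gC' 2%N)) Up).
move=> q Uq; apply: partial_val; apply: is_derive_addf.
  exact: (Ck_is_derive i (gC 1%N) Uq).
exact: (Ck_is_derive i (gC' 1%N) Uq).
Qed.

Lemma laplacian_mulmxr (d' : nat) (M : 'M[R]_(d, d')) g p : Cinf U g -> U p ->
  laplacian (fun p => g p *m M) p = laplacian g p *m M.
Proof.
move=> gC Up; rewrite mulmx_suml; apply: eq_bigr => i _.
rewrite (eq_partial (g' := fun p => partial i g p *m M) i oU Up).
  apply: partial_val; apply: is_derive_mulmxr.
  exact: (Ck_is_derive i (Ck_partial i (gC 2%N)) Up).
move=> q Uq; apply: partial_val; apply: is_derive_mulmxr.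
exact: (Ck_is_derive i (gC 1%N) Uq).
Qed.

Lemma laplacian_sum (I : Type) (r : seq I) (P : pred I)
    (F : I -> 'rV[R]_n -> 'rV[R]_d) p :
  (forall i, P i -> Cinf U (F i)) -> U p ->
  laplacian (fun p => \sum_(i <- r | P i) F i p) p = \sum_(i <- r | P i) laplacian (F i) p.
Proof.
move=> FC Up; rewrite exchange_big /=; apply: eq_bigr => i _.
rewrite (eq_partial (g' := fun p => \sum_(j <- r | P j) partial i (F j) p) i oU Up).
  rewrite partial_sum // => j Pj; exact: (Ck_derivable i (Ck_partial i (FC j Pj 2%N)) Up).
move=> q Uq; rewrite partial_sum // => j Pj; exact: (Ck_derivable i (FC j Pj 1%N) Uq).
Qed.

Lemma laplacian_partial g i p : Cinf U g -> U p ->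
  partial i (laplacian g) p = laplacian (partial i g) p.
Proof.
move=> gC Up; rewrite partial_sum; last first.
  by move=> k _; exact: (Ck_derivable i (Ck_partial k (Ck_partial k (gC 3%N)))).
apply: eq_bigr => k _; have H2 := Ck_partial k (gC 3%N).
rewrite (partialC_row i k oU H2 Up); apply: (eq_partial k oU Up) => q Uq.
exact: (partialC_row i k oU (gC 2%N) Uq).
Qed.

End Laplacian.

(** * Functions of the norm of a block of variables *)

Section RadialComposition.
Variables (R : realType) (n m d : nat) (b : 'I_n) (S : {set 'I_m}).
Variables (src : 'I_n -> 'I_m) (tgt : 'I_m -> 'I_n).
Hypothesis src_out : forall j, j != b -> src j \notin S.
Hypothesis tgtK : forall i, i \notin S -> src (tgt i) = i.
Hypothesis tgt_neq : forall i, i \notin S -> tgt i != b.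
Hypothesis srcK : forall j, j != b -> tgt (src j) = j.

Definition sqnorm (q : 'rV[R]_m) : R := \sum_(s in S) q 0 s ^+ 2.
Definition dn (q : 'rV[R]_m) : 'rV[R]_n :=
  \row_j (if j == b then Num.sqrt (sqnorm q) else q 0 (src j)).

Lemma sqnorm_ge0 q : 0 <= sqnorm q.
Proof. by apply: sumr_ge0 => s _; exact: sqr_ge0. Qed.

Lemma dn_b q : dn q 0 b = Num.sqrt (sqnorm q).
Proof. by rewrite mxE eqxx. Qed.

Lemma dn_b_sqr q : dn q 0 b ^+ 2 = sqnorm q.
Proof. by rewrite dn_b sqr_sqrtr // sqnorm_ge0. Qed.

Lemma continuous_dn : continuous dn.
Proof.
move=> q; apply/continuous_row => j.
have -> : (fun y => dn y 0 j) =
    (fun y => if j == b then Num.sqrt (sqnorm y) else y 0 (src j)).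
  by apply/funext => y; rewrite mxE.
case: (j == b); last exact: coord_continuous.
have sc : {for q, continuous sqnorm}.
  apply: (@cvg_sumr _ _ _ (nbhs q)) => s _.
  have cs := @coord_continuous _ 1 m 0 s q.
  exact: (continuousM cs cs).
exact: (continuous_comp sc (@sqrt_continuous R (sqnorm q))).
Qed.

Lemma dn_line_out i q (h : R) : i \notin S ->
  dn (h *: delta_mx 0 i + q) = (h * 1) *: delta_mx 0 (tgt i) + dn q.
Proof.
move=> iS; apply/rowP => j; rewrite !mxE eqxx mulr1 /=.
have [->|jb] := eqVneq j b.
  rewrite eq_sym (negbTE (tgt_neq iS)) mulr0 add0r; congr Num.sqrt.
  apply: eq_bigr => s sS; rewrite !mxE eqxx /=.
  by case: eqP => [si|_]; [rewrite -si sS in iS|rewrite mulr0 add0r].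
congr (_ * _%:R + _); congr (nat_of_bool _).
apply/eqP/eqP => [<-|->]; first by rewrite srcK.
exact: tgtK.
Qed.

Lemma sqnorm_line s q (h : R) : s \in S ->
  sqnorm (h *: delta_mx 0 s + q) = sqnorm q + (2 * q 0 s) * h + h ^+ 2.
Proof.
move=> sS; rewrite /sqnorm (bigD1 s) //= [in RHS](bigD1 s) //= !mxE !eqxx mulr1.
rewrite (eq_bigr (fun i => q 0 i ^+ 2)); first by ring.
by move=> i /andP[_ is_]; rewrite !mxE eqxx /= (negbTE is_) mulr0 add0r.
Qed.

Lemma dn_line_in s q (h : R) : s \in S ->
  dn (h *: delta_mx 0 s + q) =
  (Num.sqrt (sqnorm (h *: delta_mx 0 s + q)) - Num.sqrt (sqnorm q)) *: delta_mx 0 b + dn q.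
Proof.
move=> sS; apply/rowP => j; rewrite !mxE eqxx /=.
have [jb|jb] := eqVneq j b; first by rewrite mulr1 subrK.
rewrite mulr0 !add0r; case: eqP => [js|_]; last by rewrite mulr0 add0r.
by have := src_out jb; rewrite js sS.
Qed.

Variable U : set 'rV[R]_n.
Hypotheses (oU : open U) (Uf : forall p, U p -> U (flip b p)).
Let U' := [set q | U (dn q)].
Implicit Types H : 'rV[R]_n -> 'rV[R]_d.

Lemma open_dn : open U'.
Proof. by apply: (@open_comp _ _ dn U) => // q _; exact: continuous_dn. Qed.
Let oU' := open_dn.

Lemma is_derive_dn_out H i q : Ck 1 U H -> U' q -> i \notin S ->
  is_derive q (delta_mx 0 i) (H \o dn) (partial (tgt i) H (dn q)).
Proof.
move=> H1 Uq iS; rewrite -[X in is_derive _ _ _ X]scale1r.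
apply: (is_derive_comp_coord (fun h => dn_line_out q h iS)).
exact: (Ck_is_derive _ H1).
Qed.

(** Where the norm is positive this is the chain rule for the square root. Where it vanishes, moving
    by [h] along [s] moves [dn q] by the absolute value of [h] along [b]; evenness of [H] removes
    the absolute value, and both sides are 0. *)
Lemma is_derive_dn_in H s q : smooth_even b U H -> U' q -> s \in S ->
  is_derive q (delta_mx 0 s) (H \o dn) (q 0 s *: radial b H (dn q)).
Proof.
move=> He Uq sS; have [HC Hpar] := He.
have [N0|N0] := eqVneq (sqnorm q) 0.
  have qs : q 0 s = 0.
    have : q 0 s ^+ 2 <= sqnorm q.
      rewrite /sqnorm (bigD1 s) //= lerDl.
      by apply: sumr_ge0 => i _; exact: sqr_ge0.
    by rewrite N0 => qle; apply/eqP; rewrite -sqrf_eq0 eq_le qle sqr_ge0.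
  have db : dn q 0 b = 0 by rewrite dn_b N0 sqrtr0.
  rewrite qs scale0r.
  apply/line_is_derive.
  have Hd : is_derive (dn q) (delta_mx 0 b) H 0.
    have := Ck_is_derive b (HC 1%N) Uq.
    by rewrite (partial_radial oU Uf He Uq) db scale0r.
  apply: near_eq_is_derive ((line_is_derive _ _ _ _).1 Hd).
  have [r r0 Hr] := open_distP oU Uq.
  near=> h => /=.
  have hr : `|h| < r.
    near: h; apply/nbhs_ballP; exists r => // h; rewrite -ball_normE /ball_ /=.
    by rewrite sub0r normrN.
  rewrite dn_line_in // sqnorm_line // N0 sqrtr0 subr0 add0r qs mulr0 mul0r add0r sqrtr_sqr.
  have [h0|h0] := leP 0 h; first by rewrite ger0_norm.
  rewrite ltr0_norm //.
  have Uh : U (h *: delta_mx 0 b + dn q).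
    apply: Hr; rewrite addrK normrZ.
    by apply: le_lt_trans hr; rewrite ler_piMr // normr_delta_le1.
  by rewrite -[LHS]scale1r -Hpar // flip_line eqxx mulrN1 flip_id.
pose psi (h : R) := Num.sqrt (sqnorm q + (2 * q 0 s) * h + h ^+ 2) - Num.sqrt (sqnorm q).
have Np : 0 < sqnorm q by rewrite lt_neqAle eq_sym N0 sqnorm_ge0.
have dpsi : is_derive (0 : R) 1 psi (q 0 s / Num.sqrt (sqnorm q)).
  have d1 : is_derive (0 : R) 1 (fun h : R => sqnorm q + (2 * q 0 s) * h + h ^+ 2) (2 * q 0 s).
    have := is_derive_addf (is_derive_addf (is_derive_cst (sqnorm q) (0 : R) 1)
       (is_derive_mulc (2 * q 0 s) (is_derive_id (0 : R) 1)))
       (is_derive_sqr (is_derive_id (0 : R) 1)).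
    by move=> Z; apply: is_derive_eq; rewrite mul0r mulr0 addr0 add0r mulr1.
  have Z0 : sqnorm q + 2 * q 0 s * 0 + 0 ^+ 2 = sqnorm q.
    by rewrite mulr0 expr0n /= !addr0.
  have d2 : is_derive (sqnorm q + 2 * q 0 s * 0 + 0 ^+ 2) 1 (@Num.sqrt R)
      (2 * Num.sqrt (sqnorm q))^-1.
    by rewrite Z0; exact: is_derive1_sqrt.
  have := is_deriveB (is_derive1_compW (f := @Num.sqrt R)
       (p := fun h : R => sqnorm q + (2 * q 0 s) * h + h ^+ 2) (t := 0) d2 d1)
     (is_derive_cst (Num.sqrt (sqnorm q)) (0 : R) 1).
  move=> Z; apply: is_derive_eq; rewrite subr0 /GRing.scale /=.
  by field; rewrite gt_eqF // sqrtr_gt0.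
have := is_derive_comp_line (g := H) (l := dn) (p := psi) (x := q)
  (v := delta_mx 0 s) (w := delta_mx 0 b).
move=> /(_ (partial b H (dn q)) (q 0 s / Num.sqrt (sqnorm q))) Z.
rewrite (_ : _ *: _ = (q 0 s / Num.sqrt (sqnorm q)) *: partial b H (dn q)).
  apply: Z => //.
  - by near=> h; rewrite dn_line_in // sqnorm_line.
  - by rewrite /psi mulr0 expr0n /= !addr0 subrr.
  - exact: (Ck_is_derive b (HC 1%N) Uq).
rewrite (partial_radial oU Uf He Uq) dn_b scalerA divfK //.
by rewrite gt_eqF // sqrtr_gt0.
Unshelve. all: by end_near. Qed.

(** The first derivatives of [H \o dn] are again, up to a coordinate factor, smooth even functions
    composed with [dn], so the induction never meets a derivative of the norm. *)
Lemma Cinf_dn H : smooth_even b U H -> Cinf U' (H \o dn).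
Proof.
move=> He k; elim: k H He => [|k IH] H He.
  split=> // q Uq; have [HC _] := He.
  exact: (continuous_comp (@continuous_dn q) (Ck_cont (HC 0%N) Uq)).
have [HC _] := He.
apply: (CkS_is_derive (dg := fun i q => if i \in S then q 0 i *: (radial b H \o dn) q
    else (partial (tgt i) H \o dn) q) oU').
- by move=> q Uq; exact: (continuous_comp (@continuous_dn q) (Ck_cont (HC 0%N) Uq)).
- move=> i q Uq; case: ifP => iS; first exact: is_derive_dn_in.
  by apply: is_derive_dn_out; rewrite ?iS //; exact: (HC 1%N).
- move=> i; have [iS|iS] := boolP (i \in S).
    apply: (CkZ oU'); first exact: Ck_coord.
    by apply: IH; exact: smooth_even_radial.
  by apply: IH; apply: smooth_even_partial => //; exact: tgt_neq.
Qed.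

Let partial_dn_out H i q : smooth_even b U H -> U' q -> i \notin S ->
  partial i (H \o dn) q = partial (tgt i) H (dn q).
Proof.
by move=> [HC _] Uq iS; apply: partial_val; apply: is_derive_dn_out => //; exact: (HC 1%N).
Qed.

Let partial_dn_in H s q : smooth_even b U H -> U' q -> s \in S ->
  partial s (H \o dn) q = q 0 s *: radial b H (dn q).
Proof. by move=> He Uq sS; apply: partial_val; exact: is_derive_dn_in. Qed.

Lemma laplacian_dn H q : smooth_even b U H -> U' q ->
  laplacian (H \o dn) q = darboux b #|S|%:R H (dn q).
Proof.
move=> He Uq; rewrite /laplacian (bigID (mem S)) /= addrC /darboux -addrA.
congr (_ + _).
  rewrite /lap_other [RHS](reindex_onto tgt src); last by move=> j jb; exact: srcK.
  rewrite [RHS](eq_bigl (fun i => i \notin S)); last first.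
    move=> i; apply/idP/idP => [/andP[ib /eqP <-]|iS]; first exact: src_out.
    by rewrite tgt_neq // tgtK // eqxx.
  apply: eq_bigr => i iS; rewrite (eq_partial (g' := partial (tgt i) H \o dn) i oU' Uq).
    by rewrite partial_dn_out //; apply: smooth_even_partial => //; exact: tgt_neq.
  by move=> z Uz; exact: partial_dn_out.
rewrite (eq_bigr (fun s => radial b H (dn q) + q 0 s ^+ 2 *: radial b (radial b H) (dn q))).
  by rewrite big_split /= sumr_const -scaler_suml -/(sqnorm q) dn_b_sqr scaler_nat.
move=> s sS; rewrite (eq_partial (g' := fun q => q 0 s *: (radial b H \o dn) q) s oU' Uq).
  have HB := smooth_even_radial oU Uf He.
  have := is_deriveZW (is_derive_coord s s q) (is_derive_dn_in HB Uq sS).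
  by move=> /partial_val ->; rewrite eqxx scale1r scalerA addrC.
by move=> z Uz; exact: partial_dn_in.
Qed.

(** The extra 2 is the cross term of the Leibniz rule: twice [partial s (H \o dn)] is
    [(2 * q 0 s) *: radial b H] at [dn q]. *)
Lemma laplacian_coord_dn H s q : smooth_even b U H -> U' q -> s \in S ->
  laplacian (fun q => q 0 s *: (H \o dn) q) q =
  q 0 s *: darboux b (#|S|%:R + 2) H (dn q).
Proof.
move=> He Uq sS; have HC := Cinf_dn He.
have P1 i z : U' z -> partial i (fun q => q 0 s *: (H \o dn) q) z =
    z 0 s *: partial i (H \o dn) z + (s == i)%:R *: (H \o dn) z.
  move=> Uz; apply: partial_val; apply: is_deriveZW; first exact: is_derive_coord.
  exact: (Ck_is_derive i (HC 1%N) Uz).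
have P2 i : partial i (partial i (fun q => q 0 s *: (H \o dn) q)) q =
    q 0 s *: partial i (partial i (H \o dn)) q
    + ((s == i)%:R *+ 2) *: partial i (H \o dn) q.
  rewrite (eq_partial i oU' Uq (P1 i)).
  have D1 := is_deriveZW (is_derive_coord i s q) (Ck_is_derive i (Ck_partial i (HC 2%N)) Uq).
  have D2 := is_deriveZ (s == i)%:R (Ck_is_derive i (HC 1%N) Uq).
  by rewrite (partial_val (is_derive_addf D1 D2)) -addrA -scalerDl mulr2n.
rewrite /laplacian (eq_bigr _ (fun i _ => P2 i)) big_split /= -scaler_sumr.
rewrite -/(laplacian (H \o dn) q) laplacian_dn // (bigD1 s) //= big1 ?addr0; last first.
  by move=> i is_; rewrite eq_sym (negbTE is_) mul0rn scale0r.
rewrite eqxx partial_dn_in // /darboux (_ : true%:R = 1 :> R) //.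
move: (lap_other _ _ _) (radial _ _ _) (radial _ _ _) (dn q 0 b) => X Y Z e.
by apply/rowP => j; rewrite !mxE; ring.
Qed.

Let iter_radial H k : smooth_even b U H -> smooth_even b U (iter k (radial b) H).
Proof. by move=> He; elim: k => [//|k IH] /=; exact: smooth_even_radial. Qed.

(* The Laplacian of [iter j radial H \o dn] is [#|S| - 3 - 2 j] times
   [iter j.+1 radial H \o dn], and this factor vanishes for [j = k]. *)
Lemma iter_laplacian_dn_eq0 H k q : #|S| = k.+1.*2.+1 -> smooth_even b U H ->
  (forall p, U p -> darboux b 3 H p = 0) -> U' q ->
  iter k.+1 (@laplacian R m 'rV[R]_d) (H \o dn) q = 0.
Proof.
move=> Sk He Hd.
have Hdj j p : U p -> darboux b (3 + j%:R * 2) (iter j (radial b) H) p = 0.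
  elim: j p => [|j IH] p Up; first by rewrite mul0r addr0; exact: Hd.
  rewrite -[j.+1%:R]natr1 mulrDl mul1r addrA /=.
  exact: (darboux_radial oU Uf (iter_radial j He) IH).
pose a j : R := #|S|%:R - (3 + j%:R * 2).
have step j z : U' z -> laplacian (iter j (radial b) H \o dn) z =
    a j *: (iter j.+1 (radial b) H \o dn) z.
  move=> Uz; rewrite laplacian_dn //; last exact: iter_radial.
  have := Hdj j _ Uz; rewrite /darboux /a /=.
  move: (lap_other _ _ _) (radial _ _ _) (radial _ _ _) (dn z 0 b) => X Y Z e.
  by move=> E0; rewrite scalerBl -[RHS]addr0 -E0; apply/rowP => i; rewrite !mxE; ring.
have main j z : U' z -> iter j (@laplacian R m 'rV[R]_d) (H \o dn) z =
    (\prod_(i < j) a i) *: (iter j (radial b) H \o dn) z.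
  elim: j z => [|j IH] z Uz /=; first by rewrite big_ord0 scale1r.
  rewrite (eq_laplacian oU' IH Uz).
  have KC : Cinf U' (iter j (radial b) H \o dn) by apply: Cinf_dn; exact: iter_radial.
  set c := \prod_(i < j) a i.
  have -> : laplacian (fun p => c *: (iter j (radial b) H \o dn) p) z
      = c *: laplacian (iter j (radial b) H \o dn) z.
    rewrite -mul_mx_scalar -(laplacian_mulmxr oU' _ KC Uz).
    by apply: (eq_laplacian oU' _ Uz) => p _; rewrite mul_mx_scalar.
  by rewrite step // scalerA big_ord_recr.
move=> Uq; rewrite main // big_ord_recr /=.
have -> : a k = 0.
  by rewrite /a Sk -addnn -addn1 !natrD -natr1; ring.
by rewrite mulr0 scale0r.
Qed.

End RadialComposition.

(** * Stem functions and regularity *)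

Section Algebra.
Variables (R : realType) (d N : nat).
Local Notation A := 'rV[R]_d.
Variables (mul : A -> A -> A) (conj : A -> A) (v : nat -> A).
Hypothesis alg : real_algebra R d mul (v 0%N).
Hypothesis hyp : hypercomplex_basis R d mul conj N v.
Local Notation one := (v 0%N).

Lemma mulDl x y z : mul (x + y) z = mul x z + mul y z.
Proof. by case: alg => H _ _ _; have := H 1 x y z; rewrite !scale1r. Qed.

Lemma mulDr x y z : mul z (x + y) = mul z x + mul z y.
Proof. by case: alg => _ H _ _; have := H 1 x y z; rewrite !scale1r. Qed.

Lemma mul0l z : mul 0 z = 0.
Proof. by have := mulDl 0 0 z; rewrite addr0 => /eqP; rewrite -subr_eq0 opprD addNKr oppr_eq0 => /eqP. Qed.

Lemma mul0r_ z : mul z 0 = 0.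
Proof. by have := mulDr 0 0 z; rewrite addr0 => /eqP; rewrite -subr_eq0 opprD addNKr oppr_eq0 => /eqP. Qed.

Lemma mulZl (a : R) x z : mul (a *: x) z = a *: mul x z.
Proof. by case: alg => H _ _ _; have := H a x 0 z; rewrite mul0l !addr0. Qed.

Lemma mulZr (a : R) x z : mul z (a *: x) = a *: mul z x.
Proof. by case: alg => _ H _ _; have := H a x 0 z; rewrite mul0r_ !addr0. Qed.

Lemma mulNl x z : mul (- x) z = - mul x z.
Proof. by rewrite -scaleN1r mulZl scaleN1r. Qed.

Lemma mulNr x z : mul z (- x) = - mul z x.
Proof. by rewrite -scaleN1r mulZr scaleN1r. Qed.

Lemma mulAA x y z : mul x (mul y z) = mul (mul x y) z.
Proof. by case: alg. Qed.

Lemma mul1l x : mul one x = x.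
Proof. by case: alg => _ _ _ H; have [] := H x. Qed.

Lemma mul1r_ x : mul x one = x.
Proof. by case: alg => _ _ _ H; have [] := H x. Qed.

Lemma mul_suml (I : Type) (r : seq I) (P : pred I) (F : I -> A) z :
  mul (\sum_(i <- r | P i) F i) z = \sum_(i <- r | P i) mul (F i) z.
Proof. by apply: (big_morph (fun x => mul x z)) => [x y|]; rewrite ?mulDl ?mul0l. Qed.

Lemma mul_sumr (I : Type) (r : seq I) (P : pred I) (F : I -> A) z :
  mul z (\sum_(i <- r | P i) F i) = \sum_(i <- r | P i) mul z (F i).
Proof. by apply: (big_morph (mul z)) => [x y|]; rewrite ?mulDr ?mul0r_. Qed.

(** Left multiplication by a constant becomes a matrix acting on the right, so that every rule about
    [*m] applies to it. *)
Definition Lm (e : A) : 'M[R]_d := \matrix_i mul e (delta_mx 0 i).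

Lemma LmE e x : mul e x = x *m Lm e.
Proof.
rewrite {1}(row_sum_delta x) mul_sumr mulmx_sum_row; apply: eq_bigr => i _.
by rewrite mulZr rowK.
Qed.

Lemma v_clifford s t : (1 <= s <= N)%N -> (1 <= t <= N)%N ->
  mul (v s) (v t) + mul (v t) (v s) = (- 2 * (s == t)%:R) *: one.
Proof.
case: hyp => _ _ H1 H2 _ sN tN; have [<-|st] := eqVneq s t; last first.
  by rewrite H2 // addNr mulr0 scale0r.
have [Hs1 Hs2] := H1 s sN.
have cs : conj (v s) = - v s by apply/eqP; rewrite -addr_eq0 addrC Hs1.
move: Hs2; rewrite cs mulNr => Hs2.
by rewrite -(opprK (mul _ _)) Hs2 mulr1 scaleNr -opprD scaler_nat mulr2n.
Qed.

Lemma sphere_v s : (1 <= s)%N -> sphere R d v s s (v s).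
Proof. by move=> s1; exists (fun=> 1); rewrite !big_nat1 scale1r expr1n. Qed.

(** In the double sum for [mul J J] symmetrised with itself, the terms off the diagonal cancel by
    anticommutation, and the diagonal ones add up to [- (one *+ 2)] times the squared norm of
    [c]. *)
Lemma sphere_sq l m J : (1 <= l)%N -> (m <= N)%N -> sphere R d v l m J ->
  mul J J = - one.
Proof.
move=> l1 mN [c [EJ c1]].
have E : mul J J = \sum_(l <= s < m.+1) \sum_(l <= t < m.+1) (c s * c t) *: mul (v s) (v t).
  rewrite {1}EJ mul_suml; apply: eq_bigr => s _; rewrite mulZl EJ mul_sumr scaler_sumr.
  by apply: eq_bigr => t _; rewrite mulZr scalerA.
have E2 : mul J J + mul J J = - (one *+ 2).
  rewrite {1}E E [X in X + _]exchange_big -big_split /=.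
  transitivity (\sum_(l <= s < m.+1) (c s ^+ 2) *: (- (one *+ 2))); last first.
    by rewrite -scaler_suml c1 scale1r.
  rewrite big_nat [RHS]big_nat; apply: eq_bigr => s /andP[ls sm].
  rewrite -big_split /=.
  rewrite (bigD1_seq s) ?mem_index_iota ?ls ?sm ?iota_uniq //= big1_seq ?addr0.
    rewrite -scalerDr v_clifford ?eqxx ?mulr1; last 2 first.
    - by rewrite (leq_trans l1 ls) (leq_trans _ mN).
    - by rewrite (leq_trans l1 ls) (leq_trans _ mN).
    by rewrite scaleNr scaler_nat.
  move=> t; rewrite mem_index_iota => /andP[ts /andP[lt tm]].
  rewrite (mulrC (c t)) -scalerDr v_clifford.
  - by rewrite (negbTE ts) mulr0 scale0r scaler0.
  - by rewrite (leq_trans l1 lt) (leq_trans _ mN).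
  - by rewrite (leq_trans l1 ls) (leq_trans _ mN).
move/eqP: E2; rewrite -mulr2n -mulNrn -subr_eq0 -mulrnBl -scaler_nat scaler_eq0.
by rewrite pnatr_eq0 /= subr_eq0 => /eqP.
Qed.

Lemma sphere_anti l m l' m' J J' : (1 <= l)%N -> (m < l')%N -> (m' <= N)%N ->
  sphere R d v l m J -> sphere R d v l' m' J' -> mul J J' = - mul J' J.
Proof.
move=> l1 ml mN [c [-> _]] [c' [-> _]].
apply/eqP; rewrite -addr_eq0 mul_suml mul_suml; apply/eqP.
rewrite (eq_bigr (fun s => \sum_(l' <= t < m'.+1) (c s * c' t) *: mul (v s) (v t))); last first.
  by move=> s _; rewrite mulZl mul_sumr scaler_sumr; apply: eq_bigr => t _; rewrite mulZr scalerA.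
rewrite [X in _ + X](eq_bigr (fun t => \sum_(l <= s < m.+1) (c s * c' t) *: mul (v t) (v s))); last first.
  move=> t _; rewrite mulZl mul_sumr scaler_sumr; apply: eq_bigr => s _.
  by rewrite mulZr scalerA mulrC.
rewrite [X in _ + X]exchange_big -big_split /= big_nat big1 // => s /andP[ls sm].
rewrite -big_split /= big_nat big1 // => t /andP[lt tm].
have lts : (s < t)%N by apply: leq_trans lt; exact: leq_trans sm _.
rewrite -scalerDr v_clifford.
- by rewrite (ltn_eqF lts) mulr0 scale0r scaler0.
- rewrite (leq_trans l1 ls) /=; apply: leq_trans mN; rewrite ltnS in tm.
  exact: leq_trans (ltnW lts) tm.
- by rewrite (leq_trans _ (ltnW lts)) ?(leq_trans l1) //=; exact: leq_trans mN.
Qed.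

(** The matrix whose rows are the [v s] has full row rank, and its right inverse reads off
    coordinates. These functionals recover [(alpha, beta)] from a point of V. *)
Lemma dual_coordinates : exists co : nat -> A -> R,
  (forall s (a : R) x y, co s (a *: x + y) = a * co s x + co s y) /\
  (forall s t, (s <= N)%N -> (t <= N)%N -> co s (v t) = (s == t)%:R).
Proof.
case: hyp => _ Hind _ _ _.
pose M : 'M[R]_(N.+1, d) := \matrix_(i < N.+1) v i.
have Mf : row_free M.
  apply: inj_row_free => w Hw; apply/rowP => i; rewrite mxE.
  have := Hind (fun k => w 0 (inord k)).
  rewrite (eq_bigr (fun s : 'I_N.+1 => w 0 s *: row s M)); last first.
    by move=> s _; rewrite inord_val rowK.
  rewrite -mulmx_sum_row Hw => /(_ erefl i); rewrite inord_val; apply.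
  by rewrite -ltnS.
exists (fun s x => (x *m pinvmx M) 0 (inord s)); split.
  by move=> s a x y; rewrite mulmxDl -scalemxAl !mxE.
move=> s t sN tN.
have -> : v t = row (inord t) M by rewrite rowK inordK.
rewrite -row_mul mulmxVp // rowE mulmx1 mxE eqxx /= -val_eqE /=.
by rewrite !inordK.
Qed.

Section ProductsJK.
Variable J : nat -> A.

(** The ordered product over a sequence instead of an ordinal type: induction on [s] and relabelling
    of the indices become available. *)
Definition JKs (T : eqType) (Jf : T -> A) (K : pred T) (s : seq T) : A :=
  foldr (fun k x => if K k then mul (Jf k) x else x) one s.

Lemma JKE n (K : {set 'I_n}) :
  JK R d mul one n J K = JKs (fun k : 'I_n => J k) (mem K) (enum 'I_n).
Proof.
have Ei : index_enum 'I_n = enum 'I_n by rewrite [index_enum _]unlock -enumT.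
rewrite /JK Ei.
by rewrite bigop.unlock /reducebig /JKs; elim: (enum _) => //= k s ->.
Qed.

End ProductsJK.

Lemma JKs_inv (T : eqType) (Jf : T -> A) (K : pred T) s :
  (forall k, k \in s -> mul (Jf k) (Jf k) = - one) ->
  exists y, forall x, mul y (mul (JKs Jf K s) x) = x.
Proof.
elim: s => [|k s IH] HJ /=; first by exists one => x; rewrite !mul1l.
have [y Hy] := IH (fun j js => HJ j (mem_behead (s := k :: s) js)).
case: ifP => _; last by exists y.
exists (mul y (- Jf k)) => x; rewrite -mulAA -[mul (mul _ _) x]mulAA.
rewrite [mul (- _) _]mulAA mulNl HJ ?inE ?eqxx // opprK mul1l; exact: Hy.
Qed.

Lemma JKs_anti (T : eqType) (Jf : T -> A) (K : pred T) s z :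
  (forall k, k \in s -> mul (Jf k) z = - mul z (Jf k)) ->
  mul (JKs Jf K s) z = (-1) ^+ count K s *: mul z (JKs Jf K s).
Proof.
elim: s => [|k s IH] HJ /=; first by rewrite mul1l mul1r_ scale1r.
have {}IH := IH (fun j js => HJ j (mem_behead (s := k :: s) js)).
case: ifP => _ //; rewrite add1n exprS -mulAA IH mulZr !mulAA HJ ?inE ?eqxx //.
by rewrite mulNl -scalerA scaleN1r scalerN.
Qed.

Lemma JKs_scale (T : eqType) (Jf Jf' : T -> A) (e : T -> R) (K : pred T) s :
  (forall k, k \in s -> K k -> Jf' k = e k *: Jf k) ->
  JKs Jf' K s = (\prod_(k <- s | K k) e k) *: JKs Jf K s.
Proof.
elim: s => [|k s IH] HJ /=; first by rewrite big_nil scale1r.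
have {}IH := IH (fun j js => HJ j (mem_behead (s := k :: s) js)).
rewrite big_cons; case: ifP => Kk //.
by rewrite IH HJ ?inE ?eqxx // mulZl mulZr scalerA.
Qed.

Lemma JKs_map (T T' : eqType) (h : T -> T') (Jf : T' -> A) (K : pred T') s :
  JKs Jf K (map h s) = JKs (Jf \o h) (K \o h) s.
Proof. by elim: s => //= k s ->. Qed.

Lemma eq_JKs (T : eqType) (Jf Jf' : T -> A) (K K' : pred T) s :
  Jf =1 Jf' -> K =1 K' -> JKs Jf K s = JKs Jf' K' s.
Proof. by move=> EJ EK; elim: s => //= k s ->; rewrite EJ EK. Qed.

End Algebra.

(** * The notions of the statement expressed by those of the proof *)

Section FrozenNotions.
Variables (R : realType) (d n : nat).
Implicit Types (U : set 'rV[R]_n) (g : 'rV[R]_n -> 'rV[R]_d).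

Lemma vcE (p : 'rV[R]_n) (i : 'I_n) : vc R n p i = p 0 i.
Proof. by rewrite /vc valK. Qed.

Lemma vc_lt (p : 'rV[R]_n) k (kn : (k < n)%N) : vc R n p k = p 0 (Ordinal kn).
Proof. by rewrite -[k]/(val (Ordinal kn)) vcE. Qed.

Lemma iterpd_rcons s i g : iterpd R d n (rcons s i) g = iterpd R d n s (partial i g).
Proof. by rewrite /iterpd -cats1 foldr_cat /= partial_pd. Qed.

(** [Ck] peels off the derivative that is taken first, which is the last letter of the word in
    [iterpd]; hence the induction on words through [rcons]. *)
Lemma Ck_onP k U g : Ck_on R d k n U g <-> Ck k U g.
Proof.
elim: k g => [|k IH] g; split.
- by move=> H; split=> // x Ux; have [] := H [::] x Ux isT.
- by move=> H s x Ux; rewrite leqn0 => /nilP ->; split=> //; exact: (Ck_cont H Ux).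
- move=> H; apply: CkS_intro => [x Ux|i x Ux|i].
  + by have [] := H [::] x Ux isT.
  + by have [_ H'] := H [::] x Ux isT; exact: H'.
  + apply/IH => s x Ux sk; have := H (rcons s i) x Ux; rewrite size_rcons => /(_ sk).
    by rewrite iterpd_rcons.
- move=> H s x Ux; case/lastP: s => [|s i] sk /=.
    by split=> [|_ i]; [exact: (Ck_cont H Ux)|exact: (Ck_derivable i H Ux)].
  rewrite iterpd_rcons; move: sk; rewrite size_rcons ltnS.
  exact: ((IH _).2 (Ck_partial i H) s x Ux).
Qed.

Lemma Cinf_onP U g : Cinf_on R d n U g <-> Cinf U g.
Proof. by split=> H k; apply/Ck_onP; exact: H. Qed.

Lemma lapE g : lap R d n g = laplacian g.
Proof. by apply/funext => p; apply: eq_bigr => i _; rewrite !partial_pd. Qed.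

End FrozenNotions.

Lemma iter_lapS (R : realType) (d : nat) ts F k K :
  iter k (lapS R d ts) F K = iter k (@laplacian R (dimD ts) 'rV[R]_d) (F K).
Proof. by elim: k => //= k IH; rewrite /lapS IH lapE. Qed.

Section ParityComponents.
Variables (R : realType) (d n t : nat) (ri : 'I_t -> 'I_n) (D : set 'rV[R]_n).
Hypothesis Df : forall h p, D p -> D (flip (ri h) p).
Variable nice : ('rV[R]_n -> 'rV[R]_d) -> Prop.
Hypothesis niceD : forall f g, nice f -> nice g -> nice (fun p => f p + g p).
Hypothesis niceZ : forall (a : R) f, nice f -> nice (fun p => a *: f p).
Hypothesis niceR : forall h f, nice f -> nice (fun p => f (flip (ri h) p)).
Hypothesis niceE : forall f g, (forall p, D p -> f p = g p) -> nice f -> nice g.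

(* The component of given parities in all variables is obtained by applying
   the projectors (1 +- reflection) / 2 one after the other. *)
Lemma parity_component (c : {set 'I_t} -> 'rV[R]_n -> 'rV[R]_d) :
  (forall (K : {set 'I_t}) h, parity (ri h) D (if h \in K then -1 else 1) (c K)) ->
  nice (fun p => \sum_K c K p) -> forall K, nice (c K).
Proof.
move=> cp nc K.
pose cond hs (K' : {set 'I_t}) := all (fun h => (h \in K') == (h \in K)) hs.
have H hs : nice (fun p => \sum_(K' | cond hs K') c K' p).
  elim: hs => [|h hs IH]; first exact: nc.
  pose e : R := if h \in K then -1 else 1.
  have := niceZ 2^-1 (niceD IH (niceZ e (niceR h IH))).
  apply: niceE => p Dp; rewrite scaler_sumr -big_split /= scaler_sumr.
  rewrite [RHS](eq_bigl (fun K' => cond hs K' && ((h \in K') == (h \in K)))); last first.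
    by move=> K'; rewrite /cond /= andbC.
  rewrite big_mkcondr /=; apply: eq_bigr => K' _; rewrite cp // /e.
  case: (h \in K') (h \in K) => -[] /=; rewrite ?scaleN1r ?scale1r ?opprK.
  - by rewrite scalerDr -scalerDl -[2^-1]GRing.mul1r -splitr scale1r.
  - by rewrite subrr scaler0.
  - by rewrite subrr scaler0.
  - by rewrite scalerDr -scalerDl -[2^-1]GRing.mul1r -splitr scale1r.
apply: niceE (H (enum 'I_t)) => p _; rewrite (big_pred1 K) // => K'.
apply/idP/eqP => [/allP cK|->]; last by apply/allP => h _.
by apply/setP => h; apply/eqP/cK; rewrite mem_enum.
Qed.

End ParityComponents.

Section Flips.
Variables (R : realType) (d n : nat) (U : set 'rV[R]_n).
Hypothesis oU : open U.
Implicit Types g : 'rV[R]_n -> 'rV[R]_d.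

Lemma flip_sign_sq (b i : 'I_n) :
  (if i == b then -1 else 1 : R) * (if i == b then -1 else 1) = 1.
Proof. by case: eqP => _; rewrite ?mulrNN mulr1. Qed.

Lemma laplacian_flip b g p : (forall p, U p -> U (flip b p)) -> Cinf U g -> U p ->
  laplacian (fun p => g (flip b p)) p = laplacian g (flip b p).
Proof.
move=> Uf gC Up; apply: eq_bigr => i _.
set c := fun i : 'I_n => if i == b then -1 else 1 : R.
rewrite (eq_partial (g' := fun p => c i *: (fun p => partial i g (flip b p)) p) i oU Up); last first.
  by move=> q Uq; exact: (partial_flip i oU Uf (gC 1%N) Uq).
have gi : Ck 1 U (partial i g) by exact: (Ck_partial i (gC 2%N)).
have D1 := Ck_is_derive i (Ck_flip oU Uf gi) Up.
rewrite (partial_val (is_deriveZ (c i) D1)) (partial_flip i oU Uf gi Up).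
by rewrite scalerA flip_sign_sq scale1r.
Qed.

Lemma parity_laplacian b a g : (forall p, U p -> U (flip b p)) -> Cinf U g ->
  parity b U a g -> parity b U a (laplacian g).
Proof.
move=> Uf gC ga p Up; rewrite -(laplacian_flip Uf gC Up).
rewrite (eq_laplacian oU (g' := fun p => g p *m a%:M)) //; last first.
  by move=> q Uq; rewrite ga // mul_mx_scalar.
by rewrite (laplacian_mulmxr oU) // mul_mx_scalar.
Qed.

Lemma parity_iter_laplacian k b a g : (forall p, U p -> U (flip b p)) -> Cinf U g ->
  parity b U a g -> parity b U a (iter k (@laplacian R n 'rV[R]_d) g).
Proof.
move=> Uf gC ga; elim: k => [//|k IH] /=; apply: parity_laplacian => //.
exact: Cinf_iter_laplacian.
Qed.

End Flips.

(** * The directions of a slice and their Clifford relations *)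

Section Steps.
Variables (R : realType) (d N : nat).
Local Notation A := 'rV[R]_d.
Variables (mul : A -> A -> A) (conj : A -> A) (v : nat -> A).
Hypothesis alg : real_algebra R d mul (v 0%N).
Hypothesis hyp : hypercomplex_basis R d mul conj N v.
Variable ts : seq nat.
Hypothesis st : steps N ts.
Local Notation one := (v 0%N).
Local Notation tn h := (nth 0%N ts h).
Local Notation n := (dimD ts).
Local Notation Lm := (Lm mul).

Definition ri (h : 'I_(tau ts)) : 'I_n := rshift (t0 ts).+1 h.

Lemma reflE (h : 'I_(tau ts)) p : refl R ts h p = flip (ri h) p.
Proof. by apply/rowP => i; rewrite !mxE. Qed.

Lemma ri_inj : injective ri.
Proof. exact: rshift_inj. Qed.

Lemma size_ts : size ts = (tau ts).+1.
Proof. by case: st => + _ _; case: ts. Qed.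

Lemma tn_lt h h' : (h < h')%N -> (h' <= tau ts)%N -> (tn h < tn h')%N.
Proof.
move=> hh h't; case: st => _ so _.
apply: (sorted_ltn_nth ltn_trans 0%N so) => //; rewrite inE size_ts ltnS //.
exact: ltnW (leq_trans hh h't).
Qed.

Lemma tn_le h h' : (h <= h')%N -> (h' <= tau ts)%N -> (tn h <= tn h')%N.
Proof. by rewrite leq_eqVlt => /predU1P[->//|hh] h't; exact/ltnW/tn_lt. Qed.

Lemma tn_N h : (h <= tau ts)%N -> (tn h <= N)%N.
Proof.
move=> ht; apply: leq_trans (tn_le ht (leqnn _)) _.
by case: st => _ _ <-; rewrite -nth_last.
Qed.

Lemma t0_N : (t0 ts <= N)%N.
Proof. exact: (@tn_N 0). Qed.

(** Every direction of R_J except [v 0] is a unit vector of the span of [v (lo i)], ..., [v (hi i)],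
    a basis vector of the mirror counting as a block of length one. Anticommutation then follows
    from the blocks being disjoint. *)
Let lo i := if (i < (t0 ts).+1)%N then i else (tn (i - (t0 ts).+1)).+1.
Let hi i := if (i < (t0 ts).+1)%N then i else tn (i - (t0 ts).+1).+1.

Let idx_tau i : (i < n)%N -> ~~ (i < (t0 ts).+1)%N -> (i - (t0 ts).+1 < tau ts)%N.
Proof. by rewrite /dimD; lia. Qed.

Let hi_N i : (i < n)%N -> (hi i <= N)%N.
Proof.
move=> il; rewrite /hi; case: ifP => it; first exact: leq_trans t0_N.
by apply: tn_N; apply: idx_tau => //; rewrite it.
Qed.

Let lo_1 i : (0 < i)%N -> (0 < lo i)%N.
Proof. by rewrite /lo; case: ifP. Qed.

Let block_lt i k : (i < k)%N -> (k < n)%N -> (hi i < lo k)%N.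
Proof.
move=> ik kn; rewrite /hi /lo; case: ifP => it; case: ifP => kt //.
- rewrite ltnS (leq_trans (n := tn 0)) //; apply: tn_le => //.
  by apply/ltnW/idx_tau => //; rewrite kt.
- by lia.
- rewrite ltnS; apply: tn_le; first by lia.
  by apply/ltnW/idx_tau => //; rewrite kt.
Qed.

Lemma dirvec_sphere J i : torus R d v ts J -> (0 < i < n)%N ->
  sphere R d v (lo i) (hi i) (dirvec R d v ts J i).
Proof.
move=> HJ /andP[i0 il]; rewrite /dirvec /lo /hi; case: ifP => it.
  exact: sphere_v.
by apply: HJ; apply: idx_tau => //; rewrite it.
Qed.

Lemma dirvec_sq J i : torus R d v ts J -> (0 < i < n)%N ->
  mul (dirvec R d v ts J i) (dirvec R d v ts J i) = - one.
Proof.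
move=> HJ il; have /andP[i0 iN] := il.
exact: (sphere_sq alg hyp (lo_1 i0) (hi_N iN) (dirvec_sphere HJ il)).
Qed.

Lemma dirvec_anti J i k : torus R d v ts J -> (0 < i < n)%N -> (0 < k < n)%N -> i != k ->
  mul (dirvec R d v ts J i) (dirvec R d v ts J k) =
  - mul (dirvec R d v ts J k) (dirvec R d v ts J i).
Proof.
move=> HJ; wlog: i k / (i < k)%N => [H il kl ik|ik il kl _].
  have := ik; rewrite neq_ltn => /orP[ik'|ki]; first exact: H.
  by rewrite (H k i) // ?opprK // eq_sym.
have /andP[i0 iN] := il; have /andP[k0 kN] := kl.
exact: (sphere_anti alg hyp (lo_1 i0) (block_lt ik kN) (hi_N kN)
  (dirvec_sphere HJ il) (dirvec_sphere HJ kl)).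
Qed.

Lemma mx_ext (M M' : 'M[R]_d) : (forall z : 'rV[R]_d, z *m M = z *m M') -> M = M'.
Proof. by move=> H; apply/row_matrixP => i; rewrite !rowE. Qed.

Lemma Lm_mul x y : Lm x *m Lm y = Lm (mul y x).
Proof. by apply: mx_ext => z; rewrite mulmxA -!(LmE alg) (mulAA alg). Qed.

Lemma LmD x y : Lm (x + y) = Lm x + Lm y.
Proof. by apply: mx_ext => z; rewrite mulmxDr -!(LmE alg) (mulDl alg). Qed.

Lemma Lm_one : Lm one = 1%:M.
Proof. by apply: mx_ext => z; rewrite -(LmE alg) (mul1l alg) mulmx1. Qed.

Definition EJ J (i : 'I_n) := Lm (dirvec R d v ts J i).
(** The symbol of the conjugate operator: the direction [v 0] is the unit, and the others, of square
    [- one], change sign. *)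
Definition EJ' J (i : 'I_n) :=
  Lm (if (i : nat) == 0%N then one else - dirvec R d v ts J i).

Lemma EJ_elliptic J : torus R d v ts J -> forall i k : 'I_n,
  EJ J i *m EJ' J k + EJ J k *m EJ' J i = ((i == k)%:R *+ 2)%:M.
Proof.
move=> HJ i k; rewrite /EJ /EJ' !Lm_mul -LmD -[i == k]/((i : nat) == (k : nat)).
have dv0 : dirvec R d v ts J 0 = one by [].
have two1 : Lm (one *+ 2) = (1 *+ 2)%:M by rewrite raddfMn mulr2n LmD Lm_one -mulr2n.
have [i0|i0] := posnP (i : nat); have [k0|k0] := posnP (k : nat).
- by rewrite i0 k0 eqxx dv0 (mul1l alg) -mulr2n two1.
- rewrite i0 (ltn_eqF k0) mul0rn dv0 (mulNl alg) (mul1l alg) (mul1r_ alg) addNr.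
  by apply: mx_ext => z; rewrite -(LmE alg) (mul0l alg) raddf0 mulmx0.
- rewrite k0 (gtn_eqF i0) mul0rn dv0 (mulNl alg) (mul1l alg) (mul1r_ alg) subrr.
  by apply: mx_ext => z; rewrite -(LmE alg) (mul0l alg) raddf0 mulmx0.
- have [E|ik] := eqVneq (i : nat) (k : nat).
    rewrite E !(mulNl alg) (dirvec_sq HJ); last by rewrite k0 ltn_ord.
    by rewrite opprK -mulr2n two1.
  have kA := dirvec_anti HJ (i := k) (k := i).
  rewrite mul0rn !(mulNl alg) kA ?k0 ?i0 ?ltn_ord // 1?eq_sym // opprK subrr.
  by apply: mx_ext => z; rewrite -(LmE alg) (mul0l alg) raddf0 mulmx0.
Qed.

Lemma torus_nonempty : torus R d v ts (fun h => v (tn h.+1)).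
Proof.
move=> h ht; exists (fun s => (s == tn h.+1)%:R).
have th : (tn h < tn h.+1)%N by exact: tn_lt.
have mem : tn h.+1 \in index_iota (tn h).+1 (tn h.+1).+1.
  by rewrite mem_index_iota th ltnSn.
split; rewrite (bigD1_seq (tn h.+1)) ?iota_uniq //= eqxx ?scale1r ?expr1n.
  by rewrite big1 ?addr0 // => s /negbTE ->; rewrite scale0r.
by rewrite big1 ?addr0 // => s /negbTE ->; rewrite expr0n.
Qed.

Lemma JK_inv J K : torus R d v ts J ->
  exists y, forall x, mul y (mul (JK R d mul one (tau ts) J K) x) = x.
Proof.
move=> HJ; rewrite JKE; apply: (JKs_inv alg) => k _.
apply: (sphere_sq alg hyp (ltn0Sn _) _ (HJ k (ltn_ord k))).
exact: tn_N.
Qed.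

End Steps.

(** * How far a point determines its representation alpha + beta J *)

Section Representation.
Variables (R : realType) (d N : nat).
Local Notation A := 'rV[R]_d.
Variables (mul : A -> A -> A) (conj : A -> A) (v : nat -> A).
Hypothesis alg : real_algebra R d mul (v 0%N).
Hypothesis hyp : hypercomplex_basis R d mul conj N v.
Variable ts : seq nat.
Hypothesis st : steps N ts.
Local Notation one := (v 0%N).
Local Notation tn h := (nth 0%N ts h).
Local Notation n := (dimD ts).
Local Notation torus := (torus R d v ts).
Local Notation pt := (pt R d v ts).
Local Notation beta p h := (vc R n p ((t0 ts).+1 + h)%N).

Section Coordinates.
Variable co : nat -> A -> R.
Hypothesis co_lin : forall s (a : R) x y, co s (a *: x + y) = a * co s x + co s y.
Hypothesis co_v : forall s t, (s <= N)%N -> (t <= N)%N -> co s (v t) = (s == t)%:R.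

Let coD s x y : co s (x + y) = co s x + co s y.
Proof. by have := co_lin s 1 x y; rewrite scale1r GRing.mul1r. Qed.

Let co0 s : co s 0 = 0.
Proof. by have := coD s 0 0; rewrite addr0 => /eqP; rewrite -subr_eq0 opprD addNKr oppr_eq0 => /eqP. Qed.

Let coZ s (a : R) x : co s (a *: x) = a * co s x.
Proof. by have := co_lin s a x 0; rewrite addr0 co0 addr0. Qed.

Let co_sum s (I : Type) (r : seq I) (P : pred I) (F : I -> A) :
  co s (\sum_(i <- r | P i) F i) = \sum_(i <- r | P i) co s (F i).
Proof. by apply: (big_morph (co s)); [exact: coD|exact: co0]. Qed.

Let co_comb s l m (c : nat -> R) : (s <= N)%N -> (m <= N)%N ->
  co s (\sum_(l <= t < m.+1) c t *: v t) = if (l <= s <= m)%N then c s else 0.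
Proof.
move=> sN mN; rewrite co_sum.
rewrite big_nat (eq_bigr (fun t => if t == s then c s else 0)); last first.
  move=> t /andP[_ tm]; rewrite coZ co_v //; last by apply: leq_trans mN.
  by rewrite eq_sym; case: eqP => [->|_]; rewrite ?mulr1 ?mulr0.
rewrite -big_nat; case: ifP => lsm.
  rewrite (bigD1_seq s) ?iota_uniq ?mem_index_iota //= eqxx big1 ?addr0 //.
  by move=> t /negbTE ->.
rewrite big_nat big1 // => t /andP[lt tm]; case: eqP => // ts_.
by move: lsm; rewrite -ts_ lt -ltnS tm.
Qed.

Let sphere_co l m J : (m <= N)%N -> sphere R d v l m J ->
  [/\ J = \sum_(l <= s < m.+1) co s J *: v s, \sum_(l <= s < m.+1) co s J ^+ 2 = 1 &
    forall s, (s <= N)%N -> ~~ (l <= s <= m)%N -> co s J = 0].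
Proof.
move=> mN [c [EJ c1]].
have coJ s : (s <= N)%N -> co s J = if (l <= s <= m)%N then c s else 0.
  by move=> sN; rewrite EJ co_comb.
have coJ' s : (l <= s < m.+1)%N -> co s J = c s.
  by move=> /[dup] lsm /andP[_ sm]; rewrite coJ ?lsm //; exact: leq_trans mN.
split.
- by rewrite {1}EJ big_nat [RHS]big_nat; apply: eq_bigr => s lsm; rewrite coJ'.
- by rewrite -c1 big_nat [RHS]big_nat; apply: eq_bigr => s lsm; rewrite coJ'.
- by move=> s sN /negbTE lsm; rewrite coJ // lsm.
Qed.

Let co_pt_low J p s : torus J -> (s <= t0 ts)%N -> co s (pt J p) = vc R n p s.
Proof.
move=> HJ st0; have sN := leq_trans st0 (t0_N st).
rewrite /Defs.pt coD co_sum co_sum.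
rewrite (bigD1 (Ordinal (st0 : (s < (t0 ts).+1)%N))) //= coZ co_v // eqxx mulr1.
rewrite big1 ?addr0 => [|i ni]; last first.
  rewrite coZ co_v //; last by apply: leq_trans (t0_N st); rewrite -ltnS.
  by move: ni; rewrite -val_eqE /= eq_sym => /negbTE ->; rewrite mulr0.
rewrite big1 ?addr0 // => h _; rewrite coZ.
have [_ _ ->] := sphere_co (tn_N st (ltn_ord h)) (HJ h (ltn_ord h)); rewrite ?mulr0 //.
rewrite negb_and -ltnNge ltnS (leq_trans st0) //.
by apply: (tn_le st) => //; exact/ltnW.
Qed.

Let co_pt_block J p (h : 'I_(tau ts)) s : torus J -> (tn h < s <= tn h.+1)%N ->
  co s (pt J p) = beta p h * co s (J h).
Proof.
move=> HJ /andP[hs sh]; have sN := leq_trans sh (tn_N st (ltn_ord h)).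
rewrite /Defs.pt coD co_sum co_sum.
rewrite big1 ?add0r => [|i _]; last first.
  rewrite coZ co_v //; last by apply: leq_trans (t0_N st); rewrite -ltnS.
  rewrite gtn_eqF ?mulr0 //; apply: leq_ltn_trans hs.
  apply: (leq_trans (n := t0 ts)); first by rewrite -ltnS.
  by apply: (@tn_le _ _ st 0) => //; exact/ltnW.
rewrite (bigD1 h) //= coZ big1 ?addr0 // => k kh; rewrite coZ.
have [_ _ ->] := sphere_co (tn_N st (ltn_ord k)) (HJ k (ltn_ord k)); rewrite ?mulr0 //.
rewrite negb_and -!ltnNge; move: kh; rewrite -val_eqE neq_ltn => /orP[kh|hk].
  apply/orP; right; apply: leq_ltn_trans hs; apply: (tn_le st) => //; exact/ltnW.
apply/orP; left; rewrite ltnS; apply: leq_trans sh _; apply: (tn_le st) => //; exact/ltnW.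
Qed.

Lemma pt_eq_coord J J' p p' : torus J -> torus J' -> pt J p = pt J' p' ->
  (forall s, (s <= t0 ts)%N -> vc R n p s = vc R n p' s) /\
  (forall h : 'I_(tau ts), beta p h ^+ 2 = beta p' h ^+ 2 /\
     beta p h *: J h = beta p' h *: J' h).
Proof.
move=> HJ HJ' E; split.
  by move=> s st0; rewrite -(co_pt_low p HJ st0) E co_pt_low.
move=> h.
have [EJ sJ _] := sphere_co (tn_N st (ltn_ord h)) (HJ h (ltn_ord h)).
have [EJ' sJ' _] := sphere_co (tn_N st (ltn_ord h)) (HJ' h (ltn_ord h)).
have Eh s : ((tn h).+1 <= s < (tn h.+1).+1)%N ->
    beta p h * co s (J h) = beta p' h * co s (J' h).
  by move=> hs; rewrite -(co_pt_block p HJ hs) E (co_pt_block p' HJ' hs).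
split.
  rewrite -[LHS]mulr1 -[RHS]mulr1 -{1}sJ -sJ' !mulr_sumr big_nat [RHS]big_nat.
  by apply: eq_bigr => s hs; rewrite -!exprMn Eh.
rewrite {1}EJ EJ' !scaler_sumr big_nat [RHS]big_nat.
by apply: eq_bigr => s hs; rewrite !scalerA Eh.
Qed.

End Coordinates.

Let flips (hs : seq 'I_(tau ts)) (p : 'rV[R]_n) := foldr (fun h q => flip (ri h) q) p hs.

Let flipsE hs p i : uniq hs ->
  flips hs p 0 i = if i \in map (@ri ts) hs then - p 0 i else p 0 i.
Proof.
elim: hs => [//|h hs IH] /= /andP[hh uh]; rewrite mxE inE IH //.
case: eqP => [->|_] //=; rewrite ifN //.
by apply: contra hh => /mapP[k kh /ri_inj ->].
Qed.

Variable D : set 'rV[R]_n.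
Hypothesis Dr : forall (h : 'I_(tau ts)) p, D p -> D (refl R ts h p).

Lemma D_flip h p : D p -> D (flip (ri h) p).
Proof. by rewrite -reflE; exact: Dr. Qed.

Lemma stem_parity F (K : {set 'I_(tau ts)}) (h : 'I_(tau ts)) : stem R d ts D F ->
  parity (ri h) D (if h \in K then -1 else 1) (F K).
Proof.
by move=> sF p Dp; rewrite -reflE sF //; case: ifP; rewrite ?scaleN1r ?scale1r.
Qed.

Lemma parity_stem F : (forall (K : {set 'I_(tau ts)}) (h : 'I_(tau ts)),
  parity (ri h) D (if h \in K then -1 else 1) (F K)) -> stem R d ts D F.
Proof.
by move=> pF K h p Dp; rewrite reflE pF //; case: ifP; rewrite ?scaleN1r ?scale1r.
Qed.

Let D_flips hs p : D p -> D (flips hs p).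
Proof. by move=> Dp; elim: hs => //= h hs; exact: D_flip. Qed.

Let stem_flips F K hs p : stem R d ts D F -> D p ->
  F K (flips hs p) = (\prod_(h <- hs) (if h \in K then -1 else 1)) *: F K p.
Proof.
move=> sF Dp; elim: hs => [|h hs IH] /=; first by rewrite big_nil scale1r.
by rewrite (stem_parity K h sF) ?big_cons ?IH ?scalerA //; exact: D_flips.
Qed.

(** Comparing coordinates in a block gives equal vectors [beta *: J h], hence equal squares of
    [beta]. The list [hs] collects the indices where the sign of [beta] changes; where [beta] is 0
    the unit vector is undetermined, hence the restriction in the last clause. *)
Lemma pt_eq_flips J J' p p' : torus J -> torus J' -> pt J p = pt J' p' ->
  exists hs : seq 'I_(tau ts), [/\ uniq hs, p' = flips hs p &
    forall h : 'I_(tau ts), beta p h != 0 -> J' h = (if h \in hs then -1 else 1) *: J h].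
Proof.
move=> HJ HJ' E; have [co [colin cov]] := dual_coordinates hyp.
have [Elow Eblk] := pt_eq_coord colin cov HJ HJ' E.
pose hs := [seq h : 'I_(tau ts) <- enum 'I_(tau ts) | beta p' h != beta p h].
have uhs : uniq hs by rewrite filter_uniq // enum_uniq.
exists hs.
have bE (h : 'I_(tau ts)) (q : 'rV[R]_n) : beta q h = q 0 (ri h) by exact: (vcE q (ri h)).
have b' (h : 'I_(tau ts)) : beta p' h = (if beta p' h != beta p h then -1 else 1) * beta p h.
  case: eqP => [->|ne] /=; first by rewrite GRing.mul1r.
  have [/eqP] := Eblk h; rewrite eqf_sqr => /orP[/eqP e|/eqP -> _]; first by rewrite e in ne.
  by rewrite mulrN mulN1r opprK.
split.
- exact: uhs.
- apply/rowP => i; rewrite (flipsE _ _ uhs).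
  case: (splitP (i : 'I_((t0 ts).+1 + tau ts))) => [j ij|h ih].
    rewrite ifN.
      have := Elow j; rewrite -ltnS ltn_ord -ij !vcE => ->//.
    apply/mapP => -[h _ /(congr1 val)]; rewrite /= ij.
    by have := ltn_ord j; lia.
  have -> : i = ri h by apply: val_inj; rewrite /= ih.
  rewrite (mem_map (@ri_inj ts)) mem_filter mem_enum andbT -!bE {1}b'.
  by case: ifP => _; rewrite ?mulN1r ?GRing.mul1r.
- move=> h bn0; rewrite mem_filter mem_enum andbT.
  have [_] := Eblk h; rewrite {1}b'; set e := if _ then _ else _ => Eh.
  have ee : e * e = 1 by rewrite /e; case: ifP => _; rewrite ?mulrNN mulr1.
  apply: (scalerI bn0); rewrite scalerA [_ * e]mulrC -scalerA Eh.
  by rewrite scalerA mulrA ee GRing.mul1r.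
Qed.

Lemma D_of_pt J J' p p' : torus J -> torus J' -> pt J p = pt J' p' -> D p -> D p'.
Proof. by move=> HJ HJ' E Dp; have [hs [_ -> _]] := pt_eq_flips HJ HJ' E; exact: D_flips. Qed.

(** Shows that the set on which [T_regular] tests [f] in a slice is [D] itself, for every [J]. *)
Lemma Omega_pt J p : torus J -> Omega R d v ts D (pt J p) <-> D p.
Proof.
move=> HJ; split=> [[p' [J' [Dp' [HJ' E]]]]|Dp]; last by exists p, J.
exact: (D_of_pt HJ' HJ (esym E) Dp').
Qed.

(** Term by term. If some [beta] with index in [K] is 0, the oddness of [F K] kills the term on both
    sides; otherwise the signs acquired by J_K and by [F K] run over the same indices, those in both
    [hs] and [K], and cancel. *)
Lemma Ival_pt_eq F J J' p p' : stem R d ts D F -> torus J -> torus J' ->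
  pt J p = pt J' p' -> D p -> Ival R d mul v ts F J p = Ival R d mul v ts F J' p'.
Proof.
move=> sF HJ HJ' E Dp; have [hs [uhs Ep' EJ']] := pt_eq_flips HJ HJ' E.
apply: eq_bigr => K _; rewrite Ep' (stem_flips K hs sF Dp).
have bE (h : 'I_(tau ts)) (q : 'rV[R]_n) : beta q h = q 0 (ri h) by exact: (vcE q (ri h)).
have [/exists_inP[h hK /eqP b0]|nb0] := boolP [exists h in K, beta p h == 0].
  have -> : F K p = 0.
    have Ho := stem_parity K h sF; rewrite hK in Ho.
    by apply: (odd_eq0 Ho Dp); rewrite -bE.
  by rewrite scaler0 !(mul0r_ alg).
have {}EJ' (h : 'I_(tau ts)) : h \in K -> J' h = (if h \in hs then -1 else 1) *: J h.
  move=> hK; apply: EJ'; apply: contra nb0 => b0.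
  by apply/exists_inP; exists h.
rewrite !JKE (JKs_scale alg (e := fun h => if h \in hs then -1 else 1)
   (Jf := fun k : 'I_(tau ts) => J k) (Jf' := fun k : 'I_(tau ts) => J' k)); last first.
  by move=> k _ kK; apply: EJ'.
rewrite (mulZl alg) (mulZr alg) scalerA.
rewrite (_ : _ * _ = 1) ?scale1r //.
rewrite [X in X * _]big_mkcond /=.
rewrite (_ : \prod_(h <- hs) _ = \prod_(h <- enum 'I_(tau ts))
    (if h \in hs then (if h \in K then -1 else 1) else 1)); last first.
  rewrite -[RHS]big_mkcond /= -[RHS]big_filter; apply: perm_big.
  apply: uniq_perm => //; first by rewrite filter_uniq // enum_uniq.
  by move=> h; rewrite mem_filter mem_enum andbT.
rewrite -big_split /= big1 // => h _.
by case: (h \in K); case: (h \in hs); rewrite ?mulrNN mulr1.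
Qed.

Lemma Ical_pt F J p : stem R d ts D F -> torus J -> D p ->
  Ical R d mul v ts D F (pt J p) = Ival R d mul v ts F J p.
Proof.
move=> sF HJ Dp; rewrite /Ical.
case: ClassicalEpsilon.excluded_middle_informative => [e|]; last first.
  by case; exists (p, J).
case: ClassicalEpsilon.constructive_indefinite_description => -[p' J'] /= [Dp' [HJ' E]].
exact/esym/Ival_pt_eq.
Qed.

Lemma T_regularP f J : torus J -> open D -> T_regular R d mul v ts (Omega R d v ts D) f ->
  solution (EJ mul v J) D (f \o pt J).
Proof.
move=> HJ oD /(_ J HJ) /=.
have -> : [set p | Omega R d v ts D (pt J p)] = D.
  by apply/seteqP; split=> p /=; [move/(Omega_pt p HJ)|move=> Dp; apply/(Omega_pt p HJ)].
move=> [/Ck_onP H1 H2]; split=> // p Dp.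
have := H2 p ((Omega_pt p HJ).2 Dp); move=> E0; apply: etrans E0.
by apply: eq_bigr => i _; rewrite partial_pd (LmE alg).
Qed.

Lemma T_regular_intro f : (forall J, torus J -> solution (EJ mul v J) D (f \o pt J)) ->
  T_regular R d mul v ts (Omega R d v ts D) f.
Proof.
move=> H J HJ /=.
have -> : [set p | Omega R d v ts D (pt J p)] = D.
  by apply/seteqP; split=> p /=; [move/(Omega_pt p HJ)|move=> Dp; apply/(Omega_pt p HJ)].
have [H1 H2] := H J HJ; split; first exact/Ck_onP.
move=> p /(Omega_pt p HJ) Dp; apply: etrans (H2 p Dp).
by apply: eq_bigr => i _; rewrite partial_pd (LmE alg).
Qed.

End Representation.

(** * Index sets split according to the first index *)

Section SetsOfOrdinals.
Variable k : nat.
Implicit Types (K : {set 'I_k}) (L : {set 'I_k.+1}).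

Definition up K : {set 'I_k.+1} := [set lift ord0 j | j in K].
Definition up0 K : {set 'I_k.+1} := ord0 |: up K.
Definition down_set L : {set 'I_k} := [set j | lift ord0 j \in L].

Lemma ord0_up K : (ord0 \in up K) = false.
Proof. by apply/imsetP => -[j _ /eqP]; rewrite (negbTE (neq_lift _ _)). Qed.

Lemma lift_up K j : (lift ord0 j \in up K) = (j \in K).
Proof. by rewrite mem_imset //; exact: lift_inj. Qed.

Lemma ord0_up0 K : ord0 \in up0 K.
Proof. by rewrite !inE eqxx. Qed.

Lemma lift_up0 K j : (lift ord0 j \in up0 K) = (j \in K).
Proof. by rewrite !inE lift_up eq_sym (negbTE (neq_lift _ _)). Qed.

Lemma down_upK K : down_set (up K) = K.
Proof. by apply/setP => j; rewrite inE lift_up. Qed.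

Lemma down_up0K K : down_set (up0 K) = K.
Proof. by apply/setP => j; rewrite inE lift_up0. Qed.

Lemma up_downK L : ord0 \notin L -> up (down_set L) = L.
Proof.
move=> L0; apply/setP => i; case: (unliftP ord0 i) => [j ->|->].
  by rewrite lift_up inE.
by rewrite ord0_up (negbTE L0).
Qed.

Lemma up0_downK L : ord0 \in L -> up0 (down_set L) = L.
Proof.
move=> L0; apply/setP => i; case: (unliftP ord0 i) => [j ->|->].
  by rewrite lift_up0 inE.
by rewrite ord0_up0 L0.
Qed.

Lemma sum_up (W : nmodType) (F : {set 'I_k.+1} -> W) :
  \sum_L F L = \sum_K F (up K) + \sum_K F (up0 K).
Proof.
rewrite (bigID (fun L : {set 'I_k.+1} => ord0 \notin L)) /=; congr (_ + _).
  rewrite (reindex_onto up down_set); last by move=> L; exact: up_downK.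
  by apply: eq_bigl => K; rewrite ord0_up down_upK eqxx.
rewrite (reindex_onto up0 down_set); last by move=> L; rewrite negbK; exact: up0_downK.
by apply: eq_bigl => K; rewrite ord0_up0 down_up0K eqxx.
Qed.

End SetsOfOrdinals.

Definition conc (A : Type) (J1 : A) (J : nat -> A) (h : nat) : A :=
  if h is h'.+1 then J h' else J1.

Lemma concE (A : Type) (J : nat -> A) : conc (J 0%N) (fun h => J h.+1) = J.
Proof. by apply/funext => -[|h]. Qed.

(** * Passing from T to the shorter list: the first block joins the mirror *)

Section FirstBlock.
Variables (R : realType) (d N : nat).
Local Notation A := 'rV[R]_d.
Variables (mul : A -> A -> A) (conj : A -> A) (v : nat -> A).
Hypothesis alg : real_algebra R d mul (v 0%N).
Hypothesis hyp : hypercomplex_basis R d mul conj N v.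
Variables (ta tb : nat) (l : seq nat).
Local Notation ts := (ta :: tb :: l).
Local Notation tst := (tb :: l).
Hypothesis st : steps N ts.
Local Notation one := (v 0%N).
Local Notation n := (dimD ts).
Local Notation m := (dimD tst).

Lemma ta_tb : (ta < tb)%N.
Proof. by case: st => _ /= /andP[]. Qed.

Lemma steps_tail : steps N tst.
Proof. by case: st => _ /= /andP[_ so] la; split. Qed.

Let dimn : n = (ta.+1 + (size l).+1)%N. Proof. by []. Qed.
Let dimm : m = (tb.+1 + size l)%N. Proof. by []. Qed.

Definition ib : 'I_n := ri (ts := ts) ord0.
Definition blockS : {set 'I_m} := finset (fun i : 'I_m => (ta < i <= tb)%N).

Lemma val_ib : val ib = ta.+1.
Proof. by rewrite /= addn0. Qed.

Let i0m : 'I_m := Ordinal (ltn0Sn _ : (0 < m)%N).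
Let i0n : 'I_n := Ordinal (ltn0Sn _ : (0 < n)%N).

(** The mirror keeps its indices, and index [ta.+2 + h] on the side of T corresponds to [tb.+1 + h]
    on the other. At [ib] truncated subtraction gives an arbitrary value, as it does for [tgt] on
    [blockS]; the lemmas exclude these indices. *)
Definition src (j : 'I_n) : 'I_m :=
  insubd i0m (if (j < ta.+1)%N then j : nat else tb.+1 + (j - ta.+2))%N.
Definition tgt (i : 'I_m) : 'I_n :=
  insubd i0n (if (i < ta.+1)%N then i : nat else ta.+2 + (i - tb.+1))%N.

Lemma val_src j : j != ib ->
  src j = (if (j < ta.+1)%N then j : nat else tb.+1 + (j - ta.+2))%N :> nat.
Proof.
rewrite -val_eqE val_ib /= => jb; rewrite val_insubd ifT //.
have := ta_tb; have := ltn_ord j; rewrite [X in (_ < X)%N]dimn dimm.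
by case: ifP; lia.
Qed.

Lemma notin_blockS (i : 'I_m) : i \notin blockS -> (i < ta.+1)%N \/ (tb < i)%N.
Proof. by rewrite inE negb_and -!leqNgt -ltnNge ltnS => /orP[]; [left|right]. Qed.

Lemma val_tgt i : i \notin blockS ->
  tgt i = (if (i < ta.+1)%N then i : nat else ta.+2 + (i - tb.+1))%N :> nat.
Proof.
move=> /notin_blockS iS; rewrite val_insubd ifT //.
have := ta_tb; have := ltn_ord i; rewrite [X in (_ < X)%N]dimm dimn.
by case: ifP; lia.
Qed.

Lemma src_out j : j != ib -> src j \notin blockS.
Proof.
move=> jb; rewrite inE val_src //; move: jb; rewrite -val_eqE val_ib /= => jb.
have := ta_tb; case: ifP; lia.
Qed.

Lemma tgt_neq i : i \notin blockS -> tgt i != ib.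
Proof.
move=> iS; rewrite -val_eqE val_ib /= val_tgt //.
by have := notin_blockS iS; have := ta_tb; case: ifP; lia.
Qed.

Lemma tgtK i : i \notin blockS -> src (tgt i) = i.
Proof.
move=> iS; apply: ord_inj; rewrite val_src ?tgt_neq // val_tgt //.
have := notin_blockS iS; have := ta_tb; case: (ltnP i ta.+1) => H.
  by rewrite H.
by case: ifP; lia.
Qed.

Lemma srcK j : j != ib -> tgt (src j) = j.
Proof.
move=> jb; apply: ord_inj; rewrite val_tgt ?src_out // val_src //.
move: jb; rewrite -val_eqE val_ib /= => jb.
have := ta_tb; case: (ltnP j ta.+1) => H; first by rewrite H.
by case: ifP; lia.
Qed.

Lemma blockS_big (T : Type) (idx : T) (op : Monoid.com_law idx) (F : nat -> T) :
  \big[op/idx]_(ta.+1 <= s < tb.+1) F s = \big[op/idx]_(i in blockS) F i.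
Proof.
rewrite (big_nat_widen _ _ m) ?dimm ?leq_addr // (big_nat_widenl _ 0) //.
rewrite big_mkord; apply: eq_bigl => i; rewrite inE /=.
by rewrite ltnS andbC.
Qed.

Lemma card_blockS : #|blockS| = (tb - ta)%N.
Proof. by rewrite -sum1_card -(blockS_big _ (fun=> 1%N)) sum_nat_const_nat muln1 subSS. Qed.

Local Notation dn := (dn ib blockS src).

Lemma downE (q : 'rV[R]_m) : Defs.down R ts q = dn q.
Proof.
apply/rowP => i; rewrite !mxE /=.
have [ii|ii] := eqVneq i ib.
  have iv : i = ta.+1 :> nat by rewrite ii -val_ib.
  rewrite iv ltnn eqxx; congr Num.sqrt.
  rewrite (blockS_big _ (fun s => vc R m q s ^+ 2)).
  by apply: eq_bigr => s _; rewrite vcE.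
have := val_src ii; have := ii; rewrite -val_eqE val_ib /= => /negbTE -> Es.
by case: ifP Es => _ <-; rewrite vcE.
Qed.

Definition x1 (q : 'rV[R]_m) : A := \sum_(s in blockS) q 0 s *: v s.

Lemma torus_conc J1 J : torus R d v ts (conc J1 J) <->
  sphere R d v ta.+1 tb J1 /\ torus R d v tst J.
Proof.
split=> [H|[H1 H2]]; last by case=> [|h] hl; [exact: H1|exact: H2].
by split=> [|h hl]; [exact: (H 0%N)|exact: (H h.+1)].
Qed.

(** Both [p] and [q] are free, because it is applied with [p = dn q] in [pt_dn] and with [q] a
    linear image of [p] in [pt_emb]. *)
Lemma pt_split J1 J (p : 'rV[R]_n) (q : 'rV[R]_m) :
  (forall s, (s < ta.+1)%N -> vc R n p s = vc R m q s) ->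
  (forall h, (h < size l)%N -> vc R n p (ta.+2 + h)%N = vc R m q (tb.+1 + h)%N) ->
  p 0 ib *: J1 = x1 q ->
  pt R d v ts (conc J1 J) p = pt R d v tst J q.
Proof.
move=> H1 H2 H3; rewrite /pt /= [X in _ + X = _]big_ord_recl /= addrA addn0.
have -> : vc R n p ta.+1 = p 0 ib by rewrite -val_ib vcE.
rewrite H3; congr (_ + _); last first.
  apply: eq_bigr => h _; rewrite /bump leq0n /= addnA addn1 /=.
  by rewrite H2.
rewrite -[RHS](big_mkord xpredT (fun s => vc R m q s *: v s)).
rewrite (@big_cat_nat _ _ _ ta.+1) //=; last by rewrite ltnS ltnW // ta_tb.
congr (_ + _).
  by rewrite big_mkord; apply: eq_bigr => s _; rewrite H1.
rewrite (blockS_big _ (fun s => vc R m q s *: v s)).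
by apply: eq_bigr => s _; rewrite vcE.
Qed.

Lemma x1_sphere q : exists2 J1, sphere R d v ta.+1 tb J1 & dn q 0 ib *: J1 = x1 q.
Proof.
have tab := ta_tb.
have [N0|N0] := eqVneq (sqnorm blockS q) 0.
  (* When [x1 q] vanishes any unit vector of the block serves as direction. *)
  exists (v tb).
    have /(_ 0%N isT) := @torus_nonempty R d N v ts st; exact.
  rewrite dn_b N0 sqrtr0 scale0r /x1 big1 // => s sS.
  suff -> : q 0 s = 0 by rewrite scale0r.
  have : q 0 s ^+ 2 <= sqnorm blockS q.
    rewrite /sqnorm (bigD1 s) //= lerDl.
    by apply: sumr_ge0 => i _; exact: sqr_ge0.
  by rewrite N0 => qle; apply/eqP; rewrite -sqrf_eq0 eq_le qle sqr_ge0.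
have Np : 0 < sqnorm blockS q by rewrite lt_neqAle eq_sym N0 sqnorm_ge0.
have sn0 : Num.sqrt (sqnorm blockS q) != 0 by rewrite gt_eqF // sqrtr_gt0.
exists ((Num.sqrt (sqnorm blockS q))^-1 *: x1 q); last first.
  by rewrite dn_b scalerA mulfV // scale1r.
exists (fun s => (Num.sqrt (sqnorm blockS q))^-1 * vc R m q s); split.
  rewrite (blockS_big _ (fun s => (_ * vc R m q s) *: v s)) scaler_sumr.
  by apply: eq_bigr => s _; rewrite vcE scalerA.
rewrite (blockS_big _ (fun s => (_ * vc R m q s) ^+ 2)).
rewrite (eq_bigr (fun s => (Num.sqrt (sqnorm blockS q))^-1 ^+ 2 * q 0 s ^+ 2)); last first.
  by move=> s _; rewrite vcE exprMn.
by rewrite -mulr_sumr exprVn sqr_sqrtr ?sqnorm_ge0 // -/(sqnorm blockS q) mulVf.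
Qed.

Lemma dn_low q s : (s < ta.+1)%N -> vc R n (dn q) s = vc R m q s.
Proof.
move=> sa; have sn : (s < n)%N by rewrite dimn; lia.
rewrite (vc_lt _ sn) mxE; have nb : Ordinal sn != ib.
  by rewrite -val_eqE val_ib /=; lia.
by rewrite (negbTE nb) -vcE val_src //= sa.
Qed.

Lemma dn_high q h : (h < size l)%N -> vc R n (dn q) (ta.+2 + h)%N = vc R m q (tb.+1 + h)%N.
Proof.
move=> hl; have sn : (ta.+2 + h < n)%N by rewrite dimn; lia.
rewrite (vc_lt _ sn) mxE; have nb : Ordinal sn != ib.
  by rewrite -val_eqE val_ib /=; lia.
rewrite (negbTE nb) -vcE val_src //= ifF; last by lia.
by congr (vc _ _ _ _); lia.
Qed.

Lemma pt_dn J1 J q : dn q 0 ib *: J1 = x1 q ->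
  pt R d v ts (conc J1 J) (dn q) = pt R d v tst J q.
Proof. by move=> E; apply: pt_split => // [s|h]; [exact: dn_low|exact: dn_high]. Qed.

Let enum_tau : enum 'I_(tau ts) = ord0 :: map (lift ord0) (enum 'I_(tau tst)).
Proof. exact: enum_ordSl. Qed.

Lemma JK_up J1 J K :
  JK R d mul one (tau ts) (conc J1 J) (up K) = JK R d mul one (tau tst) J K.
Proof.
rewrite !JKE enum_tau /= ifF; last exact: ord0_up.
by rewrite JKs_map; apply: eq_JKs => // j; exact: lift_up.
Qed.

Lemma JK_up0 J1 J K :
  JK R d mul one (tau ts) (conc J1 J) (up0 K) = mul J1 (JK R d mul one (tau tst) J K).
Proof.
rewrite !JKE enum_tau /= ifT; last exact: ord0_up0.
by congr mul; rewrite JKs_map; apply: eq_JKs => // j; exact: lift_up0.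
Qed.

Lemma Ival_conc F J1 J p :
  Ival R d mul v ts F (conc J1 J) p =
  \sum_K mul (JK R d mul one (tau tst) J K) (F (up K) p)
  + mul J1 (\sum_K mul (JK R d mul one (tau tst) J K) (F (up0 K) p)).
Proof.
rewrite /Ival sum_up; congr (_ + _); first by apply: eq_bigr => K _; rewrite JK_up.
by rewrite (mul_sumr alg); apply: eq_bigr => K _; rewrite JK_up0 (mulAA alg).
Qed.

(** [x1 q] is a multiple of a unit vector of the first block, which anticommutes with each of the
    [#|K|] factors. *)
Lemma JK_x1 J K q : torus R d v tst J ->
  mul (JK R d mul one (tau tst) J K) (x1 q) =
  (-1) ^+ #|K| *: mul (x1 q) (JK R d mul one (tau tst) J K).
Proof.
move=> HJ; have [J1 HJ1 <-] := x1_sphere q.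
rewrite JKE (JKs_anti alg); last first.
  move=> k _; rewrite (mulZl alg) (mulZr alg) -scalerN; congr (_ *: _).
  apply/eqP; rewrite -eqr_oppLR; apply/eqP/esym.
  apply: (sphere_anti alg hyp (ltn0Sn _) _ _ HJ1 (HJ k (ltn_ord k))).
    rewrite ltnS; exact: (@tn_le N tst steps_tail 0%N k (leq0n _) (ltnW (ltn_ord k))).
  exact: (tn_N steps_tail (ltn_ord k)).
by rewrite cardE -size_filter; congr (_ ^+ _ *: _); rewrite enumT.
Qed.

Lemma flip_dn (h : 'I_(tau tst)) (q : 'rV[R]_m) :
  dn (flip (ri h) q) = flip (ri (ts := ts) (lift ord0 h)) (dn q).
Proof.
have tab := ta_tb; have hl := ltn_ord h.
apply/rowP => j; rewrite !mxE.
have rb : (j == ri (ts := ts) (lift ord0 h)) = ((j : nat) == ta.+2 + h)%N.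
  by rewrite -val_eqE /= /bump leq0n addnA addn1.
rewrite rb; have [->|jb] := eqVneq j ib.
  rewrite ifF; last by rewrite -[ib : nat]/(val ib) val_ib addSn ltn_eqF // ltnS leq_addr.
  congr Num.sqrt; apply: eq_bigr => s; rewrite inE => sS; rewrite mxE ifN //.
  by rewrite -val_eqE /= /t0 /=; lia.
have -> : (src j == ri h) = ((j : nat) == ta.+2 + h)%N; last by [].
rewrite -val_eqE /= /t0 /= val_src //; move: jb; rewrite -val_eqE val_ib /= => jb.
by case: ifP => H; apply/eqP/eqP; lia.
Qed.

Lemma x1_flip (h : 'I_(tau tst)) q : x1 (flip (ri h) q) = x1 q.
Proof.
apply: eq_bigr => s; rewrite inE => sS; rewrite mxE ifN //.
by rewrite -val_eqE /= /t0 /=; lia.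
Qed.

Lemma dirvec_tgt J1 J (i : 'I_m) : i \notin blockS ->
  dirvec R d v ts (conc J1 J) (tgt i) = dirvec R d v tst J i.
Proof.
move=> iS; have tab := ta_tb; rewrite /dirvec val_tgt // /t0 /=.
case: (ltnP i ta.+1) => ia; first by rewrite ia ifT // ltnS; exact: ltnW (leq_trans ia tab).
have tbi : (tb < i)%N by case: (notin_blockS iS) => // ia'; move: ia; rewrite leqNgt ia'.
rewrite !ifF; [|by apply/negbTE; rewrite -leqNgt..|by apply/negbTE; rewrite -leqNgt ltnW // ltnS leq_addr].
by rewrite (_ : ta.+2 + (i - tb.+1) - ta.+1 = (i - tb.+1).+1)%N //; lia.
Qed.

Lemma dirvec_blockS J (i : 'I_m) : i \in blockS -> dirvec R d v tst J i = v i.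
Proof. by rewrite inE /dirvec /t0 /= => /andP[_ itb]; rewrite ltnS itb. Qed.

Lemma dirvec_ib J1 J : dirvec R d v ts (conc J1 J) ib = J1.
Proof. by rewrite /dirvec /t0 /= addn0 ltnn subnn. Qed.

End FirstBlock.

(** * Stability of the growth bounds *)

Section GrowthClosure.
Variables (R : realType) (n d : nat) (U : set 'rV[R]_n).
Hypothesis oU : open U.
Implicit Types g : 'rV[R]_n -> 'rV[R]_d.

Lemma eq_partials g g' : (forall p, U p -> g p = g' p) ->
  forall s p, U p -> partials s g p = partials s g' p.
Proof. by move=> E; elim=> [//|i s IH] p Up /=; exact: (eq_partial i oU Up IH). Qed.

Lemma partialsD g g' s p : Cinf U g -> Cinf U g' -> U p ->
  partials s (fun p => g p + g' p) p = partials s g p + partials s g' p.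
Proof.
move=> gC gC'; elim: s p => [//|i s IH] p Up /=.
rewrite (eq_partial i oU Up IH); apply: partial_val; apply: is_derive_addf.
  exact: (Ck_is_derive i (Cinf_partials s gC 1%N) Up).
exact: (Ck_is_derive i (Cinf_partials s gC' 1%N) Up).
Qed.

Lemma partials_mulmxr (M : 'M[R]_d) g s p : Cinf U g -> U p ->
  partials s (fun p => g p *m M) p = partials s g p *m M.
Proof.
move=> gC; elim: s p => [//|i s IH] p Up /=.
rewrite (eq_partial i oU Up IH); apply: partial_val; apply: is_derive_mulmxr.
exact: (Ck_is_derive i (Cinf_partials s gC 1%N) Up).
Qed.

Lemma analytic_growth_eq g g' : (forall p, U p -> g p = g' p) ->
  analytic_growth U g -> analytic_growth U g'.
Proof.
move=> E [gC gA]; split=> [k|x Ux]; first exact: (Ck_eq oU E (gC k)).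
have [r [M [C [r0 M0 C0 H]]]] := gA x Ux; have [r' r'0 rU] := open_distP oU Ux.
exists (Num.min r r'), M, C; split=> // [|s y]; first by rewrite lt_min r0.
by rewrite lt_min => /andP[yr yr']; rewrite -(eq_partials E) ?H //; exact: rU.
Qed.

Lemma analytic_growthD g g' : analytic_growth U g -> analytic_growth U g' ->
  analytic_growth U (fun p => g p + g' p).
Proof.
move=> [gC gA] [gC' gA']; split=> [k|x Ux]; first exact: (CkD oU (gC k) (gC' k)).
have [r [M [C [r0 M0 C0 H]]]] := gA x Ux.
have [r' [M' [C' [r'0 M'0 C'0 H']]]] := gA' x Ux.
have [r'' r''0 rU] := open_distP oU Ux.
exists (Num.min r'' (Num.min r r')), (M + M'), (Num.max C C').
split; [by rewrite !lt_min r0 r'0 r''0|exact: addr_ge0|by rewrite le_max C0|].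
move=> s y; rewrite !lt_min => /and3P[yr'' yr yr'].
rewrite partialsD //; last exact: rU.
apply: le_trans (ler_normD _ _) _; rewrite -mulrA mulrDl lerD //.
  apply: le_trans (H s y yr) _; rewrite -mulrA ler_wpM2l // ler_wpM2r //.
  by rewrite lerXn2r // ?nnegrE ?le_max ?C0 ?lexx.
apply: le_trans (H' s y yr') _; rewrite -mulrA ler_wpM2l // ler_wpM2r //.
by rewrite lerXn2r // ?nnegrE ?le_max ?C'0 ?lexx ?orbT.
Qed.

Lemma norm_mulmxr (M : 'M[R]_d) :
  exists2 B : R, 0 <= B & forall x : 'rV[R]_d, `|x *m M| <= B * `|x|.
Proof.
have B0 : 0 <= \sum_i \sum_j `|M i j| by apply: sumr_ge0 => i _; exact: sumr_ge0.
exists (\sum_i \sum_j `|M i j|) => // x; apply: normr_row_le => [|j].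
  by rewrite mulr_ge0.
rewrite mxE mulr_suml; apply: le_trans (ler_norm_sum _ _ _) _.
apply: ler_sum => i _; rewrite normrM mulrC ler_pM //; last exact: normr_coord.
by rewrite (bigD1 j) //= lerDl; exact: sumr_ge0.
Qed.

Lemma analytic_growth_mulmxr (M0 : 'M[R]_d) g : analytic_growth U g ->
  analytic_growth U (fun p => g p *m M0).
Proof.
move=> [gC gA]; split=> [k|x Ux]; first exact: (Ck_mulmxr M0 oU (gC k)).
have [r [M [C [rp Mp Cp H]]]] := gA x Ux; have [B B0 HB] := norm_mulmxr M0.
have [r'' r''0 rU] := open_distP oU Ux.
exists (Num.min r'' r), (B * M), C; split=> //.
- by rewrite !lt_min rp r''0.
- exact: mulr_ge0.
- move=> s y; rewrite !lt_min => /andP[yr'' yr]; rewrite partials_mulmxr //; last exact: rU.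
  by apply: le_trans (HB _) _; rewrite -!mulrA ler_wpM2l // mulrA H.
Qed.

End GrowthClosure.

Section GrowthComposition.
Variables (R : realType) (n m d : nat).
Variables (l : 'rV[R]_n -> 'rV[R]_m) (sg : 'I_n -> 'I_m) (c : 'I_n -> R).
Hypothesis l_line : forall i x h,
  l (h *: delta_mx 0 i + x) = (h * c i) *: delta_mx 0 (sg i) + l x.
Hypothesis l_cont : continuous l.
Hypothesis c1 : forall i, `|c i| <= 1.
Variables (U : set 'rV[R]_m) (U' : set 'rV[R]_n).
Hypotheses (oU : open U) (oU' : open U') (U'U : forall x, U' x -> U (l x)).

Lemma partials_comp_coord (g : 'rV[R]_m -> 'rV[R]_d) s p : Cinf U g -> U' p ->
  partials s (g \o l) p = (\prod_(i <- s) c i) *: partials (map sg s) g (l p).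
Proof.
move=> gC; elim: s p => [|i s IH] p Up /=; first by rewrite big_nil scale1r.
rewrite (eq_partial i oU' Up IH) big_cons mulrC -scalerA; apply: partial_val.
apply: (is_deriveZ (\prod_(j <- s) c j)).
apply: (is_derive_comp_coord (j := sg i)); first by move=> h; exact: l_line.
exact: (Ck_is_derive _ (Cinf_partials _ gC 1%N) (U'U Up)).
Qed.

Lemma analytic_growth_comp_coord (g : 'rV[R]_m -> 'rV[R]_d) : analytic_growth U g ->
  analytic_growth U' (fun p => g (l p)).
Proof.
move=> [gC gA]; split=> [k|x Ux].
  exact: (Ck_comp_coord l_line l_cont oU oU' U'U (gC k)).
have [r [M [C [r0 M0 C0 H]]]] := gA (l x) (U'U Ux).
have [r1 r10 rU] := open_distP oU' Ux.
have [r2 r20 rl] := (continuous_distP l x).1 (@l_cont x) r r0.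
exists (Num.min r1 r2), M, C; split=> // [|s y]; first by rewrite lt_min r10.
rewrite lt_min => /andP[yr1 yr2].
rewrite (partials_comp_coord s gC (rU y yr1)) normrZ -[X in _ <= X]mul1r ler_pM //.
  by elim: s => [|i s IH]; rewrite ?big_nil ?normr1 // big_cons normrM mulr_ile1.
by have := H (map sg s) (l y) (rl y yr2); rewrite size_map.
Qed.

End GrowthComposition.

(** * From one slice of a T-function to its stem components *)

Section StemComponents.
Variables (R : realType) (d N : nat).
Local Notation A := 'rV[R]_d.
Variables (mul : A -> A -> A) (conj : A -> A) (v : nat -> A).
Hypothesis alg : real_algebra R d mul (v 0%N).
Hypothesis hyp : hypercomplex_basis R d mul conj N v.
Variable ts : seq nat.
Hypothesis st : steps N ts.
Local Notation n := (dimD ts).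
Variable D : set 'rV[R]_n.
Hypothesis Dr : forall (h : 'I_(tau ts)) p, D p -> D (refl R ts h p).

(** Parities isolate the summand J_K [F K] of the induced function on one slice, and a left inverse
    of J_K, as a matrix, frees [F K]. It is applied to vanishing, to smooth harmonicity and to
    growth bounds. *)
Lemma stem_component (nice : ('rV[R]_n -> A) -> Prop) F J :
  (forall f g, nice f -> nice g -> nice (fun p => f p + g p)) ->
  (forall (M : 'M[R]_d) f, nice f -> nice (fun p => f p *m M)) ->
  (forall b f, (forall p, D p -> D (flip b p)) -> nice f -> nice (fun p => f (flip b p))) ->
  (forall f g, (forall p, D p -> f p = g p) -> nice f -> nice g) ->
  stem R d ts D F -> torus R d v ts J -> nice (Ival R d mul v ts F J) ->
  forall K, nice (F K).
Proof.
move=> nD nM nR nE sF HJ nI K.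
have [y yK] := JK_inv alg hyp st K HJ.
apply: (nE _ _ _ (nM (Lm mul y) _ _)); last first.
  apply: (parity_component (D := D) nD _ _ nE (ri := @ri ts)
    (c := fun K p => mul (JK R d mul (v 0%N) (tau ts) J K) (F K p)) _ nI K).
  - move=> a f nf; apply: nE (nM a%:M _ nf) => p _; exact: mul_mx_scalar.
  - move=> h f; apply: nR => p; exact: D_flip.
  - move=> K' h p Dp; rewrite (stem_parity K' h sF Dp); exact: (mulZr alg).
by move=> p _; rewrite -(LmE alg) yK.
Qed.

Lemma stem_unique F F' J K p : stem R d ts D F -> stem R d ts D F' -> torus R d v ts J ->
  (forall p, D p -> Ival R d mul v ts F J p = Ival R d mul v ts F' J p) ->
  D p -> F K p = F' K p.
Proof.
move=> sF sF' HJ E Dp; apply/eqP; rewrite -subr_eq0; apply/eqP.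
move: p Dp.
apply: (@stem_component (fun f => forall p, D p -> f p = 0) (fun K p => F K p - F' K p) J) => //.
- by move=> f g f0 g0 p Dp; rewrite f0 ?g0 ?addr0.
- by move=> M f f0 p Dp; rewrite f0 ?mul0mx.
- by move=> b f Db f0 p Dp; apply: f0; exact: Db.
- by move=> f g E0 f0 p Dp; rewrite -E0 ?f0.
- by move=> K' h p Dp; rewrite sF // sF' //; case: ifP; rewrite ?opprB 1?addrC ?opprK.
move=> p Dp; have := E p Dp => /eqP; rewrite -subr_eq0 => /eqP E0; apply: etrans E0.
rewrite -sumrB; apply: eq_bigr => K' _.
by rewrite (mulDr alg) (mulNr alg).
Qed.

Hypothesis oD : open D.

(** On a single slice [f] solves an elliptic system, hence is smooth and harmonic, and this pair of
    properties has the stability that [stem_component] asks for. *)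
Lemma stem_regular F f J : torus R d v ts J -> tfun_of R d mul v ts D f F ->
  T_regular R d mul v ts (Omega R d v ts D) f ->
  forall K, Cinf D (F K) /\ forall p, D p -> laplacian (F K) p = 0.
Proof.
move=> HJ [sF fF] rf.
have sol := T_regularP alg hyp st Dr HJ oD rf.
have EE := EJ_elliptic alg hyp st HJ.
have uC := solution_Cinf EE oD sol.
apply: (@stem_component (fun g => Cinf D g /\ forall p, D p -> laplacian g p = 0) _ J).
- move=> g h [gC g0] [hC h0]; split=> [k|p Dp]; first exact: (CkD oD (gC k) (hC k)).
  by rewrite (laplacianD oD) // g0 // h0 // addr0.
- move=> M g [gC g0]; split=> [k|p Dp]; first exact: (Ck_mulmxr M oD (gC k)).
  by rewrite (laplacian_mulmxr oD) // g0 // mul0mx.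
- move=> b g Db [gC g0]; split=> [k|p Dp]; first exact: (Ck_flip oD Db (gC k)).
  by rewrite (laplacian_flip oD Db gC Dp) g0 //; exact: Db.
- move=> g h E [gC g0]; split=> [k|p Dp]; first exact: (Ck_eq oD E (gC k)).
  by rewrite -(eq_laplacian oD E Dp) g0.
- exact: sF.
- exact: HJ.
have Ef p : D p -> (f \o pt R d v ts J) p = Ival R d mul v ts F J p.
  by move=> Dp; exact: fF.
split=> [k|p Dp]; first exact: (Ck_eq oD Ef (uC k)).
rewrite -(eq_laplacian oD Ef Dp).
exact: (solution_harmonic EE oD (uC 2%N) sol Dp).
Qed.

End StemComponents.

Section IteratedLaplacian.
Variables (R : realType) (n d : nat) (U : set 'rV[R]_n).
Hypothesis oU : open U.
Implicit Types g : 'rV[R]_n -> 'rV[R]_d.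
Local Notation lap := (@laplacian R n 'rV[R]_d).

Lemma iter_laplacian_mulmxr k (M : 'M[R]_d) g p : Cinf U g -> U p ->
  iter k lap (fun p => g p *m M) p = iter k lap g p *m M.
Proof.
move=> gC; elim: k p => [//|k IH] p Up /=.
rewrite (eq_laplacian oU IH Up) (laplacian_mulmxr oU) //.
exact: Cinf_iter_laplacian.
Qed.

Lemma iter_laplacian_sum k (I : Type) (r : seq I) (F : I -> 'rV[R]_n -> 'rV[R]_d) p :
  (forall i, Cinf U (F i)) -> U p ->
  iter k lap (fun p => \sum_(i <- r) F i p) p = \sum_(i <- r) iter k lap (F i) p.
Proof.
move=> FC; elim: k p => [//|k IH] p Up /=.
rewrite (eq_laplacian oU IH Up) (laplacian_sum oU) // => i _.
exact: Cinf_iter_laplacian.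
Qed.

Lemma partial_iter_laplacian k i g p : Cinf U g -> U p ->
  partial i (iter k lap g) p = iter k lap (partial i g) p.
Proof.
move=> gC; elim: k p => [//|k IH] p Up /=.
rewrite (laplacian_partial oU) //; last exact: Cinf_iter_laplacian.
exact: (eq_laplacian oU IH Up).
Qed.

End IteratedLaplacian.

(** * The first Fueter transform *)

Section FirstFueter.
Variables (R : realType) (d N : nat).
Local Notation A := 'rV[R]_d.
Variables (mul : A -> A -> A) (conj : A -> A) (v : nat -> A).
Hypothesis alg : real_algebra R d mul (v 0%N).
Hypothesis hyp : hypercomplex_basis R d mul conj N v.
Variables (ta tb : nat) (l : seq nat).
Local Notation ts := (ta :: tb :: l).
Local Notation tst := (tb :: l).
Hypothesis st : steps N ts.
Local Notation one := (v 0%N).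
Local Notation n := (dimD ts).
Local Notation m := (dimD tst).
Local Notation S := (blockS ta tb l).
Local Notation b := (ib ta tb l).
Local Notation src := (@src ta tb l).
Local Notation tgt := (@tgt ta tb l).
Local Notation dn := (dn b S src).
Local Notation x1 := (@x1 R d v ta tb l).
Local Notation SE := (smooth_even b).

Let so := src_out st.
Let tK := tgtK st.
Let tne := tgt_neq st.
Let sK := srcK st.

Variable D : set 'rV[R]_n.
Hypothesis oD : open D.
Hypothesis Dr : forall (h : 'I_(tau ts)) p, D p -> D (refl R ts h p).
Local Notation Dt := ([set q | D (dn q)]).

Let Df p : D p -> D (flip b p).
Proof. exact: (D_flip Dr (ord0 : 'I_(tau ts))). Qed.

Lemma open_Dt : open Dt.
Proof. exact: open_dn. Qed.
Let oDt := open_Dt.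

Lemma Dt_refl (h : 'I_(tau tst)) q : Dt q -> Dt (refl R tst h q).
Proof.
by move=> Dq; rewrite reflE /= (flip_dn st); exact: (D_flip Dr (lift ord0 h : 'I_(tau ts))).
Qed.

(** The form [P + x1 Q]. The scalar [e] is 1 for the function itself, and a sign for its stem
    components with respect to the shorter list. *)
Definition rfun (e : R) (P Q : 'rV[R]_n -> A) (q : 'rV[R]_m) : A :=
  P (dn q) + e *: mul (x1 q) (Q (dn q)).

Lemma rfunE e P Q q : rfun e P Q q =
  (P \o dn) q + \sum_(s in S) (q 0 s *: (Q \o dn) q) *m (e *: Lm mul (v s)).
Proof.
rewrite /rfun (mul_suml alg) scaler_sumr; congr (_ + _); apply: eq_bigr => s _ /=.
by rewrite -scalemxAr -(LmE alg) (mulZl alg) (mulZr alg).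
Qed.

Let Cinf_coord_dn (Q : 'rV[R]_n -> A) (s : 'I_m) : SE D Q ->
  Cinf Dt (fun q : 'rV[R]_m => q 0 s *: (Q \o dn) q).
Proof.
move=> QS k; apply: (CkZ oDt); first exact: (Ck_coord _ _ oDt).
exact: (Cinf_dn so tK tne sK oD Df QS).
Qed.

Lemma Cinf_rfun e P Q : SE D P -> SE D Q -> Cinf Dt (rfun e P Q).
Proof.
move=> PS QS k; apply: (Ck_eq oDt (fun q _ => esym (rfunE e P Q q))).
apply: (CkD oDt); first exact: (Cinf_dn so tK tne sK oD Df PS).
apply: (Ck_sum _ oDt) => s _; apply: (Ck_mulmxr _ oDt).
exact: (Cinf_coord_dn s QS).
Qed.

(** The form survives, with parameter [#|S|] for [P] and [#|S| + 2] for [Q], the latter because of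
    the coordinates in [x1]. *)
Lemma laplacian_rfun e P Q q : SE D P -> SE D Q -> Dt q ->
  laplacian (rfun e P Q) q =
  rfun e (darboux b #|S|%:R P) (darboux b (#|S|%:R + 2) Q) q.
Proof.
move=> PS QS Dq; rewrite (eq_laplacian oDt (fun q _ => rfunE e P Q q) Dq) rfunE.
have CP := Cinf_dn so tK tne sK oD Df PS.
have CQ (s : 'I_m) k := Ck_mulmxr (e *: Lm mul (v s)) oDt (Cinf_coord_dn s QS k).
rewrite (laplacianD oDt CP) //; last by move=> k; apply: (Ck_sum _ oDt) => s _; exact: CQ.
rewrite (laplacian_dn so tK tne sK oD Df PS Dq); congr (_ + _).
rewrite (laplacian_sum oDt) => [|s _ k|]; [|exact: CQ|exact: Dq].
apply: eq_bigr => s sS.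
rewrite (laplacian_mulmxr oDt) //; last exact: Cinf_coord_dn.
by rewrite (laplacian_coord_dn so tK tne sK oD Df QS Dq sS).
Qed.

Lemma iter_laplacian_rfun k e P Q q : SE D P -> SE D Q -> Dt q ->
  iter k (@laplacian R m A) (rfun e P Q) q =
  rfun e (iter k (darboux b #|S|%:R) P) (iter k (darboux b (#|S|%:R + 2)) Q) q.
Proof.
move=> PS QS; elim: k q => [//|k IH] q Dq /=.
have it c j H : SE D H -> SE D (iter j (darboux b c) H).
  by move=> HS; elim: j => //= j; exact: (smooth_even_darboux oD Df).
by rewrite (eq_laplacian oDt IH Dq) laplacian_rfun //; exact: it.
Qed.

Lemma is_derive_rfun P Q i q dP dQ :
  is_derive q (delta_mx 0 i) (P \o dn) dP -> is_derive q (delta_mx 0 i) (Q \o dn) dQ ->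
  is_derive q (delta_mx 0 i) (rfun 1 P Q)
    (dP + (mul (x1 q) dQ + (if i \in S then mul (v i) (Q (dn q)) else 0))).
Proof.
move=> HP HQ.
have -> : rfun 1 P Q = (fun q => (P \o dn) q +
    \sum_(s in S) (q 0 s *: (Q \o dn) q) *m (1 *: Lm mul (v s))).
  by apply/funext => y; exact: rfunE.
apply: is_derive_addf => //.
have -> : mul (x1 q) dQ + (if i \in S then mul (v i) (Q (dn q)) else 0) =
  \sum_(s in S) (q 0 s *: dQ + ((s == i)%:R : R) *: (Q \o dn) q) *m (1 *: Lm mul (v s)).
  have E s : (q 0 s *: dQ + ((s == i)%:R : R) *: (Q \o dn) q) *m (1 *: Lm mul (v s)) =
    mul (q 0 s *: v s) dQ + (if s == i then mul (v s) (Q (dn q)) else 0).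
    rewrite scale1r -(LmE alg) (mulDr alg) !(mulZr alg) (mulZl alg).
    by case: ifP => _ /=; rewrite ?scale1r ?scale0r.
  rewrite (eq_bigr _ (fun s _ => E s)) big_split /= -(mul_suml alg); congr (_ + _).
  rewrite -big_mkcondr /=; case: ifP => iS.
    rewrite (big_pred1 i) // => s /=.
    by case: eqVneq => [->|_]; rewrite ?iS ?andbF.
  rewrite big_pred0 // => s; by case: eqVneq => [->|_]; rewrite ?iS ?andbF.
apply: is_derive_sumf => s _; apply: is_derive_mulmxr; apply: is_deriveZW => //.
exact: is_derive_coord.
Qed.

(** * Comparison of the two Cauchy-Riemann operators *)

Variables (f : A -> A) (F : {set 'I_(tau ts)} -> 'rV[R]_n -> A).
Hypothesis fF : tfun_of R d mul v ts D f F.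
Hypothesis rf : T_regular R d mul v ts (Omega R d v ts D) f.

Let FC K : Cinf D (F K).
Proof. by have [H _] := stem_regular alg hyp st Dr oD (torus_nonempty v st) fF rf K. Qed.

Let Fharm K p : D p -> laplacian (F K) p = 0.
Proof. by have [_ H] := stem_regular alg hyp st Dr oD (torus_nonempty v st) fF rf K; exact: H. Qed.

Lemma smooth_even_up (K : {set 'I_(tau tst)}) : SE D (F (up K)).
Proof.
split; first exact: FC.
have := @stem_parity R d ts D F (up K) ord0 fF.1.
by rewrite (ord0_up K : (ord0 : 'I_(tau ts)) \in up K = false).
Qed.

Lemma odd_up0 (K : {set 'I_(tau tst)}) : parity b D (-1) (F (up0 K)).
Proof.
have := @stem_parity R d ts D F (up0 K) ord0 fF.1.
by rewrite (ord0_up0 K : (ord0 : 'I_(tau ts)) \in up0 K = true).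
Qed.

Lemma smooth_even_up0 (K : {set 'I_(tau tst)}) : SE D (divc b (F (up0 K))).
Proof.
split; first exact: (Cinf_divc oD (FC _) (odd_up0 K)).
exact: (parity_divc Df (odd_up0 K)).
Qed.

Definition even_part J p := \sum_K mul (JK R d mul one (tau tst) J K) (F (up K) p).
Definition odd_part J p := \sum_K mul (JK R d mul one (tau tst) J K) (F (up0 K) p).

Let Cinf_mul a (g : 'rV[R]_n -> A) : Cinf D g -> Cinf D (fun p => mul a (g p)).
Proof.
move=> gC k; apply: (Ck_eq oD (fun p _ => esym (LmE alg a (g p)))).
exact: (Ck_mulmxr _ oD (gC k)).
Qed.

Let Cinf_part J (g : {set 'I_(tau tst)} -> 'rV[R]_n -> A) : (forall K, Cinf D (g K)) ->
  Cinf D (fun p => \sum_K mul (JK R d mul one (tau tst) J K) (g K p)).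
Proof.
by move=> gC k; apply: (Ck_sum _ oD) => K _; exact: (Cinf_mul _ (gC K)).
Qed.

Let parity_part J a (g : {set 'I_(tau tst)} -> 'rV[R]_n -> A) :
  (forall K, parity b D a (g K)) ->
  parity b D a (fun p => \sum_K mul (JK R d mul one (tau tst) J K) (g K p)).
Proof.
move=> gp p Dp; rewrite scaler_sumr; apply: eq_bigr => K _.
by rewrite (gp K p Dp) (mulZr alg).
Qed.

Lemma smooth_even_part J : SE D (even_part J).
Proof.
split; first by apply: Cinf_part => K; exact: FC.
by apply: parity_part => K; exact: (smooth_even_up K).2.
Qed.

Lemma odd_odd_part J : parity b D (-1) (odd_part J).
Proof. by apply: parity_part => K; exact: odd_up0. Qed.

Let Cinf_odd_part J : Cinf D (odd_part J).
Proof. by apply: Cinf_part => K; exact: FC. Qed.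

Lemma smooth_even_quot J : SE D (divc b (odd_part J)).
Proof.
split; first exact: (Cinf_divc oD (Cinf_odd_part J) (odd_odd_part J)).
exact: (parity_divc Df (odd_odd_part J)).
Qed.

Lemma darboux_quot J p : D p -> darboux b 3 (divc b (odd_part J)) p = 0.
Proof.
apply: (darboux_of_harmonic oD Df (Cinf_odd_part J) (odd_odd_part J)) => {}p Dp.
rewrite -/(laplacian _ p).
rewrite (laplacian_sum oD) => [|K _ k|]; [|exact: (Cinf_mul _ (FC _))|exact: Dp].
rewrite big1 // => K _.
rewrite (eq_laplacian oD (fun p _ => LmE alg _ (F (up0 K) p)) Dp).
by rewrite (laplacian_mulmxr oD _ (FC _) Dp) Fharm // mul0mx.
Qed.

Lemma f_pt J1 J p : torus R d v ts (conc J1 J) -> D p ->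
  f (pt R d v ts (conc J1 J) p) =
  even_part J p + mul J1 (p 0 b *: divc b (odd_part J) p).
Proof.
move=> HJ Dp; rewrite fF.2 // (Ival_conc alg) (divcE (odd_odd_part J) Dp) //.
Qed.

Lemma f_pt_tail J q : torus R d v tst J -> Dt q ->
  f (pt R d v tst J q) = rfun 1 (even_part J) (divc b (odd_part J)) q.
Proof.
move=> HJ Dq; have [J1 HJ1 E] := x1_sphere v st q.
rewrite -(pt_dn st J E) f_pt //; last by apply/torus_conc.
by rewrite /rfun -E scale1r (mulZl alg) (mulZr alg).
Qed.

Let is_derive_conc J1 J j p : D p ->
  is_derive p (delta_mx 0 j)
    (fun p => even_part J p + mul J1 (p 0 b *: divc b (odd_part J) p))
    (partial j (even_part J) p + mul J1 (p 0 b *: partial j (divc b (odd_part J)) p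
       + ((b == j)%:R : R) *: divc b (odd_part J) p)).
Proof.
move=> Dp; apply: is_derive_addf.
  exact: (Ck_is_derive j ((smooth_even_part J).1 1%N) Dp).
rewrite [mul J1 (_ + _)](LmE alg).
rewrite (_ : (fun p => mul J1 _) = (fun p : 'rV[R]_n => (p 0 b *: divc b (odd_part J) p) *m Lm mul J1)); last first.
  by apply/funext => y; rewrite (LmE alg).
apply: is_derive_mulmxr; apply: is_deriveZW; first exact: is_derive_coord.
exact: (Ck_is_derive j ((smooth_even_quot J).1 1%N) Dp).
Qed.

(** T-regularity on the slice of [conc J1 J]. Along [ib] the derivative is [p 0 b *: radial P + J1
    (p 0 b ^+ 2 *: radial Q + Q)]; multiplying by [J1], of square [- one], leaves [J1] only through
    [p 0 b *: J1], which is [x1] in [dbar_tail]. *)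
Let dbar_conc J1 J p : torus R d v ts (conc J1 J) -> D p ->
  \sum_(j | j != b) mul (dirvec R d v ts (conc J1 J) j)
     (partial j (even_part J) p + mul (p 0 b *: J1) (partial j (divc b (odd_part J)) p))
  + mul (p 0 b *: J1) (radial b (even_part J) p)
  - p 0 b ^+ 2 *: radial b (divc b (odd_part J)) p - divc b (odd_part J) p = 0.
Proof.
move=> HJ Dp; have [_ sol] := T_regularP alg hyp st Dr HJ oD rf.
apply: etrans (sol p Dp).
have E j : partial j (f \o pt R d v ts (conc J1 J)) p = _ :=
  etrans (eq_partial j oD Dp (fun p Dp => f_pt HJ Dp)) (partial_val (is_derive_conc J1 J j Dp)).
rewrite [RHS](bigD1 b) //= [RHS]addrC -!addrA; congr (_ + _).
  apply: eq_bigr => j jb; rewrite -(LmE alg) E eq_sym (negbTE jb) scale0r addr0.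
  by rewrite (mulZl alg) (mulZr alg).
have /torus_conc[HJ1 _] := HJ.
have J1sq : mul J1 J1 = - one.
  apply: (sphere_sq alg hyp _ _ HJ1) => //.
  exact: (tn_N st (h := 1%N) isT).
rewrite -(LmE alg) E eqxx scale1r dirvec_ib.
rewrite (partial_radial oD Df (smooth_even_part J) Dp) (partial_radial oD Df (smooth_even_quot J) Dp).
rewrite (mulDr alg) (mulAA alg) J1sq (mulNl alg) (mul1l alg) (mulZl alg) (mulZr alg).
by rewrite scalerA -expr2 opprD addrA.
Qed.

(** Outside the block the two operators have the same terms. Over the block, the sum of [v s] times
    the derivatives along [s] is [x1 (radial P)] minus the squared norm of [x1] times [radial Q],
    minus [#|S|] times [Q]; the single direction [J1] in [dbar_conc] gives the same with one [Q].
    Subtracting leaves [1 - #|S|]. *)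
Lemma dbar_tail J q : torus R d v tst J -> Dt q ->
  \sum_i partial i (f \o pt R d v tst J) q *m EJ mul v J i =
  (1 - #|S|%:R) *: divc b (odd_part J) (dn q).
Proof.
move=> HJ Dq; have [J1 HJ1 E1] := x1_sphere v st q.
have HJ' : torus R d v ts (conc J1 J) by apply/torus_conc.
have Ef q' : Dt q' -> (f \o pt R d v tst J) q' = _ := fun Dq' => f_pt_tail HJ Dq'.
have Pi i : partial i (f \o pt R d v tst J) q =
    partial i (rfun 1 (even_part J) (divc b (odd_part J))) q :=
  eq_partial i oDt Dq Ef.
have PS := smooth_even_part J; have QS := smooth_even_quot J.
set P := even_part J in PS *; set Q := divc b (odd_part J) in QS *.
have out i : i \notin S -> partial i (f \o pt R d v tst J) q =
    partial (tgt i) P (dn q) + mul (x1 q) (partial (tgt i) Q (dn q)).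
  move=> iS; rewrite Pi (partial_val (is_derive_rfun
    (is_derive_dn_out tK tne sK (PS.1 1%N) Dq iS)
    (is_derive_dn_out tK tne sK (QS.1 1%N) Dq iS))).
  by rewrite (negbTE iS) addr0.
have inS i : i \in S -> partial i (f \o pt R d v tst J) q =
    q 0 i *: radial b P (dn q) + (mul (x1 q) (q 0 i *: radial b Q (dn q)) + mul (v i) (Q (dn q))).
  move=> iS; rewrite Pi (partial_val (is_derive_rfun
    (is_derive_dn_in so oD Df PS Dq iS)
    (is_derive_dn_in so oD Df QS Dq iS))).
  by rewrite iS.
rewrite (bigID (mem S)) /=.
have -> : \sum_(i | i \notin S) partial i (f \o pt R d v tst J) q *m EJ mul v J i =
   \sum_(j | j != b) mul (dirvec R d v ts (conc J1 J) j)
     (partial j P (dn q) + mul (x1 q) (partial j Q (dn q))).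
  rewrite (reindex_onto src tgt) => [|i iS]; last exact: tK.
  apply: eq_big => [j|j /andP[jS /eqP js]].
    have [->|jb] := eqVneq j b; last by rewrite so ?sK ?eqxx.
    apply/negbTE/negP => /andP[bS /eqP E]; have := tne bS.
    by rewrite E eqxx.
  by rewrite out // js -(LmE alg) -(dirvec_tgt v st J1 J jS) js.
have -> : \sum_(i in S) partial i (f \o pt R d v tst J) q *m EJ mul v J i =
   mul (x1 q) (radial b P (dn q)) - dn q 0 b ^+ 2 *: radial b Q (dn q) - #|S|%:R *: Q (dn q).
  have vsq i : i \in S -> mul (v i) (v i) = - one.
    rewrite inE => /andP[ai ib_]; have i0 := leq_ltn_trans (leq0n ta) ai.
    exact: (sphere_sq alg hyp i0 (leq_trans ib_ (tn_N st (h := 1%N) isT)) (sphere_v v i0)).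
  rewrite (eq_bigr (fun i => mul (q 0 i *: v i) (radial b P (dn q)) +
      (mul (q 0 i *: v i) (mul (x1 q) (radial b Q (dn q))) - Q (dn q)))); last first.
    move=> i iS; rewrite -(LmE alg) (dirvec_blockS _ _ iS) inS // !(mulDr alg).
    rewrite (mulAA alg (v i) (v i)) vsq // (mulNl alg) (mul1l alg).
    by rewrite !(mulZl alg) !(mulZr alg).
  rewrite big_split /= -(mul_suml alg) sumrB -(mul_suml alg) -/(x1 q).
  rewrite sumr_const scaler_nat (mulAA alg).
  have -> : mul (x1 q) (x1 q) = - (dn q 0 b ^+ 2 *: one).
    rewrite -E1 (mulZl alg) (mulZr alg).
    rewrite (sphere_sq alg hyp _ _ HJ1) //; last exact: (tn_N st (h := 1%N) isT).
    by rewrite scalerA -expr2 scalerN.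
  by rewrite (mulNl alg) (mulZl alg) (mul1l alg) addrA.
have := dbar_conc HJ' Dq; rewrite E1 -/P -/Q => H0.
apply/eqP; rewrite -subr_eq0; apply/eqP; apply: etrans H0.
have AC (X Y Z W Q' : A) : Y - Z - W + X - (Q' - W) = X + Y - Z - Q'.
  by apply/rowP => k; rewrite !mxE; ring.
by rewrite scalerBl scale1r AC.
Qed.

(** In the induced function [x1] stands to the right of J_K, in [f] to its left; the sign undoes the
    exchange, by [JK_x1]. *)
Definition stem0 (K : {set 'I_(tau tst)}) : 'rV[R]_m -> A :=
  rfun ((-1) ^+ #|K|) (F (up K)) (divc b (F (up0 K))).

Lemma Ival_rfun (P Q : {set 'I_(tau tst)} -> 'rV[R]_n -> A) J q : torus R d v tst J ->
  Ival R d mul v tst (fun K => rfun ((-1) ^+ #|K|) (P K) (Q K)) J q =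
  \sum_K mul (JK R d mul one (tau tst) J K) (P K (dn q))
  + mul (x1 q) (\sum_K mul (JK R d mul one (tau tst) J K) (Q K (dn q))).
Proof.
move=> HJ; rewrite (mul_sumr alg) -big_split; apply: eq_bigr => K _ /=.
rewrite /rfun (mulDr alg) (mulZr alg) !(mulAA alg) (JK_x1 alg hyp st) //.
by rewrite (mulZl alg) scalerA -expr2 sqrr_sign scale1r.
Qed.

Lemma lift_neq_b (h : 'I_(tau tst)) : ri (ts := ts) (lift ord0 h) != b.
Proof. by rewrite (inj_eq (@ri_inj ts)) eq_sym neq_lift. Qed.

Lemma stem_stem0 : stem R d tst Dt stem0.
Proof.
apply: parity_stem => K h q Dq; rewrite /stem0 /rfun (flip_dn st) x1_flip.
have Dfh p : D p -> D (flip (ri (ts := ts) (lift ord0 h)) p).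
  exact: (D_flip Dr (lift ord0 h : 'I_(tau ts))).
have P1 := @stem_parity R d ts D F (up K) (lift ord0 h) fF.1.
have P2 := @stem_parity R d ts D F (up0 K) (lift ord0 h) fF.1.
rewrite (lift_up K h : (lift ord0 h : 'I_(tau ts)) \in up K = _) in P1.
rewrite (lift_up0 K h : (lift ord0 h : 'I_(tau ts)) \in up0 K = _) in P2.
rewrite P1 // (parity_divc_other oD Dfh (lift_neq_b h) (FC _ 1%N) P2) //.
by rewrite (mulZr alg) scalerDr !scalerA [_ * (if _ then _ else _)]mulrC.
Qed.

Lemma tfun_of_stem0 : tfun_of R d mul v tst Dt f stem0.
Proof.
split; first exact: stem_stem0.
move=> q J Dq HJ; rewrite f_pt_tail // (Ival_rfun _ _ _ HJ) /rfun scale1r; congr (_ + _).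
have [J1 HJ1 <-] := x1_sphere v st q.
rewrite !(mulZl alg) -!(mulZr alg); congr (mul J1 _).
rewrite (divcE (odd_odd_part J)) // scaler_sumr; apply: eq_bigr => K _.
by rewrite -(mulZr alg) (divcE (odd_up0 K)).
Qed.

Lemma Cinf_stem0 K : Cinf Dt (stem0 K).
Proof. exact: (Cinf_rfun _ (smooth_even_up K) (smooth_even_up0 K)). Qed.

(** * The transform and its regularity *)

Variable n1 : nat.
Hypothesis cardS : #|S| = n1.*2.+1.
Variable G : {set 'I_(tau tst)} -> 'rV[R]_m -> A.
Hypothesis fG : tfun_of R d mul v tst Dt f G.
Hypothesis GC : forall K, Cinf Dt (G K).

Let st' := steps_tail st.
Local Notation lap := (@laplacian R m A).
Local Notation G' := (iter n1 (lapS R d tst) G).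
Local Notation g := (Ical R d mul v tst Dt G').

Lemma stem_unique0 K q : Dt q -> G K q = stem0 K q.
Proof.
apply: (stem_unique alg hyp st' Dt_refl K fG.1 stem_stem0 (torus_nonempty v st')) => {}q Dq.
have HJ := torus_nonempty v st'.
by rewrite -fG.2 // -(tfun_of_stem0).2.
Qed.

Lemma stem_G' : stem R d tst Dt G'.
Proof.
apply: parity_stem => K h; rewrite iter_lapS; apply: (parity_iter_laplacian oDt).
- exact: (D_flip Dt_refl h).
- exact: GC.
- exact: (stem_parity K h fG.1).
Qed.

Lemma g_pt J q : torus R d v tst J -> Dt q ->
  g (pt R d v tst J q) = Ival R d mul v tst G' J q.
Proof. exact: (Ical_pt alg hyp st' Dt_refl stem_G'). Qed.

(** On a fixed slice the J_K are constants, so the Laplacian of stem functions is the ordinary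
    Laplacian in the coordinates of the slice. *)
Lemma g_pt_laplacian J q : torus R d v tst J -> Dt q ->
  (g \o pt R d v tst J) q = iter n1 lap (f \o pt R d v tst J) q.
Proof.
move=> HJ Dq; rewrite /= g_pt //.
have Ef q' : Dt q' -> (f \o pt R d v tst J) q' =
    \sum_K G K q' *m Lm mul (JK R d mul one (tau tst) J K).
  by move=> Dq'; rewrite /= fG.2 //; apply: eq_bigr => K _; rewrite (LmE alg).
rewrite (eq_iter_laplacian oDt n1 Ef Dq) (iter_laplacian_sum oDt) //; last first.
  by move=> K k; exact: (Ck_mulmxr _ oDt (GC K k)).
apply: eq_bigr => K _; rewrite iter_lapS (LmE alg).
by rewrite (iter_laplacian_mulmxr oDt).
Qed.

Lemma Cinf_f_pt J : torus R d v tst J -> Cinf Dt (f \o pt R d v tst J).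
Proof.
move=> HJ k; apply: (Ck_eq oDt (g := rfun 1 (even_part J) (divc b (odd_part J)))).
  by move=> q Dq; rewrite -f_pt_tail.
exact: (Cinf_rfun _ (smooth_even_part J) (smooth_even_quot J)).
Qed.

Lemma solution_g J : torus R d v tst J ->
  solution (EJ mul v J) Dt (g \o pt R d v tst J).
Proof.
move=> HJ; have uC := Cinf_f_pt HJ; set u := f \o _ in uC.
have gE q : Dt q -> iter n1 lap u q = (g \o pt R d v tst J) q.
  by move=> Dq; rewrite g_pt_laplacian.
split; first exact: (Ck_eq oDt gE (Cinf_iter_laplacian oDt n1 uC 1%N)).
move=> q Dq.
have E i : partial i (g \o pt R d v tst J) q *m EJ mul v J i =
    iter n1 lap (fun q => partial i u q *m EJ mul v J i) q.
  rewrite -(eq_partial i oDt Dq gE) (partial_iter_laplacian oDt) //.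
  by rewrite (iter_laplacian_mulmxr oDt) // => k; exact: (Ck_partial i (uC k.+1)).
rewrite (eq_bigr _ (fun i _ => E i)) -(iter_laplacian_sum oDt) //; last first.
  by move=> i k; apply: (Ck_mulmxr _ oDt); exact: (Ck_partial i (uC k.+1)).
set Q := divc b (odd_part J).
have dE q' : Dt q' -> \sum_i partial i u q' *m EJ mul v J i =
    (Q \o dn) q' *m (1 - #|S|%:R)%:M.
  by move=> Dq'; rewrite dbar_tail // mul_mx_scalar.
have QS := smooth_even_quot J.
have QC := Cinf_dn so tK tne sK oD Df QS.
rewrite (eq_iter_laplacian oDt n1 dE Dq) (iter_laplacian_mulmxr oDt) //.
(* For [n1 = 0] the block is a single coordinate and the factor [1 - #|S|] vanishes; otherwise the
   Laplacians annihilate [Q \o dn]. *)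
case: n1 cardS => [|k] cS; first by rewrite cS subrr raddf0 mulmx0.
rewrite (iter_laplacian_dn_eq0 so tK tne sK oD Df cS QS) ?mul0mx //.
exact: darboux_quot.
Qed.

Lemma SR_g : SR R d mul v tst Dt g.
Proof.
split; last exact: (T_regular_intro alg hyp st' Dt_refl solution_g).
by exists G'; split; [exact: stem_G'|move=> q J Dq HJ; exact: g_pt].
Qed.

Lemma analytic_growth_G' K : analytic_growth Dt (G' K).
Proof.
have HJ := torus_nonempty v st'; set J := (fun h => _) in HJ.
move: K; apply: (stem_component alg hyp st' Dt_refl _ _ _ _ stem_G' HJ).
- by move=> f1 f2; exact: (analytic_growthD oDt).
- by move=> M f1; exact: (analytic_growth_mulmxr oDt).
- move=> c f1 Dc.
  apply: (analytic_growth_comp_coord (sg := id) (flip_line c) (@continuous_flip _ _ c) _ oDt oDt Dc).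
  by move=> i; case: ifP => _; rewrite ?normrN normr1.
- by move=> f1 f2; exact: (analytic_growth_eq oDt).
apply: (analytic_growth_eq oDt (g := g \o pt R d v tst J)).
  by move=> q Dq; exact: g_pt.
have sol := solution_g HJ; have EE := EJ_elliptic alg hyp st' HJ.
split; first exact: (solution_Cinf EE oDt sol).
by move=> q Dq; exact: (solution_growth EE oDt sol Dq).
Qed.

(** * The transform as an analytic T-function *)

Local Notation P' K := (iter n1 (darboux b #|S|%:R) (F (up K))).
Local Notation Q' K := (iter n1 (darboux b (#|S|%:R + 2)) (divc b (F (up0 K)))).

Let SE_iter c k (H : 'rV[R]_n -> A) : SE D H -> SE D (iter k (darboux b c) H).
Proof. by move=> HS; elim: k => //= k; exact: (smooth_even_darboux oD Df). Qed.

Let P'_flip (K : {set 'I_(tau tst)}) p : D p -> P' K (flip b p) = P' K p.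
Proof. by move=> Dp; have [_ ->] := SE_iter #|S|%:R n1 (smooth_even_up K); rewrite ?scale1r. Qed.

Let Q'_flip (K : {set 'I_(tau tst)}) p : D p -> Q' K (flip b p) = Q' K p.
Proof. by move=> Dp; have [_ ->] := SE_iter (#|S|%:R + 2) n1 (smooth_even_up0 K); rewrite ?scale1r. Qed.

Lemma iter_lapS_rfun K q : Dt q -> G' K q = rfun ((-1) ^+ #|K|) (P' K) (Q' K) q.
Proof.
move=> Dq; rewrite iter_lapS (eq_iter_laplacian oDt n1 (@stem_unique0 K) Dq).
exact: (iter_laplacian_rfun _ _ (smooth_even_up K) (smooth_even_up0 K) Dq).
Qed.

(** For [c] of norm 1, a linear section of [dn] up to the sign of [p 0 b]: the block receives
    [p 0 b] times the unit vector with coordinates [c]. The evenness of [P'] and [Q'] makes the sign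
    immaterial. *)
Definition emb (c : nat -> R) (p : 'rV[R]_n) : 'rV[R]_m :=
  \row_i (if i \in S then p 0 b * c i else p 0 (tgt i)).

Section Embedding.
Variable c : nat -> R.
Hypothesis c1 : \sum_(ta.+1 <= s < tb.+1) c s ^+ 2 = 1.

Let dn_emb_out p j : j != b -> dn (emb c p) 0 j = p 0 j.
Proof. by move=> jb; rewrite !mxE (negbTE jb) (negbTE (so jb)) sK. Qed.

Lemma dn_emb p : dn (emb c p) = p \/ dn (emb c p) = flip b p.
Proof.
have E : dn (emb c p) 0 b = `|p 0 b|.
  rewrite dn_b -sqrtr_sqr; congr Num.sqrt; rewrite -[RHS]mulr1 -c1.
  rewrite (blockS_big ta tb l _ (fun s => c s ^+ 2)) mulr_sumr.
  by apply: eq_bigr => s sS; rewrite mxE sS exprMn.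
case: (lerP 0 (p 0 b)) => pb; [left|right]; apply/rowP => j.
  have [->|jb] := eqVneq j b; last by rewrite dn_emb_out.
  by rewrite E ger0_norm.
have [->|jb] := eqVneq j b; last by rewrite dn_emb_out // mxE (negbTE jb).
by rewrite E ltr0_norm // mxE eqxx.
Qed.

Lemma x1_emb p : x1 (emb c p) = p 0 b *: (\sum_(ta.+1 <= s < tb.+1) c s *: v s).
Proof.
rewrite (blockS_big ta tb l _ (fun s => c s *: v s)) scaler_sumr.
by apply: eq_bigr => s sS; rewrite mxE sS scalerA.
Qed.

Lemma pt_emb J p :
  pt R d v ts (conc (\sum_(ta.+1 <= s < tb.+1) c s *: v s) J) p = pt R d v tst J (emb c p).
Proof.
have vc_dn k : k != ta.+1 -> vc R n p k = vc R n (dn (emb c p)) k.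
  move=> kb; have [kn|kn] := ltnP k n.
    by rewrite !(vc_lt _ kn) dn_emb_out // -val_eqE val_ib.
  by rewrite /vc insubN // -leqNgt.
apply: (pt_split st) => [s sa|h hl|].
- by rewrite vc_dn ?(dn_low st) // ltn_eqF.
- by rewrite vc_dn ?(dn_high st) // addSn gtn_eqF // ltnS leq_addr.
- by rewrite x1_emb.
Qed.

Lemma Dt_emb p : D p -> Dt (emb c p).
Proof. by move=> Dp /=; case: (dn_emb p) => -> //; exact: Df. Qed.

Lemma rfun_emb e K p : D p -> rfun e (P' K) (Q' K) (emb c p) =
  P' K p + e *: mul (p 0 b *: \sum_(ta.+1 <= s < tb.+1) c s *: v s) (Q' K p).
Proof.
by move=> Dp; rewrite /rfun x1_emb; case: (dn_emb p) => ->; rewrite ?P'_flip ?Q'_flip.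
Qed.

Lemma emb_flip (h : 'I_(tau tst)) p :
  emb c (flip (ri (ts := ts) (lift ord0 h)) p) = flip (ri h) (emb c p).
Proof.
have tab := ta_tb st; apply/rowP => i; rewrite !mxE eq_sym (negbTE (lift_neq_b h)).
case: ifP => iS.
  rewrite ifF //; apply/negbTE; move: iS; rewrite inE -val_eqE /= /t0 /=; lia.
have -> : (tgt i == ri (ts := ts) (lift ord0 h)) = (i == ri h); last by [].
rewrite -!val_eqE /= /bump leq0n /t0 /= (val_tgt st); last by rewrite iS.
have [] := notin_blockS (negbT iS) => H; rewrite ?H.
  by apply/eqP/eqP; lia.
by rewrite ifF; [apply/eqP/eqP; lia|apply/negbTE; rewrite -leqNgt; lia].
Qed.

End Embedding.

Definition stem_T (L : {set 'I_(tau ts)}) (p : 'rV[R]_n) : A :=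
  let K := down_set (L : {set 'I_(tau tst).+1}) in
  if (ord0 : 'I_(tau ts)) \in L then p 0 b *: Q' K p else P' K p.

Let c0 s : R := (s == tb)%:R.

Let mem_tb : tb \in index_iota ta.+1 tb.+1.
Proof. by rewrite mem_index_iota ltnS (ta_tb st) leqnn. Qed.

Let c0_sq : \sum_(ta.+1 <= s < tb.+1) c0 s ^+ 2 = 1.
Proof.
rewrite (bigD1_seq tb) ?iota_uniq //= /c0 eqxx expr1n big1 ?addr0 // => s /negbTE ->.
by rewrite expr0n.
Qed.

Let c0_v : \sum_(ta.+1 <= s < tb.+1) c0 s *: v s = v tb.
Proof.
rewrite (bigD1_seq tb) ?iota_uniq //= /c0 eqxx scale1r big1 ?addr0 // => s /negbTE ->.
by rewrite scale0r.
Qed.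

Let vtb_sq : mul (v tb) (v tb) = - one.
Proof.
have tb0 := leq_ltn_trans (leq0n ta) (ta_tb st).
exact: (sphere_sq alg hyp tb0 (tn_N st (h := 1%N) isT) (sphere_v v tb0)).
Qed.

Let comb (e : R) (M : 'M[R]_d) K p :=
  (G' K (emb c0 p) + G' K (emb c0 (flip b p)) *m e%:M) *m M.

(* On [D] the components are the even and odd parts of [G' K] in the variable
   [b], read along the direction [v tb] of the block. *)
Let stem_T_comb L : exists e M, forall p, D p ->
  comb e M (down_set (L : {set 'I_(tau tst).+1})) p = stem_T L p.
Proof.
rewrite /stem_T; set K := down_set _; set s : R := (-1) ^+ #|K|.
have E p : D p -> G' K (emb c0 p) = P' K p + s *: (p 0 b *: mul (v tb) (Q' K p)).
  move=> Dp; rewrite iter_lapS_rfun; last exact: (Dt_emb c0_sq).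
  by rewrite (rfun_emb c0_sq) // c0_v (mulZl alg).
have E' p : D p -> G' K (emb c0 (flip b p)) = P' K p - s *: (p 0 b *: mul (v tb) (Q' K p)).
  move=> Dp; rewrite E; last exact: Df.
  by rewrite P'_flip // Q'_flip // mxE eqxx scaleNr scalerN.
case: ((ord0 : 'I_(tau ts)) \in L).
  (* The difference of the two values is [2 s (p 0 b)] times [v tb] times [Q' K p]; since [s] and
     [v tb] have squares 1 and [- one], this factor leaves [p 0 b *: Q' K p]. *)
  exists (-1), ((- (s / 2)) *: Lm mul (v tb)) => p Dp.
  rewrite /comb E // E' // mul_mx_scalar scaleN1r opprD opprK addrACA subrr add0r.
  rewrite -mulr2n -[_ *+ 2]scaler_nat -scalemxAr -(LmE alg) !(mulZr alg).
  rewrite (mulAA alg) vtb_sq (mulNl alg) (mul1l alg) !scalerA scalerN -scaleNr.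
  congr (_ *: _); have : s * s = 1 by rewrite -expr2 sqrr_sign.
  move=> ss; transitivity (s * s * p 0 b); last by rewrite ss GRing.mul1r.
  by field.
exists 1, (2^-1)%:M => p Dp.
rewrite /comb E // E' // mulmx1 addrACA subrr addr0 mul_mx_scalar.
by apply/rowP => k; rewrite !mxE; field.
Qed.

(** In the first variable the parity is visible in the definition. In the others it is inherited
    from [G'] through [comb], because [emb] and [flip b] commute with those reflections. *)
Lemma stem_stem_T : stem R d ts D stem_T.
Proof.
apply: parity_stem => L h.
have [h' ->|->] := unliftP (ord0 : 'I_(tau tst).+1) h; last first.
  move=> p Dp; rewrite /stem_T; case: ifP => _.
    by rewrite Q'_flip // mxE eqxx scaleN1r scaleNr.
  by rewrite P'_flip // scale1r.
have Dh p : D p -> D (flip (ri (ts := ts) (lift ord0 h')) p).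
  exact: (D_flip Dr (lift ord0 h' : 'I_(tau ts))).
have [e [M H]] := stem_T_comb L; move=> p Dp.
rewrite -(H _ (Dh _ Dp)) -(H _ Dp) /comb.
have -> : flip b (flip (ri (ts := ts) (lift ord0 h')) p) =
    flip (ri (ts := ts) (lift ord0 h')) (flip b p).
  by apply/rowP => i; rewrite !mxE; case: ifP; case: ifP.
rewrite !emb_flip; set K := down_set _.
have Gp := stem_parity K h' stem_G'.
have -> : (lift ord0 h' : 'I_(tau ts)) \in L = (h' \in K) by rewrite inE.
rewrite Gp; last exact: (Dt_emb c0_sq).
rewrite Gp; last by apply: (Dt_emb c0_sq); exact: Df.
by rewrite -scalemxAl -scalerDr -scalemxAl.
Qed.

Let itb : 'I_m := Ordinal (leq_addr _ _ : (tb < m)%N).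

Let itb_S : itb \in S.
Proof. by rewrite inE /= (ta_tb st) leqnn. Qed.

Let emb_line j x (h : R) : emb c0 (h *: delta_mx 0 j + x) =
  (h * 1) *: delta_mx 0 (if j == b then itb else src j) + emb c0 x.
Proof.
apply/rowP => i; rewrite !mxE mulr1 !eqxx /=; case: ifP => iS; case: (eqVneq j b) => jb.
- by rewrite /c0 -(inj_eq val_inj i itb) /=; ring.
- rewrite (_ : i == src j = false); first by rewrite /=; ring.
  by apply/negbTE/eqP => ij; move: (so jb); rewrite -ij iS.
- rewrite jb (negbTE (tne (negbT iS))) (_ : i == itb = false) //.
  by apply/negbTE/eqP => ij; move: iS; rewrite ij itb_S.
- congr (h * _%:R + _); congr nat_of_bool; apply/eqP/eqP => [<-|->]; rewrite ?tK ?sK //.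
  exact: negbT.
Qed.

Let emb_cont : continuous (emb c0).
Proof.
move=> x; apply/continuous_distP => e e0; exists e => // y xy.
apply: normr_row_lt => // i; rewrite !mxE.
have H j : `|y 0 j - x 0 j| < e.
  by apply: le_lt_trans xy; have := normr_coord (y - x) j; rewrite !mxE.
case: ifP => _ //; rewrite -mulrBl normrM; apply: le_lt_trans (H b).
by rewrite ler_piMr // /c0; case: eqP; rewrite ?normr1 ?normr0.
Qed.

(** [comb] involves [G'] only through [emb c0] and [flip b], which send coordinate directions to
    multiples, of size at most 1, of coordinate directions; so the bounds on [G'] descend without
    passing through the square root in [dn]. *)
Lemma analytic_growth_stem_T L : analytic_growth D (stem_T L).
Proof.
have [e [M H]] := stem_T_comb L; apply: (analytic_growth_eq oD H).
apply: (analytic_growth_mulmxr oD); set K := down_set _.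
have GE : analytic_growth D (fun p => G' K (emb c0 p)).
  apply: (analytic_growth_comp_coord emb_line emb_cont _ oDt oD (Dt_emb c0_sq)).
    by move=> i; rewrite normr1.
  exact: analytic_growth_G'.
apply: (analytic_growthD oD) => //; apply: (analytic_growth_mulmxr oD).
apply: (analytic_growth_comp_coord (sg := id) (flip_line b) (@continuous_flip _ _ b) _ oD oD Df GE).
by move=> i; case: ifP => _; rewrite ?normrN normr1.
Qed.

(** An arbitrary first component of J has coordinates [c] in the block, and [emb c] presents the
    same point of V for the shorter list. There [g] is a sum of J_K [P' K] plus [x1] times a sum of
    J_K [Q' K], and [x1] is [p 0 b] times that component: these are the terms without and with the
    first index. *)
Lemma S_omega_g : S_omega R d mul v ts D g.
Proof.
exists stem_T; split; last first.
  by move=> L; exact: (analytic_growth_analytic oD (analytic_growth_stem_T L)).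
split; first exact: stem_stem_T.
move=> p J Dp; rewrite -(concE J); set Jt := fun h => _; move=> HJ.
have /torus_conc[HJ1 HJt] := HJ; have [c [EJ1 c1]] := HJ1.
have Dq := Dt_emb c1 Dp.
rewrite EJ1 pt_emb g_pt // (Ival_conc alg) /Ival.
rewrite (eq_bigr (fun K => mul (JK R d mul one (tau tst) Jt K)
   (rfun ((-1) ^+ #|K|) (P' K) (Q' K) (emb c p)))); last first.
  by move=> K _; rewrite iter_lapS_rfun.
have := Ival_rfun (fun K => P' K) (fun K => Q' K) (emb c p) HJt; rewrite /Ival => ->.
rewrite x1_emb (mulZl alg) -(mulZr alg) scaler_sumr; congr (_ + mul _ _).
  apply: eq_bigr => K _; rewrite /stem_T.
  rewrite (ord0_up K : (ord0 : 'I_(tau ts)) \in up K = false) down_upK.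
  by case: (dn_emb c1 p) => ->; rewrite ?P'_flip.
apply: eq_bigr => K _; rewrite /stem_T.
rewrite (ord0_up0 K : (ord0 : 'I_(tau ts)) \in up0 K = true) down_up0K (mulZr alg).
by case: (dn_emb c1 p) => ->; rewrite ?Q'_flip.
Qed.

End FirstFueter.

Unset Implicit Arguments.

Theorem theorem7p2 (R : realType) (d N : nat)
    (mul : 'rV[R]_d -> 'rV[R]_d -> 'rV[R]_d) (conj : 'rV[R]_d -> 'rV[R]_d)
    (v : nat -> 'rV[R]_d) (ts : seq nat) (D : set 'rV[R]_(dimD ts)) (n1 : nat) :
  real_algebra R d mul (v 0%N) ->
  star_involution R d mul conj ->
  hypercomplex_basis R d mul conj N v ->
  steps N ts -> (2 <= size ts)%N ->
  open D ->
  (forall (h : 'I_(tau ts)) (p : 'rV[R]_(dimD ts)), D p -> D (refl R ts h p)) ->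
  domain_in R d (Vspace R d N v) (Omega R d v ts D) ->
  (nth 0%N ts 1 - nth 0%N ts 0)%N = n1.*2.+1 ->
  forall f : 'rV[R]_d -> 'rV[R]_d,
    SR R d mul v ts D f ->
    (exists G, tfun_of R d mul v (behead ts) (Dtilde R ts D) f G /\
               forall K, Cinf_on R d (dimD (behead ts)) (Dtilde R ts D) (G K)) /\
    (forall G, tfun_of R d mul v (behead ts) (Dtilde R ts D) f G ->
               (forall K, Cinf_on R d (dimD (behead ts)) (Dtilde R ts D) (G K)) ->
       let g := Ical R d mul v (behead ts) (Dtilde R ts D)
                  (iter n1 (lapS R d (behead ts)) G) in
       SR R d mul v (behead ts) (Dtilde R ts D) g /\ S_omega R d mul v ts D g).
Proof.
case: ts D => [//|ta [//|tb l]] D alg _ hyp st _ oD Dr _ cardN f [[F fF] rf].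
have -> : Dtilde R (ta :: tb :: l) D =
    [set q | D (dn (ib ta tb l) (blockS ta tb l) (@src ta tb l) q)].
  by apply/funext => q; rewrite /Dtilde /= (downE st).
have cS : #|blockS ta tb l| = n1.*2.+1 by rewrite card_blockS.
split=> [|G fG GC].
  exists (stem0 mul v F); split; first exact: (tfun_of_stem0 alg hyp st oD Dr fF rf).
  by move=> K; apply/Cinf_onP; exact: (Cinf_stem0 alg hyp st oD Dr fF rf).
have {}GC K := (Cinf_onP _ _).1 (GC K).
split; first exact: (SR_g alg hyp st oD Dr fF rf cS fG GC).
exact: (S_omega_g alg hyp st oD Dr fF rf cS fG GC).
Qed.
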